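(* Let $\varepsilon=\varepsilon(n,m)\in(0,1/100)$ be efficiently computable, let $1\le p\le q\le\infty$, and let $\gamma=\gamma(n,m)\ge 1$. Then there is a $(\gamma^4\cdot 2^{\varepsilon m}\cdot\mathrm{poly}(m))$-time reduction from $\gamma'$-$\mathsf{SVP}_q$ to $\gamma$-$\mathsf{SVP}_p$, where \[\gamma' := 100\,\log^{1/p}(1/\varepsilon)\cdot \gamma/\varepsilon^{1/p}.\] The reduction preserves the dimension and rank of the lattice and only calls its oracle on sublattices of the input lattice.
   Context: A lattice of rank $n$ in $\mathbb{R}^m$ (dimension $m$) is $\mathcal{L}(\mathbf{B})=\{\sum_{i=1}^n z_i\mathbf{b}_i: z_i\in\mathbb{Z}\}$ for linearly independent $\mathbf{b}_1,\dots,\mathbf{b}_n\in\mathbb{R}^m$ (a basis). For $1\le p<\infty$, $\|\mathbf{x}\|_p=(\sum_i|x_i|^p)^{1/p}$, and $\|\mathbf{x}\|_\infty=\max_i|x_i|$. $\lambda_1^{(p)}(\mathcal{L})=\min_{\mathbf{x}\in\mathcal{L}\setminus\{\mathbf{0}\}}\|\mathbf{x}\|_p$. For $\gamma\ge1$, $\gamma$-$\mathsf{SVP}_p$ is the search problem: given a basis of a lattice $\mathcal{L}$, output $\mathbf{v}\in\mathcal{L}$ with $0<\|\mathbf{v}\|_p\le\gamma\lambda_1^{(p)}(\mathcal{L})$. A $T$-time reduction from problem A to problem B is a (randomized) algorithm running in time $T$ that solves A given access to an oracle solving B. *)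

(* Defs.v *)
From HB Require Import structures.
From Stdlib Require List.
From mathcomp Require Import all_boot all_order all_algebra.
From mathcomp Require Import all_classical all_reals all_analysis.

Set Implicit Arguments.
Unset Strict Implicit.
Unset Printing Implicit Defensive.

Import Order.TTheory GRing.Theory Num.Theory.

Local Open Scope classical_set_scope.
Local Open Scope ring_scope.

(** * Norms, lattices and the search problem SVP *)

(* The junk value at -oo is never used: exponents satisfy 1 <= p. *)
Definition lpnorm (R : realType) (p : \bar R) (m : nat) (x : 'rV[R]_m) : R :=
  match p with
  | EFin r => (\sum_j `|x 0 j| `^ r) `^ r^-1
  | +oo%E => \big[Num.max/0]_j `|x 0 j|
  | -oo%E => 0
  end.

(* 1/p, with the convention 1/oo = 0 *)
Definition inv_exponent (R : realType) (p : \bar R) : R :=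
  if p is EFin r then r^-1 else 0.

(* The rows of B are the basis vectors b_1, ..., b_n in R^m. *)
Definition lattice (R : realType) (n m : nat) (B : 'M[R]_(n, m))
  : set 'rV[R]_m :=
  [set x | exists z : 'rV[int]_n, x = map_mx intr z *m B].

(* The infimum is attained when the lattice has positive rank. *)
Definition lambda1 (R : realType) (p : \bar R) (m : nat) (L : set 'rV[R]_m)
  : R :=
  inf [set lpnorm p x | x in [set x | L x /\ x != 0]].

Definition SVP_solution (R : realType) (p : \bar R) (g : R) (n m : nat)
    (B : 'M[R]_(n, m)) (v : 'rV[R]_m) : Prop :=
  [/\ lattice B v, 0 < lpnorm p v & lpnorm p v <= g * lambda1 p (lattice B)].

Definition oracle (R : realType) : Type :=
  forall n m : nat, 'M[R]_(n, m) -> 'rV[R]_m.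

(* Nothing is required on inputs that are not bases, nor in rank 0, where no
   solution exists. *)
Definition solves_SVP (R : realType) (p : \bar R) (g : nat -> nat -> R)
    (O : oracle R) : Prop :=
  forall (n m : nat) (B : 'M[R]_(n, m)), (0 < n)%N -> row_free B ->
    SVP_solution p (g n m) B (O n m B).

(** * Model of computation

   Lattice bases have real entries and running times are measured in terms of
   the rank and dimension only, so the model is the real RAM: a program works
   on indexed memories of naturals and of reals; exact real arithmetic,
   including exp and ln, has unit cost, reals cannot be rounded to integers,
   and only naturals can be used as addresses.  Natural-number arithmetic is
   charged logarithmically (each value that is computed costs its bit length),
   so that large integers give no unrealistic speed-up.  Programs are finite
   syntactic objects, whose only constants are natural numbers; a single
   program handles all ranks and dimensions. *)

(* The first argument of NGet and RGet is the name of an array, the second one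
   an index in it. *)
Inductive nexpr : Type :=
| NConst of nat
| NGet of nat & nexpr
| NAdd of nexpr & nexpr
| NSub of nexpr & nexpr
| NMul of nexpr & nexpr
| NDiv of nexpr & nexpr
| NMod of nexpr & nexpr.

Inductive rexpr : Type :=
| RNat of nexpr
| RGet of nat & nexpr
| RAdd of rexpr & rexpr
| RSub of rexpr & rexpr
| RMul of rexpr & rexpr
| RDiv of rexpr & rexpr
| RExp of rexpr
| RLn of rexpr.

Inductive test : Type :=
| TNLe of nexpr & nexpr
| TRLe of rexpr & rexpr
| TNot of test.

(* Flip a i stores a uniformly random bit in cell i of the natural array a;
   Query n m a b reads an n x m matrix (row-major) from the real array a and
   stores the oracle's answer in the real array b. *)
Inductive cmd : Type :=
| Skip
| NSet of nat & nexpr & nexpr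
| RSet of nat & nexpr & rexpr
| Seq of cmd & cmd
| If of test & cmd & cmd
| While of test & cmd
| Flip of nat & nexpr
| Query of nexpr & nexpr & nat & nat.

Inductive query (R : realType) : Type :=
| MkQuery (n m : nat) of 'M[R]_(n, m).

(* coins: the random bits still to be read; clock: the time spent so far;
   asked: the oracle queries made so far *)
Record state (R : realType) : Type := State {
  nmem : nat -> nat -> nat;
  rmem : nat -> nat -> R;
  coins : seq bool;
  clock : nat;
  asked : seq (query R)
}.

Definition store (T : Type) (mem : nat -> nat -> T) (a i : nat) (v : T)
  : nat -> nat -> T :=
  fun b j => if (b == a) && (j == i) then v else mem b j.

Fixpoint neval (mem : nat -> nat -> nat) (e : nexpr) : nat :=
  match e with
  | NConst k => k
  | NGet a i => mem a (neval mem i)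
  | NAdd e1 e2 => (neval mem e1 + neval mem e2)%N
  | NSub e1 e2 => (neval mem e1 - neval mem e2)%N
  | NMul e1 e2 => (neval mem e1 * neval mem e2)%N
  | NDiv e1 e2 => (neval mem e1 %/ neval mem e2)%N
  | NMod e1 e2 => (neval mem e1 %% neval mem e2)%N
  end.

Definition bitlen (k : nat) : nat := (trunc_log 2 k).+1.

Fixpoint ncost (mem : nat -> nat -> nat) (e : nexpr) : nat :=
  (bitlen (neval mem e) +
   match e with
   | NConst _ => 0
   | NGet _ i => ncost mem i
   | NAdd e1 e2 | NSub e1 e2 | NMul e1 e2 | NDiv e1 e2 | NMod e1 e2 =>
       ncost mem e1 + ncost mem e2
   end)%N.

Fixpoint reval (R : realType) (s : state R) (e : rexpr) : R :=
  match e with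
  | RNat k => (neval (nmem s) k)%:R
  | RGet a i => rmem s a (neval (nmem s) i)
  | RAdd e1 e2 => reval s e1 + reval s e2
  | RSub e1 e2 => reval s e1 - reval s e2
  | RMul e1 e2 => reval s e1 * reval s e2
  | RDiv e1 e2 => reval s e1 / reval s e2
  | RExp e1 => expR (reval s e1)
  | RLn e1 => ln (reval s e1)
  end.

Fixpoint rcost (mem : nat -> nat -> nat) (e : rexpr) : nat :=
  match e with
  | RNat k => (ncost mem k).+1
  | RGet _ i => (ncost mem i).+1
  | RAdd e1 e2 | RSub e1 e2 | RMul e1 e2 | RDiv e1 e2 =>
      (rcost mem e1 + rcost mem e2).+1
  | RExp e1 | RLn e1 => (rcost mem e1).+1
  end.

Fixpoint teval (R : realType) (s : state R) (t : test) : bool :=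
  match t with
  | TNLe e1 e2 => (neval (nmem s) e1 <= neval (nmem s) e2)%N
  | TRLe e1 e2 => reval s e1 <= reval s e2
  | TNot t1 => ~~ teval s t1
  end.

Fixpoint tcost (mem : nat -> nat -> nat) (t : test) : nat :=
  match t with
  | TNLe e1 e2 => (ncost mem e1 + ncost mem e2).+1
  | TRLe e1 e2 => (rcost mem e1 + rcost mem e2).+1
  | TNot t1 => (tcost mem t1).+1
  end.

Definition tick (R : realType) (k : nat) (s : state R) : state R :=
  State (nmem s) (rmem s) (coins s) (clock s + k) (asked s).

Definition set_nat (R : realType) (a i v : nat) (s : state R) : state R :=
  State (store (nmem s) a i v) (rmem s) (coins s) (clock s) (asked s).

Definition set_real (R : realType) (a i : nat) (v : R) (s : state R)
  : state R :=
  State (nmem s) (store (rmem s) a i v) (coins s) (clock s) (asked s).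

Definition pop_coin (R : realType) (s : state R) : state R :=
  State (nmem s) (rmem s) (behead (coins s)) (clock s) (asked s).

Definition read_matrix (R : realType) (s : state R) (a n m : nat)
  : 'M[R]_(n, m) :=
  \matrix_(i < n, j < m) rmem s a (i * m + j)%N.

Definition read_vector (R : realType) (s : state R) (a m : nat) : 'rV[R]_m :=
  \row_(j < m) rmem s a j.

Definition write_vector (R : realType) (mem : nat -> nat -> R) (a m : nat)
    (v : 'rV[R]_m) : nat -> nat -> R :=
  fun b j =>
    if b == a then (if insub j is Some j' then v 0 j' else mem b j)
    else mem b j.

Definition ask (R : realType) (O : oracle R) (n m a b : nat) (s : state R)
  : state R :=
  let B := read_matrix s a n m in
  State (nmem s) (write_vector (rmem s) b (O n m B)) (coins s) (clock s)
        (rcons (asked s) (MkQuery B)).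

(* Big-step semantics.  An oracle call is charged for the entries read and
   written. *)
Inductive exec (R : realType) (O : oracle R)
  : cmd -> state R -> state R -> Prop :=
| ExecSkip s : exec O Skip s s
| ExecNSet a i e s :
    exec O (NSet a i e) s
      (tick (ncost (nmem s) i + ncost (nmem s) e).+1
        (set_nat a (neval (nmem s) i) (neval (nmem s) e) s))
| ExecRSet a i e s :
    exec O (RSet a i e) s
      (tick (ncost (nmem s) i + rcost (nmem s) e).+1
        (set_real a (neval (nmem s) i) (reval s e) s))
| ExecSeq c1 c2 s1 s2 s3 :
    exec O c1 s1 s2 -> exec O c2 s2 s3 -> exec O (Seq c1 c2) s1 s3
| ExecIf t c1 c2 s s' :
    exec O (if teval s t then c1 else c2) (tick (tcost (nmem s) t) s) s' ->
    exec O (If t c1 c2) s s'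
| ExecWhileStop t c s :
    ~~ teval s t ->
    exec O (While t c) s (tick (tcost (nmem s) t) s)
| ExecWhileLoop t c s1 s2 s3 :
    teval s1 t ->
    exec O c (tick (tcost (nmem s1) t) s1) s2 ->
    exec O (While t c) s2 s3 ->
    exec O (While t c) s1 s3
| ExecFlip a i s :
    exec O (Flip a i) s
      (tick (ncost (nmem s) i).+1
        (set_nat a (neval (nmem s) i) (head false (coins s)) (pop_coin s)))
| ExecQuery en em a b s (n := neval (nmem s) en) (m := neval (nmem s) em) :
    exec O (Query en em a b) s
      (tick (ncost (nmem s) en + ncost (nmem s) em + n * m + m).+1
        (ask O n m a b s)).

(* Programs that neither toss coins nor call the oracle *)
Fixpoint plain (c : cmd) : bool :=
  match c with
  | Seq c1 c2 | If _ c1 c2 => plain c1 && plain c2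
  | While _ c1 => plain c1
  | Flip _ _ | Query _ _ _ _ => false
  | _ => true
  end.

Definition nat_input (l : seq nat) : nat -> nat -> nat :=
  fun a i => if a == 0%N then nth 0%N l i else 0%N.

(* eps(n, m) is computable to within 2^-l in time poly(m, l), on input
   (n, m, l); the output is the first cell of the real array 0. *)
Definition efficiently_computable (R : realType) (eps : nat -> nat -> R)
  : Prop :=
  exists (c : cmd) (C k : nat), plain c /\
    forall n m l : nat, (0 < n <= m)%N ->
      exists s : state R,
        [/\ exec (fun _ _ _ => 0) c
              (State (nat_input [:: n; m; l]) (fun _ _ => 0) [::] 0 [::]) s,
            (clock s <= C * (m + l) ^ k)%N &
            `|rmem s 0%N 0%N - eps n m| <= 2^-1 ^+ l].

(** * Reductions *)

(* Input: n and m in the natural array 0, the basis (row-major) in the real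
   array 0, and the parameters of the problems in the real array 1. *)
Definition input_state (R : realType) (params : seq R) (n m : nat)
    (B : 'M[R]_(n, m)) (w : seq bool) : state R :=
  State (nat_input [:: n; m])
    (fun a => if a == 0%N then
                nth 0 [seq B i j | i <- enum 'I_n, j <- enum 'I_m]
              else if a == 1%N then nth 0 params
              else fun _ => 0)
    w 0 [::].

(* Output: the vector in the real array 2. *)
Definition output (R : realType) (m : nat) (s : state R) : 'rV[R]_m :=
  read_vector s 2 m.

(* A query has the same rank and dimension as the input, and is a basis of a
   sublattice of the input lattice. *)
Definition sublattice_query (R : realType) (n m : nat) (B : 'M[R]_(n, m))
    (x : query R) : Prop :=
  exists B' : 'M[R]_(n, m),
    [/\ x = MkQuery B', row_free B' & lattice B' `<=` lattice B].

(* c is a randomized reduction from gA-SVP_q to gB-SVP_p that runs in time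
   T(n, m), preserves rank and dimension, and only calls its oracle on
   sublattices of the input lattice.  The time bound and the restriction on the
   oracle calls hold for all coin tosses, and the output is correct with
   probability at least 2/3.  N bounds the running time, so no run tosses more
   than N coins, and the probability is over N uniform bits. *)
Definition SVP_reduction (R : realType) (p q : \bar R)
    (gA gB T : nat -> nat -> R) (c : cmd) : Prop :=
  forall O : oracle R, solves_SVP p gB O ->
  forall (n m : nat) (B : 'M[R]_(n, m)), (0 < n)%N -> row_free B ->
  let start (w : seq bool) :=
    input_state [:: inv_exponent p; inv_exponent q; gB n m] B w in
  exists N : nat,
    [/\ N%:R <= T n m,
        forall w : N.-tuple bool, exists s : state R,
          [/\ exec O c (start w) s, (clock s <= N)%N &
              List.Forall (sublattice_query B) (asked s)] &
        2 / 3 * 2 ^+ N <=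
        (#|[pred w : N.-tuple bool |
             `[< exists2 s : state R, exec O c (start w) s &
                   SVP_solution q (gA n m) B (output m s) >]]|)%:R :> R].

(* Main.v *)
(* Fix a lattice vector x with ||x||_q <= 5/4 lambda_1^(q) and a power Q of 2.
   Multiplying a basis vector b_j by Q and adding random multiples c_i b_j to
   the other b_i gives a random sublattice of index Q; with probability at least
   1/(4Q) it contains x but none of the at most N vectors found before, as long
   as these are not parallel to x.  The oracle then returns a new vector v with
   ||v||_p <= gamma ||x||_p.  Hence after O(QN) rounds, with good probability,
   either some v is parallel to x or N distinct such v have been found.
   Truncating coordinates to multiples of a suitable tau puts the l_p ball of
   radius gamma ||x||_p into fewer than N = exp(O(eps m)) classes, so two of the
   N vectors are close in the l_q norm.  In either case the shortest nonzero
   difference of two of the vectors found, or of one of them and 0, is short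
   enough. *)
Require Import Defs.
From mathcomp Require Import all_boot all_order all_algebra.
From mathcomp Require Import all_classical all_reals all_analysis.
From mathcomp Require Import zify ring lra.
Import Order.TTheory GRing.Theory Num.Theory.
Local Open Scope ring_scope.

Set Implicit Arguments.
Unset Strict Implicit.
Unset Printing Implicit Defensive.

(** * Hoare-style rules for runs of programs *)

(** The oracle may be adversarial: on a fixed lattice it can return the same useless vector forever,
    so only a change of lattice forces a new answer. The sublattice has to keep [x], and a known
    vector is excluded with good probability only if its condition modulo Q is nearly independent of
    that of [x]. Modulo Q there are zero divisors; Q is a power of 2 so that coins give uniform
    residues, odd coordinates are units, and whatever some 0 < h < 2N annihilates is annihilated by
    N. Taking Q >= 4 N gamma m turns every remaining dependence into true parallelism, and a
    parallel vector is harmless because it is short in all norms at once. Reals cannot be rounded by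
    the machine, so truncation occurs in the analysis only and the program compares all pairs. With
    N about exp(eps m / 8) there are T = O(Q N) = O(gamma m N^2) rounds, and T^2 pairs cost about
    N^4 = exp(eps m / 2) <= 2^(eps m). The pairs account for gamma^2; the other gamma^2 pays for
    linear bounds on two quantities that are logarithmic in gamma. *)

Fixpoint nat_writes (c : cmd) : seq nat :=
  match c with
  | NSet a _ _ | Flip a _ => [:: a]
  | Seq c1 c2 | If _ c1 c2 => nat_writes c1 ++ nat_writes c2
  | While _ c1 => nat_writes c1
  | _ => [::]
  end.

Fixpoint real_writes (c : cmd) : seq nat :=
  match c with
  | RSet a _ _ => [:: a]
  | Query _ _ _ b => [:: b]
  | Seq c1 c2 | If _ c1 c2 => real_writes c1 ++ real_writes c2
  | While _ c1 => real_writes c1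
  | _ => [::]
  end.

Fixpoint flips (c : cmd) : bool :=
  match c with
  | Seq c1 c2 | If _ c1 c2 => flips c1 || flips c2
  | While _ c1 => flips c1
  | Flip _ _ => true
  | _ => false
  end.

Fixpoint queries (c : cmd) : bool :=
  match c with
  | Seq c1 c2 | If _ c1 c2 => queries c1 || queries c2
  | While _ c1 => queries c1
  | Query _ _ _ _ => true
  | _ => false
  end.

(** A syntactic bound on the effects of a command. With it, a loop invariant mentions only the
    arrays that the loop changes. *)
Definition frame (R : realType) (c : cmd) (s s' : state R) : Prop :=
  [/\ forall a, a \notin nat_writes c -> nmem s' a = nmem s a,
      forall a, a \notin real_writes c -> rmem s' a = rmem s a,
      ~~ flips c -> coins s' = coins s &
      ~~ queries c -> asked s' = asked s].

Lemma frame_refl (R : realType) (c : cmd) (s : state R) : frame c s s.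
Proof. by []. Qed.

Lemma frame_trans (R : realType) (c : cmd) (s1 s2 s3 : state R) :
  frame c s1 s2 -> frame c s2 s3 -> frame c s1 s3.
Proof.
move=> [n1 r1 c1 q1] [n2 r2 c2 q2]; split=> [a ha|a ha|h|h].
- by rewrite n2 ?n1.
- by rewrite r2 ?r1.
- by rewrite c2 ?c1.
- by rewrite q2 ?q1.
Qed.

Lemma frame_sub (R : realType) (c c' : cmd) (s s' : state R) :
  {subset nat_writes c <= nat_writes c'} ->
  {subset real_writes c <= real_writes c'} ->
  (flips c -> flips c') -> (queries c -> queries c') ->
  frame c s s' -> frame c' s s'.
Proof.
move=> hn hr hf hq [n r f q]; split=> [a ha|a ha|h|h].
- by apply: n; apply: contra ha => /hn.
- by apply: r; apply: contra ha => /hr.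
- by apply: f; apply: contra h => /hf.
- by apply: q; apply: contra h => /hq.
Qed.

Lemma frame_tick (R : realType) (c : cmd) (k : nat) (s s' : state R) :
  frame c (tick k s) s' -> frame c s s'.
Proof. by []. Qed.

Lemma store_other (T : Type) (mem : nat -> nat -> T) a i v b :
  b != a -> store mem a i v b = mem b.
Proof. by move=> /negbTE hb; rewrite /store hb. Qed.

Lemma exec_frame (R : realType) (O : oracle R) c s s' :
  exec O c s s' -> frame c s s'.
Proof.
elim=> {c s s'}.
- by move=> s; apply: frame_refl.
- move=> a i e s; split=> //= b; rewrite inE; exact: store_other.
- move=> a i e s; split=> //= b; rewrite inE; exact: store_other.
- move=> c1 c2 s1 s2 s3 _ h1 _ h2; apply: (frame_trans (s2 := s2)).
    apply: frame_sub h1 => [a|a||] /=; rewrite ?mem_cat; by move=> ->.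
  by apply: frame_sub h2 => [a|a||] /=; rewrite ?mem_cat => ->; rewrite orbT.
- move=> t c1 c2 s s' _; case: ifP => _ /frame_tick h.
    by apply: frame_sub h => [a|a||] /=; rewrite ?mem_cat => ->.
  by apply: frame_sub h => [a|a||] /=; rewrite ?mem_cat => ->; rewrite orbT.
- by [].
- move=> t c s1 s2 s3 _ _ h1 _ h2; apply: frame_trans h2; exact: h1.
- move=> a i s; split=> //= b; rewrite inE; exact: store_other.
- move=> en em a b s n m; split=> //= d; rewrite inE /write_vector => /negbTE.
  by move=> ->.
Qed.

Lemma frame_seq (R : realType) c1 c2 (s1 s2 s3 : state R) :
  frame c1 s1 s2 -> frame c2 s2 s3 -> frame (Seq c1 c2) s1 s3.
Proof.
move=> h1 h2; apply: (frame_trans (s2 := s2)).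
  by apply: frame_sub h1 => [a|a||] /=; rewrite ?mem_cat => ->.
by apply: frame_sub h2 => [a|a||] /=; rewrite ?mem_cat => ->; rewrite orbT.
Qed.

(** Total correctness with a time bound relative to the starting clock. The existence of a run is
    the form in which [SVP_reduction] asks for it. *)
Definition run (R : realType) (O : oracle R) c s k (Q : state R -> Prop) :=
  exists s', [/\ exec O c s s', Q s' & (clock s' <= clock s + k)%N].

Lemma run_weaken (R : realType) (O : oracle R) c s k k' (Q Q' : state R -> Prop) :
  run O c s k Q -> (k <= k')%N -> (forall s', frame c s s' -> Q s' -> Q' s') ->
  run O c s k' Q'.
Proof.
move=> [s' [ex hQ hk]] kk' QQ'; exists s'; split=> //.
  by apply: QQ' => //; apply: exec_frame ex.
by apply: leq_trans hk _; rewrite leq_add2l.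
Qed.

Lemma run_cost (R : realType) (O : oracle R) c s k k' (Q : state R -> Prop) :
  (k <= k')%N -> run O c s k Q -> run O c s k' Q.
Proof. by move=> kk' h; apply: run_weaken h kk' _. Qed.

Lemma run_seq (R : realType) (O : oracle R) c1 c2 s k1 k2 (Q1 Q : state R -> Prop) :
  run O c1 s k1 Q1 ->
  (forall s', frame c1 s s' -> Q1 s' -> run O c2 s' k2 Q) ->
  run O (Seq c1 c2) s (k1 + k2) Q.
Proof.
move=> [s1 [ex1 hQ1 hk1]] h.
have [s2 [ex2 hQ hk2]] := h _ (exec_frame ex1) hQ1.
exists s2; split=> //; first exact: ExecSeq ex1 ex2.
by apply: leq_trans hk2 _; rewrite addnA leq_add2r.
Qed.

Lemma run_skip (R : realType) (O : oracle R) s k (Q : state R -> Prop) :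
  Q s -> run O Skip s k Q.
Proof. by move=> hQ; exists s; split=> //; [exact: ExecSkip | rewrite leq_addr]. Qed.

Fixpoint nsize (e : nexpr) : nat :=
  match e with
  | NConst _ => 1
  | NGet _ i => (nsize i).+1
  | NAdd e1 e2 | NSub e1 e2 | NMul e1 e2 | NDiv e1 e2 | NMod e1 e2 =>
      (nsize e1 + nsize e2).+1
  end.

(** All intermediate values stay below [M], so each node of an expression costs at most [bitlen M].
    Differences, quotients and remainders carry no bound of their own because they do not exceed
    their first argument. *)
Fixpoint nbound (mem : nat -> nat -> nat) (M : nat) (e : nexpr) : Prop :=
  match e with
  | NConst k => (k <= M)%N
  | NGet a i => (mem a (neval mem i) <= M)%N /\ nbound mem M i
  | NAdd e1 e2 =>
      [/\ (neval mem e1 + neval mem e2 <= M)%N, nbound mem M e1 & nbound mem M e2]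
  | NSub e1 e2 | NDiv e1 e2 => nbound mem M e1 /\ nbound mem M e2
  | NMul e1 e2 =>
      [/\ (neval mem e1 * neval mem e2 <= M)%N, nbound mem M e1 & nbound mem M e2]
  | NMod e1 e2 => nbound mem M e1 /\ nbound mem M e2
  end.

Lemma leq_bitlen k M : (k <= M)%N -> (bitlen k <= bitlen M)%N.
Proof. by move=> h; rewrite ltnS leq_trunc_log. Qed.

Lemma nbound_eval mem M e : nbound mem M e -> (neval mem e <= M)%N.
Proof.
elim: e => [k|a i _|e1 _ e2 _|e1 h1 e2 _|e1 _ e2 _|e1 h1 e2 _|e1 h1 e2 _] //=.
- by case.
- by case.
- by case=> /h1 h _; apply: leq_trans (leq_subr _ _) h.
- by case.
- by case=> /h1 h _; apply: leq_trans (leq_div _ _) h.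
- by case=> /h1 h _; apply: leq_trans (leq_mod _ _) h.
Qed.

Lemma ncost_le mem M e :
  nbound mem M e -> (ncost mem e <= nsize e * bitlen M)%N.
Proof.
elim: e => [k|a i hi|e1 h1 e2 h2|e1 h1 e2 h2|e1 h1 e2 h2|e1 h1 e2 h2|e1 h1 e2 h2].
all: move=> hb; have hv := leq_bitlen (nbound_eval hb).
- by rewrite /= addn0 mul1n.
- by rewrite [ncost _ _]/= [nsize _]/= mulSn leq_add // hi //; case: hb.
all: rewrite [ncost _ _]/= [nsize _]/= mulSn mulnDl leq_add // leq_add //.
all: by [apply: h1; case: hb | apply: h2; case: hb].
Qed.

Fixpoint rsize (e : rexpr) : nat :=
  match e with
  | RNat k => (nsize k).+1
  | RGet _ i => (nsize i).+1
  | RAdd e1 e2 | RSub e1 e2 | RMul e1 e2 | RDiv e1 e2 => (rsize e1 + rsize e2).+1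
  | RExp e1 | RLn e1 => (rsize e1).+1
  end.

Fixpoint rbound (mem : nat -> nat -> nat) (M : nat) (e : rexpr) : Prop :=
  match e with
  | RNat i | RGet _ i => nbound mem M i
  | RAdd e1 e2 | RSub e1 e2 | RMul e1 e2 | RDiv e1 e2 =>
      rbound mem M e1 /\ rbound mem M e2
  | RExp e1 | RLn e1 => rbound mem M e1
  end.

Lemma bitlen_gt0 M : (0 < bitlen M)%N. Proof. by []. Qed.

Lemma rcost_le mem M e :
  rbound mem M e -> (rcost mem e <= rsize e * bitlen M)%N.
Proof.
have b0 := bitlen_gt0 M.
elim: e => [k|a i|e1 h1 e2 h2|e1 h1 e2 h2|e1 h1 e2 h2|e1 h1 e2 h2|e1 h1|e1 h1].
- by move=> /ncost_le h; rewrite /= mulSn -add1n leq_add.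
- by move=> /ncost_le h; rewrite /= mulSn -add1n leq_add.
1-4: by case=> /h1 ? /h2 ?; rewrite /= mulSn mulnDl -add1n !leq_add.
all: by move=> /h1 h; rewrite /= mulSn -add1n leq_add.
Qed.

Fixpoint tsize (t : test) : nat :=
  match t with
  | TNLe e1 e2 => (nsize e1 + nsize e2).+1
  | TRLe e1 e2 => (rsize e1 + rsize e2).+1
  | TNot t1 => (tsize t1).+1
  end.

Fixpoint tbound (mem : nat -> nat -> nat) (M : nat) (t : test) : Prop :=
  match t with
  | TNLe e1 e2 => nbound mem M e1 /\ nbound mem M e2
  | TRLe e1 e2 => rbound mem M e1 /\ rbound mem M e2
  | TNot t1 => tbound mem M t1
  end.

Lemma tcost_le mem M t :
  tbound mem M t -> (tcost mem t <= tsize t * bitlen M)%N.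
Proof.
have b0 := bitlen_gt0 M.
elim: t => [e1 e2|e1 e2|t h].
- by case=> /ncost_le h1 /ncost_le h2; rewrite /= mulSn mulnDl -add1n !leq_add.
- by case=> /rcost_le h1 /rcost_le h2; rewrite /= mulSn mulnDl -add1n !leq_add.
by move=> /h ht; rewrite /= mulSn -add1n leq_add.
Qed.

(* 50 bounds the size of every expression occurring in the program. *)
Definition step_cost (M : nat) : nat := (50 * bitlen M)%N.

Lemma step_cost_gt0 M : (0 < step_cost M)%N. Proof. by rewrite muln_gt0. Qed.

Lemma run_nset (R : realType) (O : oracle R) M a i e s (Q : state R -> Prop) :
  (nsize i + nsize e < 50)%N -> nbound (nmem s) M i -> nbound (nmem s) M e ->
  (forall k, Q (tick k (set_nat a (neval (nmem s) i) (neval (nmem s) e) s))) ->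
  run O (NSet a i e) s (step_cost M) Q.
Proof.
move=> hs hi he hQ; eexists; split; [exact: ExecNSet | exact: hQ | rewrite /=].
rewrite leq_add2l /step_cost.
apply: (@leq_trans ((nsize i + nsize e).+1 * bitlen M)); last by rewrite leq_mul2r hs orbT.
by rewrite mulSn mulnDl -add1n !leq_add // ncost_le.
Qed.

Lemma run_rset (R : realType) (O : oracle R) M a i e s (Q : state R -> Prop) :
  (nsize i + rsize e < 50)%N -> nbound (nmem s) M i -> rbound (nmem s) M e ->
  (forall k, Q (tick k (set_real a (neval (nmem s) i) (reval s e) s))) ->
  run O (RSet a i e) s (step_cost M) Q.
Proof.
move=> hs hi he hQ; eexists; split; [exact: ExecRSet | exact: hQ | rewrite /=].
rewrite leq_add2l /step_cost.
apply: (@leq_trans ((nsize i + rsize e).+1 * bitlen M)); last by rewrite leq_mul2r hs orbT.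
by rewrite mulSn mulnDl -add1n !leq_add // ?ncost_le // rcost_le.
Qed.

Lemma run_flip (R : realType) (O : oracle R) M a i s (Q : state R -> Prop) :
  (nsize i < 50)%N -> nbound (nmem s) M i ->
  (forall k, Q (tick k (set_nat a (neval (nmem s) i) (head false (coins s))
     (pop_coin s)))) ->
  run O (Flip a i) s (step_cost M) Q.
Proof.
move=> hs hi hQ; eexists; split; [exact: ExecFlip | exact: hQ | rewrite /=].
rewrite leq_add2l /step_cost.
apply: (@leq_trans ((nsize i).+1 * bitlen M)); last by rewrite leq_mul2r hs orbT.
by rewrite mulSn -add1n !leq_add // ncost_le.
Qed.

Lemma run_if (R : realType) (O : oracle R) M t c1 c2 s k1 k2 (Q : state R -> Prop) :
  (tsize t < 50)%N -> tbound (nmem s) M t ->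
  (teval s t -> forall k, run O c1 (tick k s) k1 Q) ->
  (~~ teval s t -> forall k, run O c2 (tick k s) k2 Q) ->
  run O (If t c1 c2) s (step_cost M + (k1 + k2)) Q.
Proof.
move=> hs ht h1 h2; set k := tcost (nmem s) t.
have hk : (k <= step_cost M)%N.
  by apply: leq_trans (tcost_le ht) _; rewrite leq_mul2r (ltnW hs) orbT.
have [s' [ex hQ hc]] : run O (if teval s t then c1 else c2) (tick k s) (k1 + k2) Q.
  case: ifP => [/h1 /(_ k)|/negbT /h2 /(_ k)] h; apply: run_weaken h _ _ => //.
    by rewrite leq_addr.
  by rewrite leq_addl.
exists s'; split=> //; first exact: ExecIf.
by apply: leq_trans hc _; rewrite /= -addnA leq_add2l leq_add2r.
Qed.

(** The number of iterations is fixed beforehand as [n]. The invariant must be stable under [tick]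
    because each test advances the clock. *)
Lemma run_while (R : realType) (O : oracle R) M t c s n kb
    (Inv : nat -> state R -> Prop) (Q : state R -> Prop) :
  (tsize t < 50)%N ->
  (forall i s' k, Inv i s' -> Inv i (tick k s')) ->
  Inv 0%N s ->
  (forall i s', (i <= n)%N -> frame c s s' -> Inv i s' ->
    tbound (nmem s') M t /\ teval s' t = (i < n)%N) ->
  (forall i s', (i < n)%N -> frame c s s' -> Inv i s' -> run O c s' kb (Inv i.+1)) ->
  (forall s', frame c s s' -> Inv n s' -> Q s') ->
  run O (While t c) s (n * (step_cost M + kb) + step_cost M) Q.
Proof.
move=> hs htick h0 ht hb hQ.
have tc i s' : (i <= n)%N -> frame c s s' -> Inv i s' ->
    (tcost (nmem s') t <= step_cost M)%N.
  move=> hi fr hI; have [hbd _] := ht _ _ hi fr hI.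
  by apply: leq_trans (tcost_le hbd) _; rewrite leq_mul2r (ltnW hs) orbT.
suff main d : forall i s', (i + d = n)%N -> frame c s s' -> Inv i s' ->
    run O (While t c) s' (d * (step_cost M + kb) + step_cost M) Q.
  by apply: (main n 0%N).
elim: d => [|d IH] i s' hid fr hI.
  rewrite addn0 in hid; subst i.
  have [_ hf] := ht _ _ (leqnn n) fr hI.
  exists (tick (tcost (nmem s') t) s'); split.
  - by apply: ExecWhileStop; rewrite hf ltnn.
  - by apply: hQ => //; apply: htick.
  - by rewrite /= leq_add2l mul0n add0n; apply: tc hI.
have hin : (i < n)%N by rewrite -hid addnS ltnS leq_addr.
have [_ hf] := ht _ _ (ltnW hin) fr hI.
set k := tcost (nmem s') t.
have [s1 [ex1 hI1 hk1]] := hb i (tick k s') hin fr (htick _ _ _ hI).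
have fr1 : frame c s s1.
  by apply: frame_trans (exec_frame ex1).
have [s2 [ex2 hQ2 hk2]] := IH i.+1 s1 ltac:(by rewrite addSn -addnS) fr1 hI1.
exists s2; split=> //.
- by apply: ExecWhileLoop ex1 ex2; rewrite hf.
- apply: leq_trans hk2 _; rewrite mulSn -!addnA.
  apply: leq_trans (leq_add hk1 (leqnn _)) _.
  have := tc _ _ (ltnW hin) fr hI; rewrite -/k /=; lia.
Qed.

Definition nvar (v : nat) : nexpr := NGet v (NConst 0).

Definition For (v : nat) (e : nexpr) (c : cmd) : cmd :=
  Seq (NSet v (NConst 0) (NConst 0))
    (While (TNot (TNLe e (nvar v)))
      (Seq c (NSet v (NConst 0) (NAdd (nvar v) (NConst 1))))).

Lemma set_nat_id (R : realType) a i (s : state R) :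
  set_nat a i (nmem s a i) s = s.
Proof.
case: s => nm rm cs ck ask; rewrite /set_nat /=.
have -> // : store nm a i (nm a i) = nm.
apply/funext => b; apply/funext => j.
by rewrite /store; case: ifP => // /andP [/eqP -> /eqP ->].
Qed.

(** The bound [e] is evaluated again at every test, so it has to keep the value [n] throughout. The
    invariant must ignore both the counter and the clock. *)
Lemma run_for (R : realType) (O : oracle R) M v e c s n kb
    (Inv : nat -> state R -> Prop) (Q : state R -> Prop) :
  (nsize e < 20)%N -> v \notin nat_writes c -> (n < M)%N ->
  (forall i s' x k, Inv i s' -> Inv i (tick k (set_nat v 0 x s'))) ->
  Inv 0%N s ->
  (forall i s', (i <= n)%N -> frame (For v e c) s s' -> Inv i s' ->
     nbound (nmem s') M e /\ neval (nmem s') e = n) ->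
  (forall i s', (i < n)%N -> frame (For v e c) s s' -> nmem s' v 0%N = i ->
     Inv i s' -> run O c s' kb (Inv i.+1)) ->
  (forall s', frame (For v e c) s s' -> Inv n s' -> Q s') ->
  run O (For v e c) s (n * (kb + 2 * step_cost M) + 2 * step_cost M) Q.
Proof.
move=> hs hv hM hset h0 he hb hQ.
have M0 : (0 < M)%N by apply: leq_ltn_trans hM.
apply: (@run_weaken _ _ _ _ (step_cost M + (n * (step_cost M + (kb + step_cost M))
    + step_cost M)) _ Q) => //; last by nia.
apply: (run_seq (Q1 := fun s' => Inv 0%N s' /\ nmem s' v 0%N = 0%N)).
  apply: run_nset => //= k; split; first exact: hset.
  by rewrite /store !eqxx.
move=> s1 fr1 [hI1 hv1].
set c2 := Seq c _.
have frs s' : frame c2 s1 s' -> frame (For v e c) s s'.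
  move=> f; apply: frame_seq fr1 _; by apply: frame_sub f => /=.
apply: (run_while (Inv := fun i s' => Inv i s' /\ nmem s' v 0%N = i)) => //.
- by rewrite /=; lia.
- move=> i s' k [hI hvi]; split=> //.
  (* A pure tick is presented as a store of the current counter value, so that [hset] applies. *)
  rewrite -(set_nat_id v 0 s'); exact: hset.
- move=> i s' hi f [hI hvi].
  have [hb1 hb2] := he _ _ hi (frs _ f) hI.
  rewrite /= hb2 hvi ltnNge; split=> //; split=> //; split=> //.
  by apply: ltnW; apply: leq_ltn_trans hM.
- move=> i s' hi f [hI hvi].
  have h := hb _ _ hi (frs _ f) hvi hI.
  apply: (run_seq (Q1 := Inv i.+1)) h _ => s2 f2 hI2.
  have hvi2 : nmem s2 v 0%N = i by case: f2 => -> //.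
  apply: run_nset => //=.
  + rewrite hvi2; split=> //; last by split=> //; apply: ltnW; apply: ltn_trans hM.
    by rewrite addn1; apply: leq_trans (ltnW hM).
  + move=> k; split; first exact: hset.
    by rewrite /store !eqxx /= hvi2 addn1.
- by move=> s' f [hI _]; apply: hQ => //; apply: frs.
Qed.

(** * Relocating a program to a fresh block of arrays *)

Fixpoint nshift (d : nat) (e : nexpr) : nexpr :=
  match e with
  | NConst k => NConst k
  | NGet a i => NGet (a + d) (nshift d i)
  | NAdd e1 e2 => NAdd (nshift d e1) (nshift d e2)
  | NSub e1 e2 => NSub (nshift d e1) (nshift d e2)
  | NMul e1 e2 => NMul (nshift d e1) (nshift d e2)
  | NDiv e1 e2 => NDiv (nshift d e1) (nshift d e2)
  | NMod e1 e2 => NMod (nshift d e1) (nshift d e2)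
  end.

Fixpoint rshift_expr (d : nat) (e : rexpr) : rexpr :=
  match e with
  | RNat k => RNat (nshift d k)
  | RGet a i => RGet (a + d) (nshift d i)
  | RAdd e1 e2 => RAdd (rshift_expr d e1) (rshift_expr d e2)
  | RSub e1 e2 => RSub (rshift_expr d e1) (rshift_expr d e2)
  | RMul e1 e2 => RMul (rshift_expr d e1) (rshift_expr d e2)
  | RDiv e1 e2 => RDiv (rshift_expr d e1) (rshift_expr d e2)
  | RExp e1 => RExp (rshift_expr d e1)
  | RLn e1 => RLn (rshift_expr d e1)
  end.

Fixpoint tshift (d : nat) (t : test) : test :=
  match t with
  | TNLe e1 e2 => TNLe (nshift d e1) (nshift d e2)
  | TRLe e1 e2 => TRLe (rshift_expr d e1) (rshift_expr d e2)
  | TNot t1 => TNot (tshift d t1)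
  end.

Fixpoint cshift (d : nat) (c : cmd) : cmd :=
  match c with
  | Skip => Skip
  | NSet a i e => NSet (a + d) (nshift d i) (nshift d e)
  | RSet a i e => RSet (a + d) (nshift d i) (rshift_expr d e)
  | Seq c1 c2 => Seq (cshift d c1) (cshift d c2)
  | If t c1 c2 => If (tshift d t) (cshift d c1) (cshift d c2)
  | While t c1 => While (tshift d t) (cshift d c1)
  | Flip a i => Flip (a + d) (nshift d i)
  | Query en em a b => Query (nshift d en) (nshift d em) (a + d) (b + d)
  end.

Definition shifted (T : Type) (d : nat) (mem mem' : nat -> nat -> T) : Prop :=
  forall a i, mem' (a + d)%N i = mem a i.

Lemma neval_shift d mem mem' e :
  shifted d mem mem' -> neval mem' (nshift d e) = neval mem e.
Proof.
move=> h; elim: e => [k|a i IH|e1 h1 e2 h2|e1 h1 e2 h2|e1 h1 e2 h2|e1 h1 e2 h2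
  |e1 h1 e2 h2] //=; rewrite ?IH ?h1 ?h2 //; exact: h.
Qed.

Lemma ncost_shift d mem mem' e :
  shifted d mem mem' -> ncost mem' (nshift d e) = ncost mem e.
Proof.
move=> h; elim: e => [k|a i IH|e1 h1 e2 h2|e1 h1 e2 h2|e1 h1 e2 h2|e1 h1 e2 h2
  |e1 h1 e2 h2] //=; rewrite ?IH ?h1 ?h2 ?(neval_shift _ h) //; by rewrite h.
Qed.

Definition sim (R : realType) d (s t : state R) : Prop :=
  shifted d (nmem s) (nmem t) /\ shifted d (rmem s) (rmem t).

Lemma reval_shift (R : realType) d (s t : state R) e :
  sim d s t -> reval t (rshift_expr d e) = reval s e.
Proof.
move=> [hn hr]; elim: e => [k|a i|e1 h1 e2 h2|e1 h1 e2 h2|e1 h1 e2 h2|e1 h1 e2 h2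
  |e1 h1|e1 h1] /=; rewrite ?h1 ?h2 ?(neval_shift _ hn) //; exact: hr.
Qed.

Lemma rcost_shift d mem mem' e :
  shifted d mem mem' -> rcost mem' (rshift_expr d e) = rcost mem e.
Proof.
move=> hn; elim: e => [k|a i|e1 h1 e2 h2|e1 h1 e2 h2|e1 h1 e2 h2|e1 h1 e2 h2
  |e1 h1|e1 h1] /=; by rewrite ?h1 ?h2 ?(ncost_shift _ hn).
Qed.

Lemma teval_shift (R : realType) d (s t : state R) e :
  sim d s t -> teval t (tshift d e) = teval s e.
Proof.
move=> h; elim: e => [e1 e2|e1 e2|e1 h1] /=.
- by rewrite !(neval_shift _ (proj1 h)).
- by rewrite !(reval_shift _ h).
by rewrite h1.
Qed.

Lemma tcost_shift d mem mem' t :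
  shifted d mem mem' -> tcost mem' (tshift d t) = tcost mem t.
Proof.
move=> h; elim: t => [e1 e2|e1 e2|t h1] /=; by rewrite ?(ncost_shift _ h) ?(rcost_shift _ h) ?h1.
Qed.

Lemma shifted_store (T : Type) d (mem mem' : nat -> nat -> T) a i v :
  shifted d mem mem' -> shifted d (store mem a i v) (store mem' (a + d) i v).
Proof. by move=> h b j; rewrite /store eqn_add2r h. Qed.

(** Values and costs do not depend on the names of arrays, so the relocated run takes the same time.
    As [plain] excludes coins and queries, the run can be replayed under any oracle and with any
    remaining coins. *)
Lemma exec_shift (R : realType) (O O' : oracle R) d c s s' t :
  exec O c s s' -> plain c -> sim d s t ->
  exists t', [/\ exec O' (cshift d c) t t', sim d s' t' &
    (clock t' + clock s = clock t + clock s')%N].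
Proof.
move=> ex; elim: ex t => {c s s'}.
- by move=> s t _ h; exists t; split=> //; apply: ExecSkip.
- move=> a i e s t _ [hn hr]; eexists; split; first exact: ExecNSet.
    split=> //=; rewrite !(neval_shift _ hn); exact: shifted_store.
  by rewrite /= !(ncost_shift _ hn); lia.
- move=> a i e s t _ h; case: (h) => hn hr; eexists; split; first exact: ExecRSet.
    split=> //=; rewrite (neval_shift _ hn) (reval_shift _ h); exact: shifted_store.
  by rewrite /= (ncost_shift _ hn) (rcost_shift _ hn); lia.
- move=> c1 c2 s1 s2 s3 _ h1 _ h2 t /= /andP [p1 p2] h.
  have [t2 [ex2 hs2 hc2]] := h1 _ p1 h.
  have [t3 [ex3 hs3 hc3]] := h2 _ p2 hs2.
  exists t3; split=> //; [exact: ExecSeq ex2 ex3 | lia].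
- move=> e c1 c2 s s' _ IH t /= /andP [p1 p2] h.
  have hp : plain (if teval s e then c1 else c2) by case: ifP.
  have [t' [ex' hs' hc']] := IH (tick (tcost (nmem s) e) t) hp h.
  exists t'; split=> //; last by move: hc' => /=; lia.
  apply: ExecIf; rewrite (teval_shift _ h) (tcost_shift _ (proj1 h)).
  by move: ex'; case: ifP.
- move=> e c s hf t _ h; eexists; split.
  + by apply: ExecWhileStop; rewrite (teval_shift _ h).
  + exact: h.
  + by rewrite /= (tcost_shift _ (proj1 h)); lia.
- move=> e c s1 s2 s3 ht _ h1 _ h2 t /= p h.
  have [t2 [ex2 hs2 hc2]] := h1 (tick (tcost (nmem s1) e) t) p h.
  have [t3 [ex3 hs3 hc3]] := h2 _ p hs2.
  exists t3; split=> //; last by move: hc2 hc3 => /=; lia.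
  apply: ExecWhileLoop ex3; first by rewrite (teval_shift _ h).
  by rewrite (tcost_shift _ (proj1 h)).
- by [].
- by [].
Qed.

Lemma cshift_writes d c a : (a < d)%N ->
  a \notin nat_writes (cshift d c) /\ a \notin real_writes (cshift d c).
Proof.
move=> ha; have ne b : a != (b + d)%N by apply: contraTneq ha => ->; rewrite -leqNgt leq_addl.
elim: c => //=.
- by move=> b *; rewrite inE ne.
- by move=> b *; rewrite inE ne.
- by move=> c1 [h1 h2] c2 [h3 h4]; rewrite !mem_cat !negb_or h1 h2 h3 h4.
- by move=> _ c1 [h1 h2] c2 [h3 h4]; rewrite !mem_cat !negb_or h1 h2 h3 h4.
- by move=> b *; rewrite inE ne.
- by move=> *; rewrite inE ne.
Qed.

Lemma cshift_plain d c : plain c ->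
  flips (cshift d c) = false /\ queries (cshift d c) = false.
Proof.
elim: c => //=.
- by move=> c1 h1 c2 h2 /andP [/h1 [-> ->] /h2 [-> ->]].
- by move=> _ c1 h1 c2 h2 /andP [/h1 [-> ->] /h2 [-> ->]].
Qed.

(** * The sampling rounds *)

(* Layout of the memory.  Natural arrays: 1 number N of vectors sought,
   2 modulus Q, 3 log2 Q, 4 number of rounds, 5 round counter, 6 row, 7 bit
   counter, 8 multiplier, 9 pivot row j, 10 column, 11 coin, 12 and 13 pair of
   pool indices.  Real arrays: 3 query, 4 answer, 5 pool (row 0 is the zero
   vector), 6 key, 7 best key, 8 difference.  The program for eps works on the
   arrays from 20 on. *)
Definition entry (row : nexpr) : nexpr :=
  NAdd (NMul row (NGet 0 (NConst 1))) (nvar 10).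

Definition bits_cmd : cmd :=
  For 7 (nvar 3)
    (Seq (Flip 11 (NConst 0))
      (NSet 8 (NConst 0) (NAdd (NMul (NConst 2) (nvar 8)) (nvar 11)))).

(* The multiplier Q - 1 in the pivot row turns b_j into Q b_j.  In rank 1 the
   pivot may be the missing row 1, where the input array is zero; the query is
   then the input basis itself. *)
Definition row_cmd : cmd :=
  Seq (NSet 8 (NConst 0) (NConst 0))
 (Seq bits_cmd
 (Seq (If (TNLe (nvar 6) (nvar 9))
        (If (TNLe (nvar 9) (nvar 6))
          (NSet 8 (NConst 0) (NSub (nvar 2) (NConst 1))) Skip) Skip)
      (For 10 (NGet 0 (NConst 1))
        (RSet 3 (entry (nvar 6))
          (RAdd (RGet 0 (entry (nvar 6)))
                (RMul (RNat (nvar 8)) (RGet 0 (entry (nvar 9))))))))).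

Definition round_cmd : cmd :=
  Seq (Flip 9 (NConst 0))
 (Seq (For 6 (nvar 0) row_cmd)
 (Seq (Query (nvar 0) (NGet 0 (NConst 1)) 3 4)
      (For 10 (NGet 0 (NConst 1))
        (RSet 5 (entry (NAdd (nvar 5) (NConst 1))) (RGet 4 (nvar 10)))))).

Fixpoint bitval (w : seq bool) (k : nat) : nat :=
  if k is k'.+1 then (2 * bitval w k' + nth false w k')%N else 0%N.

Lemma bitval_lt w k : (bitval w k < 2 ^ k)%N.
Proof. by elim: k => //= k IH; rewrite expnS; case: nth => /=; lia. Qed.

(** The first coin of a round is the pivot, 0 or 1. The pivot row also consumes [kk] coins, whose
    value is then overwritten, so row [i] always starts at offset [1 + i * kk]. *)
Definition row_mult (Q kk : nat) (w : seq bool) (i : nat) : nat :=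
  if i == head false w :> nat then Q.-1 else bitval (drop (1 + i * kk) w) kk.

Definition query_mx (R : realType) (n m Q kk : nat) (mem : nat -> R) (w : seq bool)
  : 'M[R]_(n, m) :=
  \matrix_(i < n, j < m) (mem (i * m + j)%N
     + (row_mult Q kk w i)%:R * mem (head false w * m + j)%N).

Lemma run_bits (R : realType) (O : oracle R) M (s : state R) :
  nmem s 8 0%N = 0%N -> (nmem s 3 0%N < M)%N -> (2 ^ nmem s 3 0%N <= M)%N ->
  (20 <= M)%N ->
  run O bits_cmd s (4 * (nmem s 3 0%N).+1 * step_cost M)
    (fun s' => nmem s' 8 0%N = bitval (coins s) (nmem s 3 0%N) /\
       coins s' = drop (nmem s 3 0%N) (coins s)).
Proof.
move=> h0 hkM h2M hM; set kk := nmem s 3 0%N in hkM h2M *; set w := coins s.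
apply: (@run_cost _ _ _ _ (kk * (2 * step_cost M + 2 * step_cost M) + 2 * step_cost M)).
  by nia.
apply: (run_for (Inv := fun b s' => nmem s' 8 0%N = bitval w b /\ coins s' = drop b w)) => //.
- by rewrite drop0.
- by move=> i s' hi [fn _ _ _] [h8 hc] /=; rewrite fn //= -/kk; do !split=> //; exact: ltnW.
- move=> b s' hb [fn _ _ _] hv [h8 hc].
  rewrite mul2n -addnn.
  apply: (run_seq (Q1 := fun s2 => [/\ nmem s2 8 0%N = bitval w b,
    nmem s2 11 0%N = nth false w b & coins s2 = drop b.+1 w])).
    apply: run_flip => //= k; split=> //=; first by rewrite /store /= hc -nth0 nth_drop addn0.
    by rewrite hc -addn1 addnC -drop_drop; case: (drop b w) => //= ? l; rewrite drop0.
  move=> s2 _ [h2 h11 h2c]; apply: run_nset => //=; last by move=> k; rewrite /store /= h2 h11.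
  have hlt := bitval_lt w b.+1; have hlt' := bitval_lt w b.
  have : (2 ^ b.+1 <= 2 ^ kk)%N by rewrite leq_exp2l.
  have : (2 ^ b <= 2 ^ b.+1)%N by rewrite leq_exp2l.
  rewrite h2 h11; move: hlt => /=; set x := bitval w b; set y := nth false w b.
  by move=> *; do !split; lia.
Qed.

Lemma addn_mul_inj m i j i' j' : (j < m)%N -> (j' < m)%N ->
  (i * m + j == i' * m + j')%N = (i == i') && (j == j').
Proof.
move=> hj hj'; apply/eqP/andP => [h|[/eqP -> /eqP ->]] //.
have m0 : (0 < m)%N by apply: leq_ltn_trans hj.
have e1 : i = i' by have := congr1 (divn^~ m) h; rewrite /= !divnMDl // !divn_small // !addn0.
by move: h; rewrite e1 => /addnI ->; rewrite !eqxx.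
Qed.

Lemma run_row (R : realType) (O : oracle R) M n m Q kk (s : state R)
    (i : nat) (jb : bool) :
  nmem s 0 0%N = n -> nmem s 0 1%N = m -> nmem s 2 0%N = Q -> nmem s 3 0%N = kk ->
  nmem s 6 0%N = i -> nmem s 9 0%N = jb -> (0 < Q)%N ->
  (i < n)%N -> (n * m <= M)%N -> (2 * m < M)%N -> (n < M)%N -> (Q <= M)%N ->
  (kk < M)%N -> (2 ^ kk <= M)%N -> (20 <= M)%N ->
  run O row_cmd s (4 * (kk + m + 4) * step_cost M)
    (fun s' => [/\ coins s' = drop kk (coins s),
       forall x, (x < m)%N -> rmem s' 3 (i * m + x)%N = rmem s 0 (i * m + x)%N +
         (if i == jb then Q.-1 else bitval (coins s) kk)%:R * rmem s 0 (jb * m + x)%N &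
       forall i' x, i' != i -> (x < m)%N -> rmem s' 3 (i' * m + x)%N = rmem s 3 (i' * m + x)%N]).
Proof.
move=> hn hm hQ hkk hi hj Q0 lin nmM m2M nM QM kM k2M M20.
have imM : (i * m + m <= n * m)%N by rewrite addnC -mulSn leq_mul2r lin orbT.
set w := coins s.
set U := step_cost M.
apply: (@run_cost _ _ _ _ (U + (4 * kk.+1 * U + ((U + ((U + (U + 0)) + 0)) +
   (m * (U + 2 * U) + 2 * U))))).
  by nia.
apply: (run_seq (Q1 := fun s1 => nmem s1 8 0%N = 0%N)) => [|s1 f1 h1].
  by apply: run_nset.
case: (f1) => fn1 fr1 fc1 _.
apply: (run_seq (Q1 := fun s2 => nmem s2 8 0%N = bitval w kk /\ coins s2 = drop kk w)) =>
  [|s2 f2 [h2 hc2]].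
  have e3 : nmem s1 3 0%N = kk by rewrite fn1.
  by have := @run_bits _ O M s1; rewrite e3 fc1 //; apply.
have {}f2 := frame_seq f1 f2; case: (f2) => fn2 fr2 _ _.
set cc := (if i == jb then Q.-1 else bitval w kk).
have ccM : (cc <= M)%N.
  rewrite /cc; case: ifP => _; first by apply: leq_trans (leq_pred _) _.
  by apply: leq_trans (ltnW (bitval_lt _ _)) _.
(* [test] has no equality of naturals, so the pivot row is recognised by two inequalities. *)
apply: (run_seq (Q1 := fun s3 => nmem s3 8 0%N = cc)) => [|s3 f3 h3].
  have [e6 e9 e2] : [/\ nmem s2 6 0%N = i, nmem s2 9 0%N = jb & nmem s2 2 0%N = Q].
    by rewrite !fn2.
  have iM : (i <= M)%N by apply: ltnW; apply: ltn_trans nM.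
  have jM : (jb <= M)%N by case: (jb) => //=; lia.
  apply: run_if => //=; first by rewrite e6 e9.
    move=> hle k; apply: run_if => //=; first by rewrite e6 e9.
      move=> hge k'; apply: run_nset => //=.
        by rewrite e2; do !split=> //; lia.
      move=> k2; rewrite /store /= e2 /cc.
      have -> : i == jb by move: hle hge; rewrite e6 e9; rewrite eqn_leq => -> ->.
      by rewrite subn1.
    move=> hge k'; apply: run_skip => /=.
    rewrite h2 /cc; have -> // : (i == jb) = false.
    by apply: contraNF hge; rewrite e6 e9 => /eqP ->.
  move=> hle k'; apply: run_skip => /=.
  rewrite h2 /cc; have -> // : (i == jb) = false.
  by apply: contraNF hle; rewrite e6 e9 => /eqP ->.
have hc3 : coins s3 = drop kk w by case: (f3) => _ _ -> // _.
have {}f3 := frame_seq f2 f3; case: (f3) => fn3 fr3 _ _.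
apply: (run_for (Inv := fun c s4 => [/\ coins s4 = drop kk w,
     forall x, (x < c)%N -> rmem s4 3 (i * m + x)%N =
       rmem s 0 (i * m + x)%N + cc%:R * rmem s 0 (jb * m + x)%N &
     forall i' x, i' != i -> (x < m)%N ->
       rmem s4 3 (i' * m + x)%N = rmem s 3 (i' * m + x)%N])) => //.
- lia.
- by split=> //= i' x _ _; rewrite fr3.
- move=> c s4 hcm [fn _ _ _] _; rewrite /= fn // fn3 // hm; do !split=> //; lia.
- move=> c s4 hcm [fn fr _ _] h10 [hc4 hx hold].
  have [e1 e6 e9] : [/\ nmem s4 0 1%N = m, nmem s4 6 0%N = i & nmem s4 9 0%N = jb].
    by rewrite !fn // !fn3.
  have e8 : nmem s4 8 0%N = cc by rewrite fn.
  have jm : (jb * m <= m)%N by case: (jb); rewrite ?mul1n ?mul0n.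
  have im : (i * m + c < n * m)%N by lia.
  apply: run_rset => //=.
  + rewrite e1 e6 h10; do !split=> //; lia.
  + rewrite e1 e6 e9 h10 e8; do !split=> //; case: (jb) => /=; lia.
  + move=> k; rewrite e1 e6 e9 h10 e8 fr // fr3 //; split=> //.
    * move=> x hxc; rewrite /store /=; have [->|ne] := eqVneq x c; first by rewrite eqxx.
      by rewrite eqn_add2l (negbTE ne) hx //; lia.
    * move=> i' x ne hxm; rewrite /store /= addn_mul_inj // (negbTE ne) /=; exact: hold.
Qed.

Definition round_bits (n kk : nat) : nat := (1 + n * kk)%N.

(** The state built in the postcondition, whose real arrays all equal row [t.+1] of the pool, only
    serves to phrase that row through [read_vector]. Row 0 is reserved for the zero vector, hence
    the shift by one. *)
Lemma run_round (R : realType) (O : oracle R) M n m Q kk t (s : state R) :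
  nmem s 0 0%N = n -> nmem s 0 1%N = m -> nmem s 2 0%N = Q -> nmem s 3 0%N = kk ->
  nmem s 5 0%N = t -> (0 < Q)%N -> (0 < n)%N ->
  (n * m <= M)%N -> (2 * m < M)%N -> (n < M)%N -> (Q <= M)%N ->
  (kk < M)%N -> (2 ^ kk <= M)%N -> (20 <= M)%N -> (t.+2 * m <= M)%N -> (t.+1 <= M)%N ->
  let B := query_mx n m Q kk (rmem s 0) (coins s) in
  run O round_cmd s (16 * n * (kk + m + 4) * step_cost M)
    (fun s' => [/\ coins s' = drop (round_bits n kk) (coins s),
       forall x, (x < t.+1 * m)%N -> rmem s' 5 x = rmem s 5 x,
       read_vector (State (nmem s') (fun _ x => rmem s' 5 (t.+1 * m + x)%N) [::] 0 [::]) 0 m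
         = O n m B &
       asked s' = rcons (asked s) (MkQuery B)]).
Proof.
move=> hn hm hQ hkk ht Q0 n0 nmM m2M nM QM kM k2M M20 tmM tM B.
set w := coins s in B *; set U := step_cost M; have U0 : (0 < U)%N := step_cost_gt0 M.
pose j := head false w; have jm : (j * m <= m)%N by case: (j); rewrite ?mul1n ?mul0n.
pose K := (4 * (kk + m + 4) * U)%N.
apply: (@run_cost _ _ _ _ (U + ((n * (K + 2 * U) + 2 * U) + ((n * m + m + 3 * U) +
   (m * (U + 2 * U) + 2 * U))))).
  have : (n * m + m <= 2 * (n * m) * U)%N by nia.
  by rewrite /K; nia.
apply: (run_seq (Q1 := fun s1 => nmem s1 9 0%N = j /\ coins s1 = behead w)) => [|s1 f1 [hj1 hc1]].
  by apply: run_flip.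
case: (f1) => fn1 fr1 _ fq1.
apply: (run_seq (Q1 := fun s2 => coins s2 = drop (round_bits n kk) w /\
    read_matrix s2 3 n m = B)) => [|s2 f2 [hc2 hB2]].
  apply: (run_for (Inv := fun i s2 => coins s2 = drop (1 + i * kk) w /\
     (forall i' x, (i' < i)%N -> (x < m)%N -> rmem s2 3 (i' * m + x)%N =
       rmem s 0 (i' * m + x)%N + (row_mult Q kk w i')%:R * rmem s 0 (j * m + x)%N))) => //.
  - by split=> //; rewrite mul0n addn0 hc1 drop1.
  - by move=> i s2 hi [fn _ _ _] _ /=; rewrite fn // fn1 // hn; do !split=> //; lia.
  - move=> i s2 hi [fn fr _ _] h6 [hc hrows].
    apply: run_weaken (@run_row _ O M n m Q kk s2 i j _ _ _ _ h6 _ Q0 hi nmM m2M nM QM kM k2M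
      M20) (leqnn _) _;
      rewrite ?fn ?hj1 ?fn1 //.
    move=> s3 _ [hc3 hnew hold]; split.
      by rewrite hc3 hc drop_drop mulSn; congr drop; lia.
    move=> i' x; rewrite ltnS leq_eqVlt => /orP [/eqP -> xm|lt xm].
      by rewrite hnew // fr // fr1 // hc /row_mult -/j.
    by rewrite hold ?hrows // ltn_eqF.
  - move=> s2 f [hc hrows]; split=> //; apply/matrixP => i x; rewrite !mxE.
    exact: hrows.
have {}f2 := frame_seq f1 f2; case: (f2) => fn2 fr2 _ fq2.
apply: (run_seq (Q1 := fun s3 => [/\ coins s3 = drop (round_bits n kk) w,
    read_vector s3 4 m = O n m B & asked s3 = rcons (asked s) (MkQuery B)])) =>
      [|s3 f3 [hc3 hv3 hq3]].
  have e0 : nmem s2 0 0%N = n by rewrite fn2.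
  have e1 : nmem s2 0 1%N = m by rewrite fn2.
  eexists; split; first exact: ExecQuery.
    rewrite /= /ask /= e0 e1 hB2 fq2 //; split=> //.
    apply/rowP => x; rewrite !mxE /= /write_vector eqxx; case: insubP => [y _ hy|].
      by congr (O _ _ _ _ _); apply: val_inj.
    by rewrite ltn_ord.
  rewrite /= e0 e1 leq_add2l /U /step_cost; have := bitlen_gt0 M => ?.
  have le_b k : (k <= M)%N -> (bitlen k <= bitlen M)%N by exact: leq_bitlen.
  have := le_b _ (ltnW nM); have hmM : (m <= M)%N by lia.
  have h1M : (1 <= M)%N by lia.
  have := le_b _ hmM; have := le_b _ (leq0n M); have := le_b _ h1M; lia.
have {}f3 := frame_seq f2 f3; case: (f3) => fn3 fr3 _ _.
apply: (run_for (Inv := fun c s4 => [/\ coins s4 = coins s3, asked s4 = asked s3,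
   forall x, (x < t.+1 * m)%N -> rmem s4 5 x = rmem s 5 x &
   forall x, (x < c)%N -> rmem s4 5 (t.+1 * m + x)%N = rmem s3 4 x])) => //.
- lia.
- by split=> //= x _; rewrite fr3.
- move=> c s4 hcm [fn _ _ _] _; rewrite /= fn // fn3 // hm; do !split=> //; lia.
- move=> c s4 hcm [fn fr _ _] h10 [hc4 hq4 hlo hhi].
  have [e1 e5] : nmem s4 0 1%N = m /\ nmem s4 5 0%N = t by rewrite !fn // !fn3.
  apply: run_rset => //=.
  + rewrite e1 e5 h10 addn1; do !split=> //; nia.
  + rewrite h10; do !split=> //; lia.
  + move=> k; rewrite e1 e5 h10 addn1 fr //; split=> // x hx; rewrite /store /=.
      by rewrite ltn_eqF ?hlo //; lia.
    by rewrite eqn_add2l; have [->|ne] := eqVneq x c => //; rewrite hhi //; lia.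
- move=> s4 _ [hc4 hq4 hlo hhi]; split=> //; rewrite ?hc4 ?hq4 //.
  rewrite -hv3; apply/rowP => x; rewrite !mxE /=; exact: hhi.
Qed.

Definition round_start (n kk t : nat) : nat := (t * round_bits n kk)%N.

Definition pool_vec (R : realType) (O : oracle R) (n m Q kk : nat) (mem : nat -> R)
    (w : seq bool) (t : nat) : 'rV[R]_m :=
  if t is t'.+1 then O n m (query_mx n m Q kk mem (drop (round_start n kk t') w)) else 0.

Definition rounds_cmd : cmd := For 5 (nvar 4) round_cmd.

Lemma run_rounds (R : realType) (O : oracle R) M n m Q kk T (s : state R) :
  nmem s 0 0%N = n -> nmem s 0 1%N = m -> nmem s 2 0%N = Q -> nmem s 3 0%N = kk ->
  nmem s 4 0%N = T -> (0 < Q)%N -> (0 < n)%N ->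
  (n * m <= M)%N -> (2 * m < M)%N -> (n < M)%N -> (Q <= M)%N ->
  (kk < M)%N -> (2 ^ kk <= M)%N -> (20 <= M)%N -> (T.+1 * m <= M)%N -> (T < M)%N ->
  rmem s 5 = (fun => 0) -> asked s = [::] ->
  run O rounds_cmd s (16 * T.+1 * n * (kk + m + 5) * step_cost M)
    (fun s' => (forall t x (xm : (x < m)%N), (t <= T)%N -> rmem s' 5 (t * m + x)%N =
         pool_vec O n m Q kk (rmem s 0) (coins s) t 0 (Ordinal xm)) /\
       asked s' = [seq MkQuery (query_mx n m Q kk (rmem s 0)
         (drop (round_start n kk t) (coins s))) | t <- iota 0 T]).
Proof.
move=> hn hm hQ hkk hT Q0 n0 nmM m2M nM QM kM k2M M20 TmM TM h5 hq.
set w := coins s; set U := step_cost M; have U0 : (0 < U)%N := step_cost_gt0 M.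
apply: (@run_cost _ _ _ _ (T * ((16 * n * (kk + m + 4) * U) + 2 * U) + 2 * U)).
  by nia.
apply: (run_for (Inv := fun t s' => [/\ coins s' = drop (round_start n kk t) w,
  asked s' = [seq MkQuery (query_mx n m Q kk (rmem s 0) (drop (round_start n kk i) w))
     | i <- iota 0 t] &
  forall i x (xm : (x < m)%N), (i <= t)%N -> rmem s' 5 (i * m + x)%N =
         pool_vec O n m Q kk (rmem s 0) w i 0 (Ordinal xm)])) => //.
- split=> //; first by rewrite /round_start mul0n drop0.
  by case=> // x xm _; rewrite h5 mxE.
- move=> i s1 hi [fn _ _ _] _ /=; rewrite fn //= hT; do !split=> //; exact: ltnW.
- move=> t s1 ht [fn fr _ _] h5t [hc hqs hp].
  apply: run_weaken (@run_round _ O M n m Q kk t s1 _ _ _ _ _ Q0 n0 nmM m2M nM QM kM k2M M20 _ _)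
    (leqnn _) _;
    rewrite ?h5t ?fn //.
  + by apply: leq_trans TmM; rewrite leq_mul2r ltnS ht orbT.
  + exact: ltn_trans TM.
  move=> s2 _ [hc2 hlo hnew hq2]; split.
  + by rewrite hc2 hc drop_drop /round_start mulSn.
  + by rewrite hq2 hqs hc fr // -[in RHS]addn1 iotaD map_cat cats1.
  + move=> i x xm; rewrite leq_eqVlt => /orP [/eqP ->|].
      move/rowP/(_ (Ordinal xm)): hnew; rewrite !mxE /= => ->.
      by rewrite hc fr.
    rewrite ltnS => le; rewrite hlo ?hp //.
    have : (i * m <= t * m)%N by rewrite leq_mul2r le orbT.
    by rewrite mulSn; lia.
- by move=> s' _ [].
Qed.

(** * Selecting the shortest nonzero difference *)

Definition acc_expr : rexpr := RGet 6 (NConst 0).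
Definition best_expr : rexpr := RGet 7 (NConst 0).
Definition real0 : rexpr := RNat (NConst 0).

(* Real array 1 holds 1/q at index 1 and the key is the q-th power of the l_q
   norm, or the square of the maximum if 1/q = 0. *)
Definition key_step_cmd : cmd :=
  let d := RGet 8 (nvar 10) in
  let dd := RMul d d in
  If (TRLe (RGet 1 (NConst 1)) real0)
    (If (TRLe acc_expr dd) (RSet 6 (NConst 0) dd) Skip)
    (If (TRLe dd real0) Skip
      (RSet 6 (NConst 0) (RAdd acc_expr
         (RExp (RDiv (RLn dd) (RMul (RGet 1 (NConst 1)) (RNat (NConst 2)))))))).

Definition key_cmd : cmd :=
  Seq (RSet 6 (NConst 0) real0)
    (For 10 (NGet 0 (NConst 1))
      (Seq (RSet 8 (nvar 10) (RSub (RGet 5 (entry (nvar 12))) (RGet 5 (entry (nvar 13)))))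
           key_step_cmd)).

Definition copy_cmd : cmd :=
  Seq (RSet 7 (NConst 0) acc_expr)
      (For 10 (NGet 0 (NConst 1)) (RSet 2 (nvar 10) (RGet 8 (nvar 10)))).

Definition update_cmd : cmd :=
  If (TRLe acc_expr real0) Skip
    (If (TRLe best_expr real0) copy_cmd
      (If (TRLe acc_expr best_expr) copy_cmd Skip)).

Definition pool_size_expr : nexpr := NAdd (nvar 4) (NConst 1).

Definition select_cmd : cmd :=
  For 12 pool_size_expr (For 13 pool_size_expr (Seq key_cmd update_cmd)).

(** With u = 1/q, [expR (ln (d * d) / (u * 2))] is |d|^q, obtained without an absolute value. The
    case d = 0 is separate because [expR] never vanishes. *)
Definition key_step (R : realType) (u acc d : R) : R :=
  if u <= 0 then (if acc <= d * d then d * d else acc)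
  else if d * d <= 0 then acc else acc + expR (ln (d * d) / (u * 2)).

Fixpoint key_upto (R : realType) (u : R) (d : nat -> R) (k : nat) : R :=
  if k is k'.+1 then key_step u (key_upto u d k') (d k') else 0.

Lemma eq_key_upto (R : realType) (u : R) (d d' : nat -> R) k :
  (forall x, (x < k)%N -> d x = d' x) -> key_upto u d k = key_upto u d' k.
Proof.
elim: k => //= k IH h; rewrite IH ?h // => x hx; apply: h; exact: ltnW.
Qed.

Lemma run_key (R : realType) (O : oracle R) M m T a b (s : state R) :
  nmem s 0 1%N = m -> nmem s 12 0%N = a -> nmem s 13 0%N = b ->
  (a <= T)%N -> (b <= T)%N -> (T.+1 * m <= M)%N -> (m < M)%N -> (20 <= M)%N ->
  (T < M)%N ->
  let d x := rmem s 5 (a * m + x)%N - rmem s 5 (b * m + x)%N in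
  run O key_cmd s (16 * m.+1 * step_cost M)
    (fun s' => rmem s' 6 0%N = key_upto (rmem s 1 1%N) d m /\
       forall x, (x < m)%N -> rmem s' 8 x = d x).
Proof.
move=> hm ha hb aT bT TmM mM M20 TM d; set U := step_cost M.
have amM : (a * m + m <= M)%N by apply: leq_trans TmM;
  rewrite addnC -mulSn leq_mul2r ltnS aT orbT.
have bmM : (b * m + m <= M)%N by apply: leq_trans TmM;
  rewrite addnC -mulSn leq_mul2r ltnS bT orbT.
apply: (@run_cost _ _ _ _ (U + (m * ((U + (U + ((U + (U + 0)) + (U + (0 + U))))) + 2 * U) + 2 *
  U))).
  by nia.
apply: (run_seq (Q1 := fun s1 => rmem s1 6 0%N = 0)) => [|s1 f1 h1].
  by apply: run_rset.
case: (f1) => fn1 fr1 _ _.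
apply: (run_for (Inv := fun c s2 => rmem s2 6 0%N = key_upto (rmem s 1 1%N) d c /\
       forall x, (x < c)%N -> rmem s2 8 x = d x)) => //.
- move=> i s2 hi [fn _ _ _] _ /=; rewrite fn // fn1 // hm; do !split=> //; lia.
- move=> c s2 hc [fn fr _ _] h10 [h6 h8].
  have [e1 e12 e13] : [/\ nmem s2 0 1%N = m, nmem s2 12 0%N = a & nmem s2 13 0%N = b].
    by rewrite !fn // !fn1.
  have e5 : rmem s2 5 = rmem s 5 by rewrite fr // fr1.
  have eu : rmem s2 1 = rmem s 1 by rewrite fr // fr1.
  apply: (run_seq (Q1 := fun s3 => rmem s3 6 0%N = key_upto (rmem s 1 1%N) d c /\
       forall x, (x < c.+1)%N -> rmem s3 8 x = d x)) => [|s3 f3 [g6 g8]].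
    apply: run_rset => //=; rewrite ?e1 ?e12 ?e13 ?h10 ?e5.
    + by do !split=> //; lia.
    + by do !split=> //; lia.
    + move=> k; split=> // x; rewrite ltnS leq_eqVlt /store /= => /orP [/eqP ->|hx].
        by rewrite eqxx.
      by rewrite ltn_eqF ?h8.
  case: (f3) => fn3 fr3 _ _.
  have e10 : nmem s3 10 0%N = c by rewrite fn3.
  have ev : rmem s3 1 1%N = rmem s 1 1%N by rewrite fr3 // eu.
  have e8 : rmem s3 8 c = d c by rewrite g8.
  have cM : (c <= M)%N by lia.
  have M1 : (1 <= M)%N by lia.
  have M2 : (2 <= M)%N by lia.
  rewrite /key_upto -/(key_upto _ _ _) /key_step.
  apply: run_if => //=; rewrite ?ev.
    move=> hu k; rewrite hu.
    apply: run_if => //=; rewrite ?e10 ?e8 ?g6 //.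
      by move=> hle k'; apply: run_rset => //=; rewrite e10 // => k''; rewrite e8 hle.
    by move=> hle k'; apply: run_skip; rewrite /= (negbTE hle).
  move=> hu k; rewrite (negbTE hu).
  apply: run_if => //=; rewrite ?e10 ?e8 //.
  - by move=> hle k'; apply: run_skip; rewrite hle.
  - move=> hle k'; apply: run_rset => //=; first by rewrite e10; do !split.
    by move=> k''; rewrite e10 ev e8 g6 (negbTE hle).
Qed.

(* best = 0 encodes that no pair with a positive key has been seen. *)
Definition best_so_far (R : realType) (u : R) (m : nat) (pool : nat -> nat -> R)
    (seen : nat -> nat -> Prop) (best : R) (out : nat -> R) : Prop :=
  let key a b := key_upto u (fun x => pool a x - pool b x) m in
  (best = 0 /\ forall a b, seen a b -> key a b <= 0) \/
  [/\ 0 < best, best = key_upto u out m,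
     exists a b, seen a b /\ (forall x, (x < m)%N -> out x = pool a x - pool b x) &
     forall a b, seen a b -> key a b <= 0 \/ best <= key a b].

Lemma run_copy (R : realType) (O : oracle R) M m (s : state R) :
  nmem s 0 1%N = m -> (m < M)%N -> (20 <= M)%N ->
  run O copy_cmd s (8 * m.+1 * step_cost M)
    (fun s' => rmem s' 7 0%N = rmem s 6 0%N /\
       forall x, (x < m)%N -> rmem s' 2 x = rmem s 8 x).
Proof.
move=> hm mM M20; set U := step_cost M.
apply: (@run_cost _ _ _ _ (U + (m * (U + 2 * U) + 2 * U))); first by nia.
apply: (run_seq (Q1 := fun s1 => rmem s1 7 0%N = rmem s 6 0%N)) => [|s1 f1 h1].
  by apply: run_rset.
case: (f1) => fn1 fr1 _ _.
apply: (run_for (Inv := fun c s2 => rmem s2 7 0%N = rmem s 6 0%N /\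
   forall x, (x < c)%N -> rmem s2 2 x = rmem s 8 x)) => //.
- move=> i s2 hi [fn _ _ _] _ /=; rewrite fn // fn1 // hm; do !split=> //; lia.
- move=> c s2 hc [fn fr _ _] h10 [h7 h2].
  apply: run_rset => //=; rewrite h10.
  + by do !split=> //; lia.
  + by do !split=> //; lia.
  + move=> k; split=> // x; rewrite ltnS leq_eqVlt /store /= => /orP [/eqP ->|hx].
      by rewrite eqxx fr // fr1.
    by rewrite ltn_eqF ?h2.
Qed.

Lemma run_pair (R : realType) (O : oracle R) M m T a b (seen : nat -> nat -> Prop)
    (s : state R) :
  nmem s 0 1%N = m -> nmem s 12 0%N = a -> nmem s 13 0%N = b ->
  (a <= T)%N -> (b <= T)%N -> (T.+1 * m <= M)%N -> (m < M)%N -> (20 <= M)%N ->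
  (T < M)%N ->
  let u := rmem s 1 1%N in let pool i x := rmem s 5 (i * m + x)%N in
  best_so_far u m pool seen (rmem s 7 0%N) (rmem s 2) ->
  run O (Seq key_cmd update_cmd) s (35 * m.+1 * step_cost M)
    (fun s' => best_so_far u m pool
       (fun i j => seen i j \/ (i = a /\ j = b)) (rmem s' 7 0%N) (rmem s' 2)).
Proof.
move=> hm ha hb aT bT TmM mM M20 TM u pool hbest; set U := step_cost M.
apply: (@run_cost _ _ _ _ (16 * m.+1 * U + (U + (0 + (U + (8 * m.+1 * U + (U + (8 * m.+1 * U +
  0)))))))).
  by nia.
apply: (run_seq (@run_key _ O M m T a b s hm ha hb aT bT TmM mM M20 TM)) => s1 f1 [h6 h8].
case: (f1) => fn1 fr1 _ _.
have e1 : nmem s1 0 1%N = m by rewrite fn1.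
set key := key_upto _ _ _ in h6.
have M1 : (0 <= M)%N by [].
have e7 : rmem s1 7 = rmem s 7 by rewrite fr1.
have e2 : rmem s1 2 = rmem s 2 by rewrite fr1.
(* Both branches that copy end here: the new key is positive and no earlier positive key is
   smaller. *)
have take_new s2 : (forall i j, seen i j -> key_upto u (fun x => pool i x - pool j x) m <= 0
      \/ key <= key_upto u (fun x => pool i x - pool j x) m) ->
    0 < key -> rmem s2 7 0%N = rmem s1 6 0%N /\
       (forall x, (x < m)%N -> rmem s2 2 x = rmem s1 8 x) ->
    best_so_far u m pool (fun i j => seen i j \/ (i = a /\ j = b)) (rmem s2 7 0%N) (rmem s2 2).
  move=> hle k0 [g7 g2]; right; rewrite g7 h6; split=> //.
  - by apply: eq_key_upto => x hx; rewrite g2 // h8.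
  - by exists a, b; split; [right | move=> x hx; rewrite g2 // h8].
  - by move=> i j [/hle //|[-> ->]]; right.
apply: run_if => //=; rewrite h6.
  move=> key0 k; apply: run_skip; rewrite /= e7 e2.
  case: hbest => [[b0 hs]|[b0 hb1 hb2 hs]]; [left | right].
    by split=> // i j [/hs //|[-> ->]].
  split=> //; first by case: hb2 => i [j [sij hx]]; exists i, j; split=> //; left.
  by move=> i j [/hs //|[-> ->]]; left.
rewrite -ltNge => key0 k; apply: run_if => //=; rewrite e7.
  move=> best0 k'; apply: run_weaken (@run_copy _ O M m (tick k' (tick k s1)) e1 mM M20) _ _ =>
    // s2 _.
  apply: take_new => // i j sij; left.
  case: hbest => [[_ hs]|[b0 _ _ _]]; first exact: hs.
  by move: best0; rewrite leNgt b0.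
rewrite -ltNge => best0 k'; apply: run_if => //=; rewrite h6 e7.
  move=> hle k2; apply: run_weaken (@run_copy _ O M m (tick k2 (tick k' (tick k s1))) e1 mM M20)
    _ _ => // s2 _.
  apply: take_new => // i j sij.
  case: hbest => [[b0 hs]|[b0 _ _ hs]]; first by left; apply: hs.
  by case: (hs _ _ sij) => h; [left | right; apply: le_trans h].
rewrite -ltNge => hlt k2; apply: run_skip; rewrite /= e7 e2.
case: hbest => [[b0 hs]|[b0 hb1 hb2 hs]]; first by move: best0; rewrite b0 ltxx.
right; split=> //; first by case: hb2 => i [j [sij hx]]; exists i, j; split=> //; left.
by move=> i j [/hs //|[-> ->]]; right; apply: ltW.
Qed.

Lemma best_so_far_sub (R : realType) (u : R) m pool (seen seen' : nat -> nat -> Prop) best out :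
  (forall a b, seen a b <-> seen' a b) ->
  best_so_far u m pool seen best out -> best_so_far u m pool seen' best out.
Proof.
move=> h; have -> // : seen = seen'.
by apply/funext => a; apply/funext => b; apply/propext.
Qed.

Lemma run_select (R : realType) (O : oracle R) M m T (s : state R) :
  nmem s 0 1%N = m -> nmem s 4 0%N = T ->
  (T.+1 * m <= M)%N -> (m < M)%N -> (20 <= M)%N -> (T.+1 < M)%N ->
  rmem s 7 0%N = 0 ->
  run O select_cmd s (50 * T.+2 * T.+2 * m.+1 * step_cost M)
    (fun s' => best_so_far (rmem s 1 1%N) m (fun i x => rmem s 5 (i * m + x)%N)
       (fun i j => (i <= T)%N /\ (j <= T)%N) (rmem s' 7 0%N) (rmem s' 2)).
Proof.
move=> hm hT TmM mM M20 TM h7; set U := step_cost M; have U0 : (0 < U)%N := step_cost_gt0 M.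
have TM' : (T < M)%N by lia.
set u := rmem s 1 1%N; set pool := fun i x : nat => rmem s 5 (i * m + x)%N.
pose K := (T.+1 * (35 * m.+1 * U + 2 * U) + 2 * U)%N.
have K1 : (K <= 40 * T.+2 * m.+1 * U)%N by rewrite /K; nia.
apply: (@run_cost _ _ _ _ (T.+1 * (K + 2 * U) + 2 * U)); first by nia.
apply: (run_for (Inv := fun a s1 => best_so_far u m pool
   (fun i j => (i < a)%N /\ (j <= T)%N) (rmem s1 7 0%N) (rmem s1 2))) => //.
- by left; split=> // a b [].
- move=> i s1 hi [fn _ _ _] _ /=; rewrite fn // hT; do !split=> //; lia.
- move=> a s1 ha [fn fr _ _] h12 hI.
  apply: (run_for (Inv := fun b s2 => best_so_far u m pool
   (fun i j => (i < a)%N /\ (j <= T)%N \/ i = a /\ (j < b)%N) (rmem s2 7 0%N) (rmem s2 2))) => //.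
  + by apply: best_so_far_sub hI => i j; split=> [|[//|[]//]]; left.
  + by move=> i s2 hi [fn2 _ _ _] _ /=; rewrite fn2 // fn // hT; do !split=> //; lia.
  + move=> b s2 hb [fn2 fr2 _ _] h13 hI2.
    have e5 : rmem s2 5 = rmem s 5 by rewrite fr2 // fr.
    have eu : rmem s2 1 = rmem s 1 by rewrite fr2 // fr.
    apply: run_weaken (@run_pair _ O M m T a b _ s2 _ _ h13 ha hb TmM mM M20 TM' _) (leqnn _) _.
    * by rewrite fn2 // fn.
    * by rewrite fn2 // h12.
    * by rewrite e5 eu; exact: hI2.
    * move=> s3 _; rewrite e5 eu; apply: best_so_far_sub => i j.
      by rewrite ltnS (leq_eqVlt j b); split=> [[[?|[-> ->]]|[-> ->]]|[?|[-> /orP [/eqP ->|->]]]];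
        rewrite ?eqxx ?orbT; tauto.
  + move=> s2 _; apply: best_so_far_sub => i j; rewrite !ltnS (leq_eqVlt i a).
    by split=> [[[-> ->]|[-> ->]]|[/orP [/eqP ->|->] ->]]; rewrite ?eqxx ?orbT; tauto.
Qed.

(** * Running the program for eps and choosing the sizes *)

(** The precision parameter is [m]: as m 2^-m <= 1, the error changes eps m / 8 by at most 1/8,
    which the [+ 1] in [bound_expr] absorbs. *)
Definition eps_cmd (c : cmd) : cmd :=
  Seq (NSet 20 (NConst 0) (NGet 0 (NConst 0)))
 (Seq (NSet 20 (NConst 1) (NGet 0 (NConst 1)))
 (Seq (NSet 20 (NConst 2) (NGet 0 (NConst 1)))
      (cshift 20 c))).

Lemma run_eps (R : realType) (O : oracle R) M c n m (s s0 : state R) :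
  plain c ->
  exec (fun _ _ _ => 0) c
    (State (nat_input [:: n; m; m]) (fun _ _ => 0) [::] 0 [::]) s0 ->
  nmem s = nat_input [:: n; m] ->
  (forall a, (20 <= a)%N -> rmem s a = fun=> 0) ->
  (n <= M)%N -> (m <= M)%N -> (20 <= M)%N ->
  run O (eps_cmd c) s (3 * step_cost M + clock s0)
    (fun s' => rmem s' 20 0%N = rmem s0 0%N 0%N).
Proof.
move=> pc ex hn hr nM mM M20; set U := step_cost M.
have in0 : forall a, (0 < a)%N -> nat_input [:: n; m] a = fun=> 0%N.
  by move=> a; rewrite lt0n /nat_input => /negbTE ->.
apply: (@run_cost _ _ _ _ (U + (U + (U + clock s0)))); first by lia.
apply: (run_seq (Q1 := fun s1 => nmem s1 20 = store (nat_input [:: n; m]) 20 0 n 20)).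
  apply: run_nset => //=; first by rewrite hn /= ; do !split=> //; lia.
  by move=> k; rewrite hn.
move=> s1 f1 h1; case: (f1) => fn1 _ _ _.
have e1 : nmem s1 0 1%N = m by rewrite fn1 // hn.
apply: (run_seq (Q1 := fun s2 => nmem s2 20 = store (nmem s1) 20 1 m 20)).
  by apply: run_nset => //=; [lia | rewrite e1; do !split=> //; lia | rewrite e1].
move=> s2 f2 h2; case: (f2) => fn2 _ _ _.
have e2 : nmem s2 0 1%N = m by rewrite fn2.
apply: (run_seq (Q1 := fun s3 => nmem s3 20 = store (nmem s2) 20 2 m 20)).
  by apply: run_nset => //=; [lia | rewrite e2; do !split=> //; lia | rewrite e2].
move=> s3 f3 h3; case: (f3) => fn3 _ _ _.
have f13 := frame_seq f1 (frame_seq f2 f3); case: (f13) => fn fr _ _.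
(* Cells 0 to 2 of the natural array 20 now hold n, m, m, and everything else from array 20 on is
   zero: the relocated program sees exactly its official input. *)
have hsim : sim 20 (State (nat_input [:: n; m; m]) (fun _ _ => 0) [::] 0 [::]) s3.
  split=> a i /=; last by rewrite fr //= hr // leq_addl.
  case: a => [|a]; last first.
    have -> : nmem s3 (a.+1 + 20)%N = nmem s (a.+1 + 20)%N.
      by apply: fn; rewrite /= !inE !negb_or gtn_eqF // addSn ltnS leq_addl.
    by rewrite hn in0 // addSn.
  rewrite add0n h3 /store eqxx /= h2 /store eqxx /= h1 /store eqxx /= in0 // /nat_input eqxx.
  by case: i => [|[|[|i]]] //=; rewrite nth_nil.
have [s4 [ex4 [hs4 hr4] hc4]] := exec_shift O ex pc hsim.
exists s4; split=> //; first exact: (hr4 0%N 0%N).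
by move: hc4 => /=; lia.
Qed.

Lemma eps_frame (R : realType) c (s s' : state R) : plain c -> frame (eps_cmd c) s s' ->
  [/\ forall a, (a < 20)%N -> nmem s' a = nmem s a,
      forall a, (a < 20)%N -> rmem s' a = rmem s a,
      coins s' = coins s & asked s' = asked s].
Proof.
move=> pc [fn fr fc fq]; have [h1 h2] := cshift_plain 20 pc; split.
- move=> a ha; apply: fn; rewrite /= !inE !negb_or.
  by have [-> _] := cshift_writes c ha; rewrite !ltn_eqF.
- move=> a ha; apply: fr; by have [_ ->] := cshift_writes c ha.
- by apply: fc; rewrite /= h1.
- by apply: fq; rewrite /= h2.
Qed.

(** [a] is the least exponent with [X <= 2 ^ a]. The equation between booleans is the form in which
    the doubling loop meets its exit test. *)
Definition first_pow (R : realType) (X : R) (a : nat) : Prop :=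
  forall i, (i <= a)%N -> (X <= (2 ^ i)%:R) = (i == a).

Lemma first_powP (R : realType) (X : R) : exists a, first_pow X a.
Proof.
have h : exists i, X <= (2 ^ i)%:R.
  exists (Num.bound `|X|); apply: le_trans (ler_norm X) _.
  apply: le_trans (ltW (archi_boundP (normr_ge0 X))) _.
  by rewrite ler_nat ltnW // ltn_expl.
exists (ex_minn h) => i; case: ex_minnP => a ha amin ia.
have [->|ne] := eqVneq i a; first by [].
by apply/negbTE; apply: contraNN ne => /amin; rewrite eqn_leq ia => ->.
Qed.

(** The number N of vectors sought is the next power of 2; it is at least exp(eps m / 8), the bound
    of [class_count]. The 8 keeps N^4 of order exp(eps m / 2), which is at most 2^(eps m). *)
Definition bound_expr : rexpr :=
  RExp (RAdd (RDiv (RMul (RGet 20 (NConst 0)) (RNat (NGet 0 (NConst 1)))) (RNat (NConst 8)))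
    (RNat (NConst 1))).

(** The lower bound 4 N gamma m that [congruent_parallel] demands of the modulus. *)
Definition modulus_expr : rexpr :=
  RMul (RMul (RMul (RNat (NConst 4)) (RNat (nvar 1))) (RGet 1 (NConst 2)))
       (RNat (NGet 0 (NConst 1))).

(** A round makes progress with probability at least 1/(4Q), so [boosting] bounds the failure
    probability by (1 - 1/(8Q))^T 2^N. With T = 8 Q (N + 2) the power is at most exp(-N - 2), which
    beats 2^N and leaves at most exp(-2) < 1/3. *)
Definition rounds_number (Q N : nat) : nat := (8 * Q * (N + 2))%N.

Definition sizes_cmd : cmd :=
  Seq (NSet 1 (NConst 0) (NConst 1))
 (Seq (While (TNot (TRLe bound_expr (RNat (nvar 1))))
        (NSet 1 (NConst 0) (NAdd (nvar 1) (nvar 1))))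
 (Seq (NSet 2 (NConst 0) (NConst 1))
 (Seq (NSet 3 (NConst 0) (NConst 0))
 (Seq (While (TNot (TRLe modulus_expr (RNat (nvar 2))))
        (Seq (NSet 2 (NConst 0) (NAdd (nvar 2) (nvar 2)))
             (NSet 3 (NConst 0) (NAdd (nvar 3) (NConst 1)))))
   (NSet 4 (NConst 0)
     (NMul (NMul (NConst 8) (nvar 2)) (NAdd (nvar 1) (NConst 2)))))))).

Lemma run_sizes (R : realType) (O : oracle R) M m a kk (s : state R) :
  nmem s 0 1%N = m -> (m <= M)%N -> (20 <= M)%N ->
  first_pow (expR (rmem s 20 0%N * m%:R / 8 + 1)) a ->
  first_pow (4 * (2 ^ a)%:R * rmem s 1 2%N * m%:R) kk ->
  (rounds_number (2 ^ kk) (2 ^ a) <= M)%N ->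
  run O sizes_cmd s (4 * (a + kk + 3) * step_cost M)
    (fun s' => [/\ nmem s' 2 0%N = (2 ^ kk)%N, nmem s' 3 0%N = kk &
       nmem s' 4 0%N = rounds_number (2 ^ kk) (2 ^ a)]).
Proof.
move=> hm mM M20 ha hk TM; set U := step_cost M; have U0 : (0 < U)%N := step_cost_gt0 M.
have aM : (2 ^ a <= M)%N by apply: leq_trans TM; rewrite /rounds_number; have := expn_gt0 2 kk;
  nia.
have kM : (2 ^ kk <= M)%N by apply: leq_trans TM; rewrite /rounds_number; nia.
apply: (@run_cost _ _ _ _ (U + ((a * (U + U) + U) + (U + (U + ((kk * (U + (U + U)) + U) + U)))))).
  by lia.
apply: (run_seq (Q1 := fun s1 => nmem s1 1 0%N = 1%N)) => [|s1 f1 h1].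
  by apply: run_nset => //=; lia.
apply: (run_seq (Q1 := fun s2 => nmem s2 1 0%N = (2 ^ a)%N)) => [|s2 f2 h2].
  case: (f1) => fn1 fr1 _ _.
  apply: (run_while (Inv := fun i s2 => nmem s2 1 0%N = (2 ^ i)%N)) => //.
  - move=> i s2 ia [fn fr _ _] hi.
    have iM : (2 ^ i <= M)%N by apply: leq_trans aM; rewrite leq_exp2l.
    rewrite /= hi fn // fn1 // hm fr // fr1 // ha // (ltn_neqAle i a) ia andbT.
    by do !split=> //; lia.
  - move=> i s2 ia [fn fr _ _] hi.
    have iM : (2 ^ i.+1 <= M)%N by apply: leq_trans aM; rewrite leq_exp2l.
    have iM' : (2 ^ i <= M)%N by apply: leq_trans iM; rewrite leq_exp2l.
    by apply: run_nset => //= [|k]; rewrite hi addnn -mul2n -expnS //; do !split.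
have {}f2 := frame_seq f1 f2.
apply: (run_seq (Q1 := fun s3 => nmem s3 2 0%N = 1%N)) => [|s3 f3 h3].
  by apply: run_nset => //=; lia.
apply: (run_seq (Q1 := fun s4 => nmem s4 3 0%N = 0%N)) => [|s4 f4 h4].
  by apply: run_nset => //=; lia.
have {}h3 : nmem s4 2 0%N = 1%N by case: f4 => -> //.
have {}h2 : nmem s4 1 0%N = (2 ^ a)%N by case: f4 => -> //; case: f3 => -> //.
have {}f4 := frame_seq f2 (frame_seq f3 f4); case: (f4) => fn4 fr4 _ _.
apply: (run_seq (Q1 := fun s5 => nmem s5 2 0%N = (2 ^ kk)%N /\ nmem s5 3 0%N = kk)) =>
  [|s5 f5 [h5 h5']].
  apply: (run_while (Inv := fun i s5 => nmem s5 2 0%N = (2 ^ i)%N /\ nmem s5 3 0%N = i)) => //.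
  - move=> i s5 ik [fn fr _ _] [hi hi'].
    have iM : (2 ^ i <= M)%N by apply: leq_trans kM; rewrite leq_exp2l.
    rewrite /= hi fn // fn // h2 fn4 // hm fr // fr4 // hk // (ltn_neqAle i kk) ik andbT.
    by do !split=> //; lia.
  - move=> i s5 ik [fn fr _ _] [hi hi'].
    have iM : (2 ^ i.+1 <= M)%N by apply: leq_trans kM; rewrite leq_exp2l.
    have iM' : (2 ^ i <= M)%N by apply: leq_trans iM; rewrite leq_exp2l.
    have ikM : (i < 2 ^ i)%N := ltn_expl i (ltnSn 1).
    apply: (run_seq (Q1 := fun s6 => nmem s6 2 0%N = (2 ^ i.+1)%N)) => [|s6 f6 h6].
      by apply: run_nset => //= [|k]; rewrite hi addnn -mul2n -expnS //; do !split.
    have e3 : nmem s6 3 0%N = i by case: f6 => -> //.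
    apply: run_nset => //=; rewrite e3; first by do !split=> //; lia.
    by move=> k; rewrite addn1 /store eqxx /=.
have e1 : nmem s5 1 0%N = (2 ^ a)%N by case: f5 => -> //.
have e3 := h5; apply: run_nset => //=; rewrite h5 e1.
- move: TM; rewrite /rounds_number => TM; do !split=> //; try lia;
    by have := expn_gt0 2 kk; have := expn_gt0 2 a; nia.
- by move=> k; split=> //=; rewrite /store /= .
Qed.

(** * The whole program and its running time *)

Definition main_cmd (c : cmd) : cmd :=
  Seq (eps_cmd c) (Seq sizes_cmd (Seq rounds_cmd select_cmd)).

(** A crude bound on all naturals computed outside the program for eps; among them are the addresses
    in the pool, up to (T + 1) m, and in the query matrix, up to n m. *)
Definition value_bound (m T : nat) : nat := (20 * T.+2 * m * m)%N.

Definition main_cost (m a kk : nat) : nat :=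
  let T := rounds_number (2 ^ kk) (2 ^ a) in
  (100 * T.+2 * T.+2 * m * (m + a + kk + 6) * step_cost (value_bound m T))%N.

Lemma main_cost_sum x n m a kk U c : (0 < m)%N -> (n <= m)%N ->
  (3 * U + c + (4 * (a + kk + 3) * U + (16 * x.+1 * n * (kk + m + 5) * U
     + 50 * x.+2 * x.+2 * m.+1 * U))
   <= 100 * x.+2 * x.+2 * m * (m + a + kk + 6) * U + c)%N.
Proof.
move=> m0 nm; set z := (m + a + kk + 6)%N; set P := (x.+2 * x.+2 * m * z)%N.
have z7 : (7 <= z)%N by rewrite /z; lia.
have h1 : (a + kk + 3 <= P)%N.
  apply: (@leq_trans z); first by rewrite /z; lia.
  by rewrite /P leq_pmull // !muln_gt0.
have h2 : (x.+1 * n * (kk + m + 5) <= P)%N.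
  rewrite /P; apply: leq_mul; last by rewrite /z; lia.
  by apply: leq_mul => //; apply: (@leq_trans x.+2) => //; rewrite leq_pmulr.
have h3 : (x.+2 * x.+2 * m.+1 <= P)%N.
  rewrite /P -[X in (_ <= X)%N]mulnA leq_mul2l; apply/orP; right.
  by apply: (@leq_trans (m * 7)); [lia | rewrite leq_mul2l z7 orbT].
have -> : (100 * x.+2 * x.+2 * m * z * U = 100 * P * U)%N by rewrite /P -!mulnA.
have -> : (16 * x.+1 * n * (kk + m + 5) = 16 * (x.+1 * n * (kk + m + 5)))%N by rewrite !mulnA.
have -> : (50 * x.+2 * x.+2 * m.+1 = 50 * (x.+2 * x.+2 * m.+1))%N by rewrite !mulnA.
move: h1 h2 h3; set A := (_ * _ * (kk + m + 5))%N; set D := (_ * _ * m.+1)%N.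
move=> h1 h2 h3; rewrite -!mulnDl addnAC -mulnDl leq_add2r leq_mul2r; apply/orP; right.
by lia.
Qed.

(** The interface between program and mathematics: queries and pool become functions of the coins,
    and the output is described by [best_so_far]. The exponents [a] and [kk] are those found by the
    doubling loops. *)
Lemma run_main (R : realType) (O : oracle R) c n m a kk (params : seq R)
    (B : 'M[R]_(n, m)) (w : seq bool) (s0 : state R) :
  (0 < n <= m)%N -> plain c ->
  exec (fun _ _ _ => 0) c
    (State (nat_input [:: n; m; m]) (fun _ _ => 0) [::] 0 [::]) s0 ->
  first_pow (expR (rmem s0 0%N 0%N * m%:R / 8 + 1)) a ->
  first_pow (4 * (2 ^ a)%:R * nth 0 params 2 * m%:R) kk ->
  let T := rounds_number (2 ^ kk) (2 ^ a) in
  let mem := nth 0 [seq B i j | i <- enum 'I_n, j <- enum 'I_m] in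
  run O (main_cmd c) (input_state params B w) (main_cost m a kk + clock s0)
    (fun s' => asked s' = [seq MkQuery (query_mx n m (2 ^ kk) kk mem
         (drop (round_start n kk t) w)) | t <- iota 0 T] /\
       exists pool : nat -> nat -> R,
        (forall t x (xm : (x < m)%N), (t <= T)%N -> pool t x =
         pool_vec O n m (2 ^ kk) kk mem w t 0 (Ordinal xm)) /\
        best_so_far (nth 0 params 1) m pool
          (fun i j => (i <= T)%N /\ (j <= T)%N) (rmem s' 7 0%N) (rmem s' 2)).
Proof.
move=> /andP [n0 nm] pc ex ha hk T mem; set s := input_state _ _ _.
pose M := value_bound m T; set U := step_cost M.
have U0 : (0 < U)%N := step_cost_gt0 M.
have m0 : (0 < m)%N by apply: leq_trans nm.
have a0 : (0 < 2 ^ a)%N by rewrite expn_gt0.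
have k0 : (0 < 2 ^ kk)%N by rewrite expn_gt0.
have kT : (2 ^ kk <= T)%N by rewrite /T /rounds_number; nia.
have klt : (kk < 2 ^ kk)%N := ltn_expl kk (ltnSn 1).
have mm : (m <= m * m)%N by rewrite leq_pmull.
have M1 : (20 * T.+2 * m <= M)%N by rewrite /M /value_bound -[X in (X <= _)%N]muln1 leq_mul2l m0
  orbT.
have TmM : (T.+2 * m <= M)%N by apply: leq_trans M1; rewrite -mulnA leq_pmull.
have M2 : (20 * T.+2 <= M)%N by apply: leq_trans M1; rewrite leq_pmulr.
have M3 : (20 * m * m <= M)%N by rewrite /M /value_bound -!mulnA leq_mul2l /= leq_pmull.
have nmM : (n * m <= M)%N by apply: leq_trans M3; nia.
have m2M : (2 * m < M)%N by apply: leq_trans M3; nia.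
have nM : (n < M)%N by lia.
have M20 : (20 <= M)%N by lia.
apply: (@run_cost _ _ _ _ ((3 * U + clock s0) + (4 * (a + kk + 3) * U +
   (16 * T.+1 * n * (kk + m + 5) * U + 50 * T.+2 * T.+2 * m.+1 * U)))).
  exact: main_cost_sum.
have sz : size [seq B i j | i <- enum 'I_n, j <- enum 'I_m] = (n * m)%N.
  by rewrite size_allpairs !size_enum_ord.
apply: (run_seq (@run_eps _ O M c n m s s0 pc ex _ _ _ _ _)) => //.
- by case=> [|[|i]].
- by exact: ltnW.
- by lia.
move=> s1 /(eps_frame pc) [fn1 fr1 fc1 fq1] he.
apply: (run_seq (@run_sizes _ O M m a kk s1 _ _ _ _ _ _)) => //.
- by rewrite fn1.
- by lia.
- by rewrite he.
- by rewrite fr1.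
- by rewrite -/T; lia.
move=> s2 f2 [h2 h3 h4]; case: (f2) => fn2 fr2 fc2 fq2.
apply: (run_seq (@run_rounds _ O M n m (2 ^ kk) kk T s2 _ _ h2 h3 h4 k0 n0 nmM m2M nM _ _ _ M20 _
  _ _ _)).
- by rewrite fn2 // fn1.
- by rewrite fn2 // fn1.
- by lia.
- by lia.
- by lia.
- by apply: leq_trans TmM; rewrite leq_mul2r leqnSn orbT.
- by lia.
- by rewrite fr2 // fr1.
- by rewrite fq2 // fq1.
have r0 : rmem s2 0 = mem by rewrite fr2 // fr1.
have c0 : coins s2 = w by rewrite fc2 // fc1.
rewrite r0 c0 => s3 f3 [hp hq]; case: (f3) => fn3 fr3 _ _.
apply: run_weaken (@run_select _ O M m T s3 _ _ _ _ M20 _ _) (leqnn _) _.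
- by rewrite fn3 // fn2 // fn1.
- by rewrite fn3.
- by apply: leq_trans TmM; rewrite leq_mul2r leqnSn orbT.
- by lia.
- by lia.
- by rewrite fr3 // fr2 // fr1.
move=> s4 [_ _ _ fq4] hbest; split; first by rewrite fq4.
exists (fun i x => rmem s3 5 (i * m + x)%N); split=> //.
by move: hbest; rewrite fr3 // fr2 // fr1.
Qed.
(** * Norms *)

Lemma powRV (R : realType) (c r : R) : 0 <= c -> c^-1 `^ r = (c `^ r)^-1.
Proof. by move=> c0; rewrite -powR_inv1 // -powRrM mulN1r powRN. Qed.

Lemma powRDp (R : realType) (x r s : R) : 0 < x -> x `^ (r + s) = x `^ r * x `^ s.
Proof. by move=> x0; rewrite powRD // (lt0r_neq0 x0) implybT. Qed.

(** The tangent of u^r at u = 1, read off Young's inequality with second factor 1. Convexity and the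
    comparison of norms below both rest on it. *)
Lemma powR_tangent (R : realType) (u r : R) : 0 <= u -> 1 <= r ->
  u <= u `^ r / r + (1 - r^-1).
Proof.
move=> u0; rewrite le_eqVlt => /orP [/eqP <-|r1].
  by rewrite powRr1 // invr1 mulr1 subrr addr0.
have r0 : 0 < r by apply: lt_trans r1.
have r1' : r - 1 != 0 by rewrite subr_eq0 gt_eqF.
have c0 : 0 < 1 - r^-1 by rewrite subr_gt0 invf_lt1.
have := @conjugate_powR _ u 1 r (1 - r^-1)^-1 u0 ler01 r0.
rewrite invr_gt0 => /(_ c0); rewrite invrK mulr1 powR1 mul1r; apply.
by rewrite addrC subrK.
Qed.

(** After division by the mean [c], the tangent inequality at 1 applies to a/c and b/c, and its
    weighted average is the claim. *)
Lemma powR_convex (R : realType) (t a b r : R) : 0 <= t <= 1 -> 0 <= a -> 0 <= b -> 1 <= r ->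
  (t * a + (1 - t) * b) `^ r <= t * a `^ r + (1 - t) * b `^ r.
Proof.
move=> /andP [t0 t1] a0 b0 r1; set c := t * a + _.
have r0 : 0 < r by apply: lt_le_trans r1.
have t1' : 0 <= 1 - t by rewrite subr_ge0.
have : 0 <= c by rewrite addr_ge0 // mulr_ge0.
rewrite le_eqVlt => /orP [/eqP <-|c0].
  by rewrite powR0 ?gt_eqF // addr_ge0 // mulr_ge0 // powR_ge0.
have cr0 : 0 < c `^ r by rewrite powR_gt0.
have ha := powR_tangent (divr_ge0 a0 (ltW c0)) r1.
have hb := powR_tangent (divr_ge0 b0 (ltW c0)) r1.
rewrite powRM ?invr_ge0 ?(ltW c0) // powRV ?(ltW c0) // in ha.
rewrite powRM ?invr_ge0 ?(ltW c0) // powRV ?(ltW c0) // in hb.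
have e1 : t * (a / c) + (1 - t) * (b / c) = 1.
  by rewrite !mulrA -mulrDl divff // gt_eqF.
have := lerD (ler_wpM2l t0 ha) (ler_wpM2l t1' hb); rewrite e1.
set A := a `^ r; set B := b `^ r; set C := c `^ r => h.
have : 0 <= ((t * A + (1 - t) * B) / C - 1) / r.
  apply: le_trans (_ : 0 <= t * (A / C / r + (1 - r^-1)) + (1 - t) * (B / C / r + (1 - r^-1)) -
    1) _.
    by rewrite subr_ge0.
  rewrite le_eqVlt; apply/orP; left; apply/eqP; field.
  by rewrite /C !gt_eqF.
by rewrite pmulr_lge0 ?invr_gt0 // subr_ge0 ler_pdivlMr // mul1r.
Qed.

Definition powsum (R : realType) (r : R) m (x : 'rV[R]_m) : R := \sum_j `|x 0 j| `^ r.

Lemma powsum_ge0 (R : realType) (r : R) m (x : 'rV[R]_m) : 0 <= powsum r x.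
Proof. by apply: sumr_ge0 => j _; rewrite powR_ge0. Qed.

Lemma lpnorm_powsum (R : realType) (r : R) m (x : 'rV[R]_m) :
  lpnorm r%:E x = powsum r x `^ r^-1.
Proof. by []. Qed.

Lemma powR_lpnorm (R : realType) (r : R) m (x : 'rV[R]_m) : 1 <= r ->
  lpnorm r%:E x `^ r = powsum r x.
Proof.
move=> r1; have r0 : 0 < r by apply: lt_le_trans r1.
by rewrite lpnorm_powsum -powRrM mulVf ?gt_eqF // powRr1 // powsum_ge0.
Qed.

Lemma lpnorm_ge0 (R : realType) (p : \bar R) m (x : 'rV[R]_m) : 0 <= lpnorm p x.
Proof.
by case: p => [r| |] //=; [rewrite powR_ge0 | rewrite bigmax_ge_id].
Qed.

Lemma powR_leP (R : realType) (a b r : R) : 0 <= a -> 0 <= b -> 0 < r ->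
  (a `^ r <= b `^ r) = (a <= b).
Proof.
move=> a0 b0 r0; apply/idP/idP => [|ab]; last first.
  by apply: ge0_ler_powR => //; rewrite ?ltW.
by apply: contraLR; rewrite -!ltNge; apply: gt0_ltr_powR.
Qed.

Lemma lpnorm_leP (R : realType) (r b : R) m (x : 'rV[R]_m) : 1 <= r -> 0 <= b ->
  (lpnorm r%:E x <= b) = (powsum r x <= b `^ r).
Proof.
move=> r1 b0; rewrite -powR_lpnorm // powR_leP ?lpnorm_ge0 //.
exact: lt_le_trans r1.
Qed.

Lemma lpnorm_coord (R : realType) (p : \bar R) m (x : 'rV[R]_m) j : (1%:E <= p)%E ->
  `|x 0 j| <= lpnorm p x.
Proof.
case: p => [r| |] //= p1; last exact: le_bigmax.
rewrite lee_fin in p1; have r0 : 0 < r by apply: lt_le_trans p1.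
rewrite -[X in X <= _](@powRr1 _ `|x 0 j|) // -(@mulfV _ r) ?gt_eqF // powRrM.
rewrite powR_leP ?powR_ge0 ?invr_gt0 //; last exact: powsum_ge0.
rewrite (bigD1 j) //= lerDl; apply: sumr_ge0 => *; exact: powR_ge0.
Qed.

Lemma lpnorm0 (R : realType) (p : \bar R) m : (1%:E <= p)%E -> lpnorm p (0 : 'rV[R]_m) = 0.
Proof.
case: p => [r| |] //= p1.
  rewrite lee_fin in p1; have r0 : 0 < r by apply: lt_le_trans p1.
  rewrite big1 ?powR0 ?invr_eq0 ?gt_eqF // => j _.
  by rewrite mxE normr0 powR0 ?gt_eqF.
apply/eqP; rewrite eq_le bigmax_ge_id andbT.
by apply: bigmax_le => // j _; rewrite mxE normr0.
Qed.

Lemma lpnorm_gt0 (R : realType) (p : \bar R) m (x : 'rV[R]_m) : (1%:E <= p)%E ->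
  (0 < lpnorm p x) = (x != 0).
Proof.
move=> p1; apply/idP/idP => [h|x0].
  by apply: contraTneq h => ->; rewrite lpnorm0 // ltxx.
have /rowP/existsNP [j /eqP hj] : ~ (x = 0) by apply/eqP.
rewrite mxE in hj; apply: lt_le_trans (lpnorm_coord x j p1).
by rewrite normr_gt0.
Qed.

Lemma lpnormZ (R : realType) (p : \bar R) m (a : R) (x : 'rV[R]_m) : (1%:E <= p)%E ->
  lpnorm p (a *: x) = `|a| * lpnorm p x.
Proof.
case: p => [r| |] //= p1; last first.
- have h := normr_ge0 a; apply/eqP; rewrite eq_le; apply/andP; split.
    apply: bigmax_le => [|j _]; first by rewrite mulr_ge0 // bigmax_ge_id.
    by rewrite mxE normrM ler_wpM2l // le_bigmax.
  have [->|a0] := eqVneq a 0; first by rewrite normr0 mul0r bigmax_ge_id.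
  rewrite -ler_pdivlMl ?normr_gt0 //; apply: bigmax_le => [|j _].
    by rewrite mulr_ge0 ?invr_ge0 // bigmax_ge_id.
  by rewrite ler_pdivlMl ?normr_gt0 // -normrM; have := @le_bigmax _ _ _ 0 (fun j =>
    `|(a *: x) 0 j|) j; rewrite mxE.
rewrite lee_fin in p1; have r0 : 0 < r by apply: lt_le_trans p1.
under eq_bigr do rewrite mxE normrM powRM //.
rewrite -mulr_sumr powRM ?powR_ge0 //; last exact: powsum_ge0.
by rewrite -powRrM mulfV ?gt_eqF // powRr1.
Qed.

Lemma lpnormN (R : realType) (p : \bar R) m (x : 'rV[R]_m) : (1%:E <= p)%E ->
  lpnorm p (- x) = lpnorm p x.
Proof. by move=> p1; rewrite -scaleN1r lpnormZ // normrN1 mul1r. Qed.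

Lemma lpnormD (R : realType) (p : \bar R) m (x y : 'rV[R]_m) : (1%:E <= p)%E ->
  lpnorm p (x + y) <= lpnorm p x + lpnorm p y.
Proof.
move=> p1; have [->|x0] := eqVneq x 0; first by rewrite add0r lpnorm0 // add0r.
have [->|y0] := eqVneq y 0; first by rewrite addr0 lpnorm0 // addr0.
case: p p1 => [r| |] // p1; last first.
  apply: bigmax_le => [|j _]; first by rewrite addr_ge0 ?lpnorm_ge0.
  rewrite mxE; apply: le_trans (ler_normD _ _) _.
  by apply: lerD; apply: (lpnorm_coord (p := +oo%E)).
have a0 : 0 < lpnorm r%:E x by rewrite lpnorm_gt0.
have b0 : 0 < lpnorm r%:E y by rewrite lpnorm_gt0.
rewrite lee_fin in p1; have r0 : 0 < r by apply: lt_le_trans p1.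
have [a aE] : exists a, a = lpnorm r%:E x := ex_intro _ _ erefl.
have [b bE] : exists b, b = lpnorm r%:E y := ex_intro _ _ erefl.
rewrite -aE in a0 *; rewrite -bE in b0 *.
have ab0 : 0 < a + b by rewrite addr_gt0.
rewrite lpnorm_leP ?(ltW ab0) //.
(* This weight makes (|x_j| + |y_j|) / (a + b) a convex combination of |x_j| / a and |y_j| / b,
   whose r-th powers each sum to 1. *)
pose t := a / (a + b).
have t01 : 0 <= t <= 1.
  apply/andP; split; first by apply: divr_ge0; apply: ltW.
  by rewrite /t ler_pdivrMr // mul1r lerDl ltW.
have tE : 1 - t = b / (a + b) by rewrite /t; field; rewrite gt_eqF.
apply: (@le_trans _ _ (\sum_j (a + b) `^ r * (t * (`|x 0 j| / a) `^ r + (1 - t) * (`|y 0 j| / b)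
  `^ r))).
  apply: ler_sum => j _; rewrite mxE.
  apply: (@le_trans _ _ ((a + b) `^ r * (t * (`|x 0 j| / a) + (1 - t) * (`|y 0 j| / b)) `^ r));
    last first.
    apply: ler_wpM2l; first exact: powR_ge0.
    by apply: powR_convex => //; apply: divr_ge0; rewrite ?normr_ge0 // ltW.
  have h0 : 0 <= t * (`|x 0 j| / a) + (1 - t) * (`|y 0 j| / b).
    by case/andP: t01 => ? ?; rewrite addr_ge0 // mulr_ge0 ?subr_ge0 // divr_ge0 // ltW.
  rewrite -powRM ?(ltW ab0) // powR_leP ?normr_ge0 ?mulr_ge0 ?(ltW ab0) //.
  apply: le_trans (ler_normD _ _) _.
  rewrite le_eqVlt; apply/orP; left; apply/eqP; rewrite tE /t; field.
  by rewrite !gt_eqF.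
rewrite -mulr_sumr ger_pMr ?powR_gt0 // big_split /= -!mulr_sumr.
have hs m' (z : 'rV[R]_m') c : 0 < c -> c = lpnorm r%:E z -> \sum_j (`|z 0 j| / c) `^ r = 1.
  move=> c0 cE; under eq_bigr do rewrite powRM ?invr_ge0 ?(ltW c0) //.
  rewrite -mulr_suml -/(powsum r z) -powR_lpnorm // -cE -powRM ?invr_ge0 ?(ltW c0) //.
  by rewrite divff ?gt_eqF // powR1.
by rewrite (hs _ x a a0 aE) (hs _ y b b0 bE) !mulr1 addrC subrK lexx.
Qed.

(** Each |x_j| is at most N = ||x||_r, so |x_j|^s <= |x_j|^r N^(s - r); summation gives N^s. *)
Lemma lpnorm_le (R : realType) (p q : \bar R) m (x : 'rV[R]_m) :
  (1%:E <= p)%E -> (p <= q)%E -> lpnorm q x <= lpnorm p x.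
Proof.
case: q => [s| |]; last by case: p.
  case: p => [r| |]; [rewrite !lee_fin => r1 rs | by rewrite leye_eq | by []].
  have s1 : 1 <= s by apply: le_trans rs.
  have [N NE] : exists N, N = lpnorm r%:E x := ex_intro _ _ erefl.
  have N0 : 0 <= N by rewrite NE lpnorm_ge0.
  rewrite -NE lpnorm_leP //.
  have key c : 0 <= c -> c <= N -> c `^ s <= c `^ r * N `^ (s - r).
    rewrite le_eqVlt => /orP [/eqP <- _|c0 cN].
      by rewrite powR0 ?mulr_ge0 ?powR_ge0 // gt_eqF // (lt_le_trans ltr01).
    have -> : c `^ s = c `^ r * c `^ (s - r).
      by rewrite -powRDp // addrC subrK.
    apply: ler_wpM2l; first exact: powR_ge0.
    by apply: ge0_ler_powR; rewrite ?subr_ge0 ?nnegrE // ltW.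
  apply: (@le_trans _ _ (\sum_j `|x 0 j| `^ r * N `^ (s - r))).
    by apply: ler_sum => j _; apply: key => //; rewrite NE; apply: lpnorm_coord.
  rewrite -mulr_suml -/(powsum r x) -powR_lpnorm // -NE -powRD; last first.
    by rewrite addrC subrK gt_eqF // (lt_le_trans ltr01).
  by rewrite addrC subrK.
move=> p1 _; apply: bigmax_le => [|j _]; first exact: lpnorm_ge0.
exact: lpnorm_coord.
Qed.

Lemma lpnorm_holder (R : realType) (r : R) (q : \bar R) m (x : 'rV[R]_m) :
  1 <= r -> (r%:E <= q)%E -> (0 < m)%N ->
  lpnorm r%:E x <= m%:R `^ (r^-1 - inv_exponent q) * lpnorm q x.
Proof.
move=> r1 rq m0; have r0 : 0 < r by apply: lt_le_trans r1.
have mR : 0 < m%:R :> R by rewrite ltr0n.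
have q1 : (1%:E <= q)%E by apply: le_trans rq; rewrite lee_fin.
have [->|x0] := eqVneq x 0; first by rewrite !lpnorm0 // mulr0.
have cmax j : `|x 0 j| <= lpnorm q x by apply: lpnorm_coord.
have [c cE] : exists c, c = lpnorm q x := ex_intro _ _ erefl.
have c0 : 0 < c by rewrite cE lpnorm_gt0.
rewrite -cE in cmax *.
rewrite lpnorm_leP ?mulr_ge0 ?powR_ge0 ?(ltW c0) //.
rewrite powRM ?powR_ge0 ?(ltW c0) // -powRrM mulrBl mulVf ?gt_eqF //.
have main (B : R) : 0 < B -> \sum_j (`|x 0 j| / B) `^ r <= m%:R ->
    powsum r x <= m%:R * B `^ r.
  move=> B0; under eq_bigr do rewrite powRM ?invr_ge0 ?(ltW B0) //.
  rewrite -mulr_suml powRV ?(ltW B0) //.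
  by rewrite ler_pdivrMr ?powR_gt0.
have mE : m%:R = \sum_(j < m) 1 :> R by rewrite sumr_const card_ord.
case: q rq q1 cE => [s| |] // rq q1 cE /=; last first.
  rewrite mul0r subr0 powRr1 ?(ltW mR) //.
  apply: main => //; rewrite mE; apply: ler_sum => j _.
  rewrite -[X in _ <= X](congr1 (fun f => f r) (powR1 R)) ge0_ler_powR ?(ltW r0) // ?nnegrE
    ?divr_ge0 ?(ltW c0) //.
  by rewrite ler_pdivrMr // mul1r.
rewrite lee_fin in rq; have s0 : 0 < s by apply: lt_le_trans rq.
(* [B] is the power mean of order s of the coordinates, so the (|x_j| / B)^s sum to m; the tangent
   inequality with exponent s/r carries this bound over to order r. *)
pose B := m%:R `^ (- s^-1) * c.
have B0 : 0 < B by rewrite mulr_gt0 // powR_gt0.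
have -> : m%:R `^ (1 - s^-1 * r) * c `^ r = m%:R * B `^ r.
  rewrite /B powRM ?powR_ge0 ?(ltW c0) // -powRrM mulrA; congr (_ * _).
  rewrite powRDp //.
  by rewrite powRr1 ?(ltW mR) // mulNr.
apply: main => //.
have sr1 : 1 <= s / r by rewrite ler_pdivlMr // mul1r.
have sr0 : 0 < s / r by apply: lt_le_trans sr1.
apply: (@le_trans _ _ (\sum_j ((`|x 0 j| / B) `^ s / (s / r) + (1 - (s / r)^-1)))).
  apply: ler_sum => j _; have := powR_tangent (powR_ge0 (`|x 0 j| / B) r) sr1.
  by rewrite -powRrM mulrCA mulfV ?gt_eqF // mulr1.
rewrite big_split /= -mulr_suml.
have -> : \sum_j (`|x 0 j| / B) `^ s = m%:R.
  under eq_bigr do rewrite powRM ?invr_ge0 ?(ltW B0) //.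
  rewrite -mulr_suml powRV ?(ltW B0) // -/(powsum s x) -powR_lpnorm; last first.
    by rewrite -lee_fin.
  rewrite -cE /B powRM ?powR_ge0 ?(ltW c0) // -powRrM mulNr mulVf ?gt_eqF // powRN.
  rewrite powRr1 ?(ltW mR) //; field.
  by rewrite !gt_eqF ?powR_gt0.
rewrite sumr_const card_ord -[X in _ + X]mulr_natl -mulrDr.
by rewrite addrC subrK mulr1.
Qed.

(** A form uniform in all exponents, including infinite ones; it is the source of the factor m in
    the modulus. *)
Lemma lpnorm_crude (R : realType) (p q : \bar R) m (x : 'rV[R]_m) :
  (1%:E <= p)%E -> (p <= q)%E -> (0 < m)%N -> lpnorm p x <= m%:R * lpnorm q x.
Proof.
move=> p1 pq m0; have m1 : 1 <= m%:R :> R by rewrite ler1n.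
case: p p1 pq => [r| |] // p1 pq; last first.
  move: pq; rewrite leye_eq => /eqP ->; by rewrite ler_peMl // lpnorm_ge0.
rewrite lee_fin in p1; have r0 : 0 < r by apply: lt_le_trans p1.
apply: le_trans (lpnorm_holder x p1 pq m0) _.
rewrite ler_wpM2r ?lpnorm_ge0 // -[X in _ <= X](@powRr1 _ m%:R) //.
apply: ler_powR => //; apply: (@le_trans _ _ r^-1); last by rewrite invf_le1.
rewrite gerBl; case: q pq => [s| |] //=; rewrite lee_fin => rs.
by rewrite invr_ge0; apply: le_trans rs; apply: ltW.
Qed.

(** * Counting integer vectors of small l_1 norm *)

(** A code stands for a bounded integer: [None] is 0 and [Some (b, k)] is k + 1 with sign bit b. The
    weight is the absolute value. *)
Definition code_weight K (c : option (bool * 'I_K.+1)) : nat :=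
  if c is Some bk then bk.2.+1 else 0%N.

(** The right-hand side is the full generating series of t^|z| over all integers z. *)
Lemma sum_code_weight (R : realType) K (t : R) : 0 < t < 1 ->
  \sum_(c : option (bool * 'I_K.+1)) t ^+ code_weight c <= (1 + t) / (1 - t).
Proof.
move=> /andP [t0 t1]; have t1' : 0 < 1 - t by rewrite subr_gt0.
have -> : \sum_(c : option (bool * 'I_K.+1)) t ^+ code_weight c =
    1 + (\sum_(k < K.+1) t ^+ k.+1 + \sum_(k < K.+1) t ^+ k.+1).
  rewrite (bigD1 None) //= expr0; congr (1 + _).
  have -> : \sum_(k < K.+1) t ^+ k.+1 + \sum_(k < K.+1) t ^+ k.+1 =
      \sum_(b : bool) \sum_(k < K.+1) t ^+ k.+1 by rewrite big_bool.
  rewrite pair_big /= (reindex_omap Some id) => [|[c|] //].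
  by apply: eq_big => [c|[b k] _] //=; rewrite eqxx.
have -> : \sum_(k < K.+1) t ^+ k.+1 = t * \sum_(k < K.+1) t ^+ k.
  by rewrite mulr_sumr; apply: eq_bigr => k _; rewrite exprS.
have hS := subrX1 t K.+1; set s := \sum_(k < K.+1) t ^+ k in hS *.
have {}hS : (1 - t) * s = 1 - t ^+ K.+1 by rewrite -[RHS]opprB hS; ring.
rewrite ler_pdivlMr // -mulrDr mulrDl mul1r.
have -> : t * (s + s) * (1 - t) = 2 * t * ((1 - t) * s) by ring.
have tK : 0 <= t ^+ K.+1 by rewrite exprn_ge0 // ltW.
by rewrite hS; nra.
Qed.

(** Every counted vector of codes contributes at least t^K to the m-th power of the generating
    function, since t < 1. *)
Lemma card_codes (R : realType) m K (t : R) : 0 < t < 1 ->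
  #|[set f : {ffun 'I_m -> option (bool * 'I_K.+1)} | (\sum_j code_weight (f j) <= K)%N]|%:R
    * t ^+ K <= ((1 + t) / (1 - t)) ^+ m.
Proof.
move=> t01; have /andP [t0 t1] := t01.
rewrite -sum1_card natr_sum mulr_suml.
apply: (@le_trans _ _ (\sum_(f : {ffun 'I_m -> option (bool * 'I_K.+1)})
    \prod_j t ^+ code_weight (f j))).
  rewrite big_mkcond; apply: ler_sum => f _; rewrite inE prodrXr.
  case: ifP => h; last by rewrite exprn_ge0 // ltW.
  by rewrite mul1r ler_wiXn2l // ltW.
rewrite -(bigA_distr_bigA (fun _ c => t ^+ code_weight c)) /= -[X in _ ^+ X]card_ord -prodr_const.
apply: ler_prod => j _; apply/andP; split; last exact: sum_code_weight.
by apply: sumr_ge0 => c _; rewrite exprn_ge0 // ltW.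
Qed.

(** Truncation is towards zero, so all reals below [tau] in absolute value share one code whatever
    their sign. [inord] is faithful as long as k' <= K. *)
Definition trunc_code (R : realType) (tau : R) K (a : R) : option (bool * 'I_K.+1) :=
  let k := Num.truncn (`|a| / tau) in
  if k is k'.+1 then Some (a < 0, inord k') else None.

Lemma trunc_code_weight (R : realType) (tau : R) K (a : R) :
  (Num.truncn (`|a| / tau) <= K)%N ->
  code_weight (trunc_code tau K a) = Num.truncn (`|a| / tau).
Proof.
by rewrite /trunc_code; case: Num.truncn => //= k hk; rewrite inordK // ltnS ltnW.
Qed.

(** For the zero code, |a - b| <= |a| + |b| and both terms are below [tau]; otherwise the signs
    agree, |a - b| <= tau and |a| >= tau. The minimum, rather than [tau] alone, keeps small
    coordinates from adding up in the l_q norm. *)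
Lemma trunc_code_close (R : realType) (tau : R) K (a b : R) : 0 < tau ->
  (Num.truncn (`|a| / tau) <= K)%N -> (Num.truncn (`|b| / tau) <= K)%N ->
  trunc_code tau K a = trunc_code tau K b ->
  `|a - b| <= 2 * Num.min tau (Num.max `|a| `|b|).
Proof.
move=> tau0 aK bK hab.
have wab : Num.truncn (`|a| / tau) = Num.truncn (`|b| / tau).
  by rewrite -(trunc_code_weight aK) -(trunc_code_weight bK) hab.
have itv (c : R) : (Num.truncn (`|c| / tau))%:R * tau <= `|c| < (Num.truncn (`|c| / tau)).+1%:R *
  tau.
  have c0 : 0 <= `|c| / tau by rewrite divr_ge0 // ltW.
  have := truncn_itv c0; rewrite ler_pdivlMr // ltr_pdivrMr //.
have := itv a; have := itv b; rewrite -wab.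
move: hab; rewrite /trunc_code -wab; case: (Num.truncn (`|a| / tau)) => [|k].
  move=> _; rewrite mul1r => /andP [_ hb] /andP [_ ha].
  have h1 : `|a - b| <= `|a| + `|b| by rewrite (le_trans (ler_normB _ _)).
  apply: le_trans h1 _.
  case: (leP `|a| `|b|) => hle; case: (leP tau _) => hle2; lra.
move=> [sgn] /andP [b1 b2] /andP [a1 a2].
have d1 : `| `|a| - `|b| | <= tau.
  rewrite ler_norml; move: a1 a2 b1 b2.
  rewrite -[k.+2%:R]natr1 mulrDl mul1r; set z := k.+1%:R * tau => *; apply/andP; split; lra.
have d0 : tau <= `|a|.
  apply: le_trans a1; rewrite ler_peMl ?(ltW tau0) //; by rewrite ler1n.
have -> : `|a - b| = `| `|a| - `|b| |.
  case: (ltP a 0) sgn => ha; case: (ltP b 0) => hb // _.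
    by rewrite (ltr0_norm ha) (ltr0_norm hb) -opprD normrN.
  by rewrite (ger0_norm ha) (ger0_norm hb).
apply: le_trans d1 _; rewrite (_ : Num.min tau _ = tau); first by lra.
by apply/min_idPl; rewrite le_max d0.
Qed.

Lemma pigeonhole (T : eqType) (I : finType) (A : {set I}) (f : T -> I) (V : seq T) :
  uniq V -> {in V, forall v, f v \in A} -> (#|A| < size V)%N ->
  exists v w, [/\ v \in V, w \in V, v != w & f v = f w].
Proof.
move=> uV hA hlt; have : ~~ uniq [seq f v | v <- V].
  apply: contraTN hlt => u; rewrite -leqNgt -(size_map f) cardE.
  apply: uniq_leq_size => // i /mapP [v hv ->]; by rewrite mem_enum hA.
elim: V uV {hA hlt} => //= v V IH /andP [vV uV].
rewrite negb_and negbK => /orP [/mapP [w wV e]|/IH].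
  exists v, w; split=> //; rewrite ?inE ?eqxx ?wV ?orbT //.
  by apply: contraNneq vV => ->.
by case=> // a [b [ha hb ne e]]; exists a, b; rewrite !inE ha hb !orbT.
Qed.

(* Truncating the coordinates of a vector of l_r norm at most A to multiples of
   tau = A / (delta m)^(1/r) leaves few classes, and two vectors of the same
   class are close in l_q norm. *)
Lemma close_pair (R : realType) (r : R) (q : \bar R) m (A delta t : R) (V : seq 'rV[R]_m) :
  1 <= r -> (r%:E <= q)%E -> (0 < m)%N -> 0 < A -> 0 < delta -> 0 < t < 1 ->
  uniq V -> {in V, forall v, lpnorm r%:E v <= A} ->
  ((1 + t) / (1 - t)) ^+ m / t `^ (delta * m%:R) < (size V)%:R ->
  exists v w, [/\ v \in V, w \in V, v != w &
    lpnorm q (v - w) <= 4 * A * (delta * m%:R) `^ (- (r^-1 - inv_exponent q))].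
Proof.
move=> r1 rq m0 A0 d0 t01 uV hV hcard; have /andP [t0 t1] := t01.
have r0 : 0 < r by apply: lt_le_trans r1.
set D := delta * m%:R; have D0 : 0 < D by rewrite mulr_gt0 // ltr0n.
set K := Num.truncn D; pose tau := A / D `^ r^-1.
have tau0 : 0 < tau by rewrite divr_gt0 // powR_gt0.
have taur : tau `^ r = A `^ r / D.
  rewrite powRM ?(ltW A0) ?invr_ge0 ?powR_ge0 // powRV ?powR_ge0 //.
  by rewrite -powRrM mulVf ?gt_eqF // powRr1 // ltW.
(* A natural number is at most its r-th power, so the total weight is at most the sum of (|v_j| /
   tau)^r, which is at most [D] because tau^r = A^r / D. *)
have hsum v : v \in V -> (\sum_j Num.truncn (`|v 0%R j| / tau)%R <= K)%N.
  move=> vV; rewrite /K truncn_ge_nat ?(ltW D0) // natr_sum.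
  apply: (@le_trans _ _ (\sum_j (`|v 0 j| / tau) `^ r)).
    apply: ler_sum => j _; have c0 : 0 <= `|v 0 j| / tau by rewrite divr_ge0 // ltW.
    have /andP [h _] := truncn_itv c0.
    apply: (@le_trans _ _ ((Num.truncn (`|v 0 j| / tau))%:R `^ r)).
      case: Num.truncn => [|k]; first by rewrite powR_ge0.
      by apply: le1r_powR => //; rewrite ler1n.
    by apply: ge0_ler_powR => //; rewrite ?nnegrE // ltW.
  under eq_bigr do rewrite powRM ?invr_ge0 ?(ltW tau0) // powRV ?(ltW tau0) //.
  rewrite -mulr_suml -/(powsum r v) taur invf_div mulrA ler_pdivrMr ?powR_gt0 //.
  rewrite mulrC ler_pM2l //; rewrite -lpnorm_leP ?(ltW A0) //; exact: hV.
have hcoord v j : v \in V -> (Num.truncn (`|v 0%R j| / tau)%R <= K)%N.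
  by move=> vV; apply: leq_trans (hsum v vV); rewrite (bigD1 j) //= leq_addr.
pose f (v : 'rV[R]_m) := [ffun j => trunc_code tau K (v 0 j)].
pose S := [set g : {ffun 'I_m -> option (bool * 'I_K.+1)} | (\sum_j code_weight (g j) <= K)%N].
have hf : {in V, forall v, f v \in S}.
  move=> v vV; rewrite inE; under eq_bigr do rewrite ffunE trunc_code_weight ?hcoord //.
  exact: hsum.
have hS : (#|S| < size V)%N.
  rewrite -(ltr_nat R); apply: le_lt_trans hcard.
  rewrite ler_pdivlMr ?powR_gt0 //; apply: le_trans (card_codes m K t01).
  apply: ler_wpM2l => //; rewrite -powR_mulrn ?(ltW t0) //.
  apply: ger_powR; first by rewrite t0 ltW.
  by have /andP [] := truncn_itv (ltW D0).
have [v [w [vV wV ne e]]] := pigeonhole uV hf hS.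
exists v, w; split=> //.
have hd j : `|(v - w) 0 j| <= 2 * Num.min tau (Num.max `|v 0 j| `|w 0 j|).
  rewrite !mxE; apply: (@trunc_code_close _ tau K) => //; try exact: hcoord.
  by move/ffunP: e => /(_ j); rewrite !ffunE.
have target0 : 0 <= 4 * A * D `^ (- (r^-1 - inv_exponent q)).
  by rewrite mulr_ge0 ?powR_ge0 // mulr_ge0 // ltW.
have DrE : D `^ (- r^-1) = tau / A.
  by rewrite powRN /tau; field; rewrite (gt_eqF A0) (gt_eqF (powR_gt0 _ D0)).
case: q rq target0 => [s| |] // rq target0; last first.
  have target0' := target0; rewrite /= subr0 DrE in target0' *.
  have -> : 4 * A * (tau / A) = 4 * tau by field; rewrite gt_eqF.
  apply: bigmax_le => [|j _]; first by rewrite mulr_ge0 // ltW.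
  apply: le_trans (hd j) _; apply: (@le_trans _ _ (2 * tau)); last by lra.
  by rewrite ler_pM2l // ge_min lexx.
rewrite lee_fin in rq; have s1 : 1 <= s by apply: le_trans rq.
have s0 : 0 < s by apply: lt_le_trans s1.
rewrite lpnorm_leP //.
(* Interpolation: [s - r] of the exponent is paid by [tau], and the remaining [r] by coordinates
   whose r-th powers sum to at most A^r for each vector. *)
have hmin j : (Num.min tau (Num.max `|v 0 j| `|w 0 j|)) `^ s <=
    tau `^ (s - r) * (`|v 0 j| `^ r + `|w 0 j| `^ r).
  set M := Num.max _ _.
  have M0 : 0 <= M by rewrite le_max normr_ge0.
  have Mr : M `^ r <= `|v 0 j| `^ r + `|w 0 j| `^ r.
    rewrite /M; case: (leP `|v 0 j| `|w 0 j|) => _; [rewrite lerDr | rewrite lerDl];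
      exact: powR_ge0.
  move: M0; rewrite le_eqVlt => /orP [/eqP <-|M0].
    have -> : Num.min tau 0 = 0 by apply/min_idPr; exact: ltW.
    by rewrite powR0 ?gt_eqF // mulr_ge0 ?powR_ge0 // addr_ge0 ?powR_ge0.
  set mu := Num.min _ _; have mu0 : 0 < mu by rewrite lt_min tau0 M0.
  have -> : mu `^ s = mu `^ (s - r) * mu `^ r by rewrite -powRDp // subrK.
  apply: ler_pM; rewrite ?powR_ge0 //.
    by apply: ge0_ler_powR; rewrite ?subr_ge0 ?nnegrE ?(ltW mu0) ?(ltW tau0) // ge_min lexx.
  apply: le_trans Mr; apply: ge0_ler_powR; rewrite ?nnegrE ?(ltW mu0) ?(ltW M0) ?(ltW r0) //.
  by rewrite ge_min lexx orbT.
apply: (@le_trans _ _ (\sum_j 2 `^ s * (tau `^ (s - r) * (`|v 0 j| `^ r + `|w 0 j| `^ r)))).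
  apply: ler_sum => j _.
  apply: (@le_trans _ _ ((2 * Num.min tau (Num.max `|v 0 j| `|w 0 j|)) `^ s)).
    apply: ge0_ler_powR; rewrite ?nnegrE ?(ltW s0) //.
    by apply: le_trans (hd j).
  rewrite powRM // ?ler_wpM2l ?powR_ge0 //.
  by rewrite le_min (ltW tau0) le_max normr_ge0.
rewrite -!mulr_sumr big_split /= -/(powsum r v) -/(powsum r w).
have hA u : u \in V -> powsum r u <= A `^ r by move=> uV'; rewrite -lpnorm_leP ?(ltW A0) // hV.
apply: (@le_trans _ _ (2 `^ s * (tau `^ (s - r) * (2 * A `^ r)))).
  rewrite !ler_wpM2l ?powR_ge0 //; have := hA _ vV; have := hA _ wV; lra.
have -> : 4 * A * D `^ (- (r^-1 - inv_exponent s%:E)) = 2 * 2 * (A * D `^ (- (r^-1 - s^-1))).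
  by rewrite /=; ring.
rewrite powRM ?mulr_ge0 ?powR_ge0 ?(ltW A0) //.
(* One factor 2 comes from [hd]; the other absorbs the presence of two vectors, as 2 <= 2^s. *)
have -> : (2 * 2 : R) `^ s = 2 `^ s * 2 `^ s by rewrite powRM.
rewrite -mulrA ler_wpM2l ?powR_ge0 //.
have -> : (A * D `^ (- (r^-1 - s^-1))) `^ s = tau `^ (s - r) * A `^ r.
  rewrite powRM ?(ltW A0) ?powR_ge0 // /tau (powRM _ (ltW A0)) ?invr_ge0 ?powR_ge0 //.
  rewrite powRV ?powR_ge0 // -!powRrM -powRN mulrAC -powRDp // subrK; congr (_ * _ `^ _).
  by field; rewrite !gt_eqF.
rewrite mulrCA ler_wpM2r ?mulr_ge0 ?powR_ge0 //.
by rewrite -[X in X <= _](@powRr1 _ 2) // ler_powR // ler1n.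
Qed.
(** * Lattices and random sublattices *)

(** By [mem_sub_basis] these are the multipliers whose sublattice with pivot [j] contains a vector
    with residues [alpha]. The entry [c j] is free, like the overwritten coins of the pivot row. *)
Definition hyper n (Q : nat) (alpha : 'I_n -> 'Z_Q) (j : 'I_n) : {set {ffun 'I_n -> 'Z_Q}} :=
  [set c : {ffun 'I_n -> 'Z_Q} | alpha j == \sum_(i | i != j) c i * alpha i].

Lemma card_Zmod Q : (1 < Q)%N -> #|'Z_Q| = Q.
Proof. by move=> Q1; rewrite card_ord Zp_cast. Qed.

Lemma sum_shift n Q (alpha : 'I_n -> 'Z_Q) (j : 'I_n) (c d : 'I_n -> 'Z_Q) (h : 'Z_Q) :
  \sum_(i | i != j) (c i + h * d i) * alpha i =
  \sum_(i | i != j) c i * alpha i + h * \sum_(i | i != j) d i * alpha i.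
Proof.
by rewrite mulr_sumr -big_split /=; apply: eq_bigr => i _; rewrite mulrDl mulrA.
Qed.

Lemma sum_delta n Q (alpha : 'I_n -> 'Z_Q) (j i0 : 'I_n) : i0 != j ->
  \sum_(i | i != j) (i == i0)%:R * alpha i = alpha i0.
Proof.
move=> ne; rewrite (bigD1 i0) //= eqxx mul1r big1 ?addr0 // => i /andP [_ /negbTE ->].
by rewrite mul0r.
Qed.

(** Adding h to coordinate [i0] of the multipliers shifts the linear form by h alpha_i0. As
    [alpha i0] is a unit, the Q such translates of the hyperplane cover all multipliers. *)
Lemma card_hyper n Q (alpha : 'I_n -> 'Z_Q) (j i0 : 'I_n) : (1 < Q)%N ->
  i0 != j -> alpha i0 \is a GRing.unit -> (Q ^ n <= Q * #|hyper alpha j|)%N.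
Proof.
move=> Q1 ne ua.
pose f (hc : 'Z_Q * {ffun 'I_n -> 'Z_Q}) : {ffun 'I_n -> 'Z_Q} :=
  [ffun i => hc.2 i + hc.1 * (i == i0)%:R].
have -> : (Q ^ n = #|[set: {ffun 'I_n -> 'Z_Q}]|)%N.
  by rewrite cardsT card_ffun card_Zmod // card_ord.
have -> : (Q * #|hyper alpha j| = #|finset.setX [set: 'Z_Q] (hyper alpha j)|)%N.
  by rewrite cardsX cardsT card_Zmod.
apply: leq_trans (leq_imset_card f _); apply: subset_leq_card.
apply/fintype.subsetP => c _; apply/imsetP.
pose h := (\sum_(i | i != j) c i * alpha i - alpha j) / alpha i0.
exists (h, [ffun i => c i + (- h) * (i == i0)%:R]).
  rewrite !inE /=; apply/eqP; under eq_bigr do rewrite ffunE.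
  by rewrite sum_shift sum_delta // mulNr /h mulrVK // opprB addrC subrK.
by apply/ffunP => i; rewrite !ffunE /= mulNr subrK.
Qed.

Lemma Zmod_nat_eq0 Q (h : nat) (w : 'Z_Q) : (1 < Q)%N ->
  (h%:R * w == 0) = (Q %| h * w)%N.
Proof.
move=> Q1; rewrite -[w in LHS]natr_Zp -natrM.
by rewrite -val_eqE /= val_Zp_nat.
Qed.

(** Write h = 2^s h' with h' odd; then s <= e, and the odd part is coprime to the modulus. This is
    where a modulus that is a power of 2 pays off. *)
Lemma dvd2_small k e h w : (0 < h < 2 ^ e.+1)%N -> (2 ^ k %| h * w)%N -> (2 ^ k %| 2 ^ e * w)%N.
Proof.
move=> /andP [h0 he] hd.
have [s [h' [hE h'odd]]] : exists s h', h = (2 ^ s * h')%N /\ odd h'.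
  exists (logn 2 h), (h %/ 2 ^ logn 2 h)%N; split.
    by rewrite mulnC divnK // pfactor_dvdnn.
  have := pfactor_coprime (isT : prime 2) h0 => -[m' cop hm].
  rewrite [X in (X %/ _)%N]hm mulnK ?expn_gt0 //.
  by move: cop; rewrite coprime2n.
have se : (s <= e)%N.
  rewrite -ltnS -(@ltn_exp2l 2) //; apply: leq_ltn_trans he.
  by rewrite hE leq_pmulr // lt0n; apply: contraTneq h'odd => ->.
have d1 : (2 ^ k %| 2 ^ s * w)%N.
  move: hd; rewrite hE -mulnA mulnCA Gauss_dvdr //.
  by rewrite coprimeXl // coprime2n.
by apply: dvdn_trans d1 _; apply: dvdn_mul => //; rewrite dvdn_exp2l.
Qed.

(** The expressions in the second alternative are 2 x 2 minors of the two residue vectors. A minor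
    away from the pivot that survives multiplication by 2^e makes the two conditions nearly
    independent; if all minors die, the vectors are proportional up to the factor 2^e as soon as
    [alpha i0] is a unit. *)
Lemma card_two_hypers n k e (alpha beta : 'I_n -> 'Z_(2 ^ k)) (j i0 : 'I_n) :
  (0 < k)%N -> i0 != j -> (e < k)%N ->
  (2 ^ e.+1 * #|hyper alpha j :&: hyper beta j| <= #|hyper alpha j|)%N \/
  (forall i, (2 ^ e)%:R * (alpha i0 * beta i - beta i0 * alpha i) = 0).
Proof.
move=> k0 ne ek; set Q := (2 ^ k)%N.
have Q1 : (1 < Q)%N by rewrite -{1}(expn0 2) ltn_exp2l.
pose w i := alpha i0 * beta i - beta i0 * alpha i.
have [/existsP [i1 /andP [nej hw]]|hno] :=
  boolP [exists i1, (i1 != j) && ((2 ^ e)%:R * w i1 != 0)].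
  left.
  have hsmall h : (0 < h < 2 ^ e.+1)%N -> h%:R * w i1 != 0.
    move=> hh; apply: contra hw; rewrite !Zmod_nat_eq0 //; exact: dvd2_small.
  (* Moving along [d] preserves the [alpha] form and changes the [beta] form by [w i1]. Hence the
     translates of the intersection by h d, h < 2^(e+1), are disjoint subsets of [hyper alpha j]. *)
  pose d (i : 'I_n) : 'Z_Q := alpha i0 * (i == i1)%:R - alpha i1 * (i == i0)%:R.
  have dsum (g : 'I_n -> 'Z_Q) : \sum_(i | i != j) d i * g i = alpha i0 * g i1 - alpha i1 * g i0.
    rewrite -(sum_delta g nej) -(sum_delta g ne) !mulr_sumr -sumrB.
    by apply: eq_bigr => i _; rewrite mulrBl !mulrA.
  have da : \sum_(i | i != j) d i * alpha i = 0 by rewrite dsum mulrC subrr.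
  have db : \sum_(i | i != j) d i * beta i = w i1 by rewrite dsum /w [beta i0 * _]mulrC.
  set S := _ :&: _.
  pose f (hc : 'I_(2 ^ e.+1) * {ffun 'I_n -> 'Z_Q}) : {ffun 'I_n -> 'Z_Q} :=
    [ffun i => hc.2 i + hc.1%:R * d i].
  have fsum g hc : \sum_(i | i != j) f hc i * g i =
      \sum_(i | i != j) hc.2 i * g i + hc.1%:R * \sum_(i | i != j) d i * g i.
    by rewrite -sum_shift; apply: eq_bigr => i _; rewrite ffunE.
  rewrite -[X in (X * _ <= _)%N]card_ord -cardsT -cardsX.
  have finj : {in finset.setX [set: 'I_(2 ^ e.+1)] S &,  injective f}.
    move=> [h c] [h' c']; rewrite !inE /= => /andP [_ hb] /andP [_ hb'] ff.
    have hh : (h%:R - h'%:R) * w i1 = 0.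
      have := fsum beta (h, c); rewrite ff fsum /= db -(eqP hb) -(eqP hb').
      by move/addrI => e1; rewrite mulrBl e1 subrr.
    have eh : h = h'.
      have [lt|lt|/val_inj //] := ltngtP h h'.
        have := hsmall (h' - h)%N; rewrite subn_gt0 lt (leq_ltn_trans (leq_subr _ _)) ?ltn_ord //.
        by rewrite natrB ?(ltnW lt) // -opprB mulNr hh oppr0 eqxx => /(_ isT).
      have := hsmall (h - h')%N; rewrite subn_gt0 lt (leq_ltn_trans (leq_subr _ _)) ?ltn_ord //.
      by rewrite natrB ?(ltnW lt) // hh eqxx => /(_ isT).
    congr (_, _) => //; apply/ffunP => i; move/ffunP: ff => /(_ i).
    by rewrite !ffunE /= eh => /addIr.
  rewrite -(card_in_imset finj); apply: subset_leq_card.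
  apply/fintype.subsetP => _ /imsetP [[h c] hc ->]; move: hc; rewrite !inE /= => /andP [ha _].
  by rewrite fsum /= da mulr0 addr0.
have hall i : i != j -> (2 ^ e)%:R * w i = 0.
  move=> nei; move: hno; rewrite negb_exists => /forallP /(_ i).
  by rewrite nei /= negbK => /eqP.
(* The minor at the pivot is reached through a common solution [c], which expresses [alpha j] and
   [beta j] by the other entries; an empty intersection gives the first alternative at once. *)
have [->|/set0Pn [c]] := eqVneq (hyper alpha j :&: hyper beta j) finset.set0.
  by left; rewrite cards0 muln0.
rewrite !inE => /andP [/eqP ha /eqP hb]; right => i.
have [->|nei] := eqVneq i j; last exact: hall.
have -> : alpha i0 * beta j - beta i0 * alpha j = \sum_(i | i != j) c i * w i.
  rewrite ha hb !mulr_sumr -sumrB; apply: eq_bigr => l _.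
  by rewrite /w mulrBr ![c l * (_ * _)]mulrCA.
rewrite mulr_sumr big1 // => l nel.
by rewrite mulrCA hall ?mulr0.
Qed.

Lemma map_intr_inj (R : numDomainType) n m (a b : 'M[int]_(n, m)) :
  map_mx intr a = map_mx intr b :> 'M[R]_(n, m) -> a = b.
Proof. by move=> /matrixP h; apply/matrixP => i j; have := h i j; rewrite !mxE => /intr_inj. Qed.

Lemma lattice0 (R : realType) n m (B : 'M[R]_(n, m)) : lattice B 0.
Proof. by exists 0; rewrite map_mx0 mul0mx. Qed.

Lemma latticeB (R : realType) n m (B : 'M[R]_(n, m)) x y :
  lattice B x -> lattice B y -> lattice B (x - y).
Proof.
by move=> [a ->] [b ->]; exists (a - b); rewrite -mulmxBl -map_mxB.
Qed.

Lemma lambda1_le (R : realType) (p : \bar R) m (L : set 'rV[R]_m) y :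
  L y -> y != 0 -> lambda1 p L <= lpnorm p y.
Proof.
move=> Ly y0; apply: ge_inf; last by exists y.
by exists 0 => _ [x _ <-]; apply: lpnorm_ge0.
Qed.

Lemma has_inf_lattice (R : realType) (p : \bar R) n m (B : 'M[R]_(n, m)) :
  (0 < n)%N -> row_free B ->
  has_inf [set lpnorm p x | x in [set x | lattice B x /\ x != 0]]%classic.
Proof.
move=> n0 Bfree; split; last by exists 0 => _ [x _ <-]; apply: lpnorm_ge0.
pose i0 := Ordinal n0; exists (lpnorm p (row i0 B)); exists (row i0 B) => //.
split; first by exists (delta_mx 0 i0); rewrite map_delta_mx -rowE.
rewrite rowE; apply/eqP => h.
have : delta_mx 0 i0 = 0 :> 'rV[R]_n.
  by apply: (row_free_inj Bfree); rewrite h mul0mx.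
by move/rowP/(_ i0)/eqP; rewrite !mxE !eqxx oner_eq0.
Qed.

(** The pseudo-inverse recovers the integer coordinates of a lattice vector. A nonzero one has
    absolute value at least 1, so the norm is at least the inverse of a constant depending on the
    pseudo-inverse only. *)
Lemma lambda1_gt0 (R : realType) (p : \bar R) n m (B : 'M[R]_(n, m)) :
  (1%:E <= p)%E -> (0 < n)%N -> row_free B -> 0 < lambda1 p (lattice B).
Proof.
move=> p1 n0 Bfree.
pose A := pinvmx B; pose C : R := 1 + \sum_i \sum_j `|A j i|.
have sum0 : 0 <= \sum_i \sum_j `|A j i| by apply: sumr_ge0 => i _; apply: sumr_ge0.
have C0 : 0 < C by apply: lt_le_trans ltr01 _; rewrite lerDl.
suff h : C^-1 <= lambda1 p (lattice B) by apply: lt_le_trans h; rewrite invr_gt0.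
have [ne _] := has_inf_lattice p n0 Bfree.
apply: lb_le_inf => //; move=> _ [x [[a ->] x0] <-].
have /rowP/existsNP [i hi] : ~ (a = 0).
  by move=> a0; move: x0; rewrite a0 map_mx0 mul0mx eqxx.
rewrite mxE in hi.
have aE : map_mx intr a = map_mx intr a *m B *m A :> 'rV[R]_n.
  by rewrite -mulmxA mulmxVp // mulmx1.
set y := map_mx intr a *m B in x0 aE *.
have h1 : 1 <= `|(map_mx intr a : 'rV[R]_n) 0 i|.
  by rewrite mxE -intr_norm ler1z -gtz0_ge1 normr_gt0; apply/eqP.
rewrite -[C^-1]mul1r ler_pdivrMr //; apply: le_trans h1 _.
rewrite aE mxE; apply: le_trans (ler_norm_sum _ _ _) _.
apply: (@le_trans _ _ (\sum_j lpnorm p y * `|A j i|)).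
  by apply: ler_sum => j _; rewrite normrM ler_wpM2r // lpnorm_coord.
rewrite -mulr_sumr ler_wpM2l ?lpnorm_ge0 // /C (bigD1 i) //= addrCA lerDl.
by apply: addr_ge0 => //; apply: sumr_ge0 => k _; apply: sumr_ge0.
Qed.

(** The infimum is approached up to a factor [c]; the later estimates tolerate c = 5/4. *)
Lemma near_shortest (R : realType) (p : \bar R) n m (B : 'M[R]_(n, m)) (c : R) :
  (1%:E <= p)%E -> (0 < n)%N -> row_free B -> 1 < c ->
  exists x, [/\ lattice B x, x != 0 & lpnorm p x <= c * lambda1 p (lattice B)].
Proof.
move=> p1 n0 Bfree c1.
have l0 := lambda1_gt0 p1 n0 Bfree.
have [_ [x [Lx x0] <-] lt] : exists2 y, [set lpnorm p x | x in [set x | lattice B x /\ x !=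
  0]]%classic y
    & y < c * lambda1 p (lattice B).
  by have [ne _] := has_inf_lattice p n0 Bfree; apply: inf_lt => //; rewrite ltr_pMl.
by exists x; split=> //; apply: ltW.
Qed.

(** * Sublattices given by a pivot and multipliers *)

Definition sub_mult n (Q : nat) (j : nat) (c : 'I_n -> nat) (i : 'I_n) : nat :=
  if i == j :> nat then Q.-1 else c i.

Definition sub_coef n (Q : nat) (j : nat) (c : 'I_n -> nat) : 'M[int]_n :=
  \matrix_(i, l) ((i == l)%:R + (if l == j :> nat then (sub_mult Q j c i)%:Z else 0)).

Definition sub_basis (R : realType) n m Q j c (B : 'M[R]_(n, m)) : 'M[R]_(n, m) :=
  map_mx intr (sub_coef Q j c) *m B.

Lemma sub_coefE n Q j (c : 'I_n -> nat) (z : 'rV[int]_n) l :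
  (z *m sub_coef Q j c) 0 l =
  z 0 l + (if l == j :> nat then \sum_i z 0 i * (sub_mult Q j c i)%:Z else 0).
Proof.
rewrite mxE; under eq_bigr do rewrite mxE mulrDr.
rewrite big_split /= (bigD1 l) //= eqxx mulr1 big1 ?addr0 => [|i /negbTE ->];
  last by rewrite mulr0.
by congr (_ + _); case: ifP => // _; rewrite big1 // => i _; rewrite mulr0.
Qed.

Lemma sub_coef_out n Q j (c : 'I_n -> nat) : (n <= j)%N -> sub_coef Q j c = 1%:M.
Proof.
move=> nj; apply/matrixP => i l; rewrite !mxE ltn_eqF ?addr0 //.
exact: leq_trans nj.
Qed.

Lemma sub_coef_sum n Q (j : 'I_n) (c : 'I_n -> nat) (z : 'rV[int]_n) : (0 < Q)%N ->
  (z *m sub_coef Q j c) 0 j = Q%:Z * z 0 j + \sum_(i | i != j) (c i)%:Z * z 0 i.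
Proof.
move=> Q0; rewrite sub_coefE eqxx (bigD1 j) //= addrA; congr (_ + _).
  rewrite /sub_mult eqxx -[Q in RHS]prednK // -[X in X + _]mul1r [z 0 j * _]mulrC -mulrDl.
  by rewrite -PoszD add1n.
apply: eq_bigr => i ne; rewrite /sub_mult ifN; first by rewrite mulrC.
exact: ne.
Qed.

Lemma sub_coef_other n Q (j : nat) (c : 'I_n -> nat) (z : 'rV[int]_n) (l : 'I_n) :
  l != j :> nat -> (z *m sub_coef Q j c) 0 l = z 0 l.
Proof. by move=> /negbTE ne; rewrite sub_coefE ne addr0. Qed.

Lemma sub_basis_sub (R : realType) n m Q j c (B : 'M[R]_(n, m)) x :
  lattice (sub_basis Q j c B) x -> lattice B x.
Proof.
by move=> [z ->]; exists (z *m sub_coef Q j c); rewrite map_mxM mulmxA.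
Qed.

Lemma sub_basis_free (R : realType) n m Q j c (B : 'M[R]_(n, m)) : (0 < Q)%N ->
  row_free B -> row_free (sub_basis Q j c B).
Proof.
move=> Q0 Bfree; rewrite /row_free mxrankMfree // -/(row_free _).
have [nj|jn] := leqP n j.
  by rewrite sub_coef_out // map_mx1 row_free_unit unitmx1.
apply: inj_row_free => v hv; pose j' := Ordinal jn.
have entry l : (v *m map_mx intr (sub_coef Q j c)) 0 l =
    v 0 l + (if l == j' then \sum_i v 0 i * (sub_mult Q j c i)%:R else 0).
  rewrite mxE; under eq_bigr do rewrite !mxE rmorphD /= mulrDr.
  rewrite big_split /= (bigD1 l) //= eqxx mulr1 big1 ?addr0 => [|i /negbTE ->];
    last by rewrite mulr0.
  congr (_ + _); rewrite -val_eqE /=; case: ifP => // _.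
  by rewrite big1 // => i _; rewrite mulr0.
have other l : l != j' -> v 0 l = 0.
  by move=> /negbTE ne; have := entry l; rewrite hv mxE ne addr0.
have := entry j'; rewrite hv mxE eqxx (bigD1 j') //= big1 => [|i /other ->];
  last by rewrite mul0r.
rewrite addr0 /sub_mult eqxx -{1}[v 0 j']mulr1 -mulrDr -mulrS prednK // => /esym/eqP.
rewrite mulf_eq0 pnatr_eq0 (gtn_eqF Q0) orbF => /eqP vj.
by apply/rowP => l; rewrite mxE; have [->|/other] := eqVneq l j'.
Qed.

Definition residues n (Q : nat) (a : 'rV[int]_n) (i : 'I_n) : 'Z_Q := (a 0 i)%:~R.

Lemma intr_Zmod_eq0 Q (z : int) : (1 < Q)%N -> ((z%:~R : 'Z_Q) == 0) = (Q%:Z %| z)%Z.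
Proof.
move=> Q1; have nat_case k : ((k%:R : 'Z_Q) == 0) = (Q %| k)%N.
  by rewrite -val_eqE /= val_Zp_nat.
rewrite dvdzE /=; case: z => k /=; first exact: nat_case.
by rewrite NegzE mulrNz oppr_eq0 nat_case.
Qed.

(** Coordinates other than [j] pass unchanged through the transformation. At [j] the equation a_j =
    Q z_j + sum c_i a_i can be solved for z_j exactly when the congruence modulo Q holds. *)
Lemma mem_sub_basis (R : realType) n m Q (j : 'I_n) (c : {ffun 'I_n -> 'Z_Q})
    (B : 'M[R]_(n, m)) (a : 'rV[int]_n) : (1 < Q)%N -> row_free B ->
  lattice (sub_basis Q j (fun i => c i) B) (map_mx intr a *m B) <->
  c \in hyper (residues Q a) j.
Proof.
move=> Q1 Bfree; have Q0 : (0 < Q)%N by apply: ltnW.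
have cE i : (c i : nat)%:R = c i :> 'Z_Q by apply: natr_Zp.
rewrite inE; split=> [[z]|].
  rewrite /sub_basis mulmxA -map_mxM => /(row_free_inj Bfree)/map_intr_inj aE.
  have oth i : i != j -> a 0 i = z 0 i by move=> ne; rewrite aE sub_coef_other.
  rewrite /residues aE sub_coef_sum // rmorphD rmorphM /= -[Q%:Z%:~R]/(Q%:R) pchar_Zp // mul0r
    add0r.
  rewrite rmorph_sum /=; apply/eqP; apply: eq_bigr => i ne.
  by rewrite rmorphM /= sub_coef_other // -[(Posz _)%:~R]/((c i : nat)%:R) cE.
move=> /eqP h.
have /dvdzP [y hy] : (Q%:Z %| a 0%R j - \sum_(i | i != j) (c i : nat)%:Z * a 0%R i)%Z.
  rewrite -intr_Zmod_eq0 // rmorphB /= -[(a 0 j)%:~R]/(residues Q a j) h rmorph_sum /= subr_eq0.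
  apply/eqP; apply: eq_bigr => i _; rewrite rmorphM /=.
  by rewrite -[(Posz _)%:~R]/((c i : nat)%:R) cE.
pose z := \row_i (if i == j then y else a 0 i).
exists z; rewrite /sub_basis mulmxA -map_mxM; congr (map_mx _ _ *m _).
apply/rowP => l; have [->|ne] := eqVneq l j; last first.
  by rewrite sub_coef_other // mxE (negbTE ne).
rewrite sub_coef_sum // mxE eqxx mulrC -hy.
have -> : \sum_(i | i != j) (c i : nat)%:Z * z 0 i = \sum_(i | i != j) (c i : nat)%:Z * a 0 i.
  by apply: eq_bigr => i /negbTE ne; rewrite mxE ne.
by rewrite subrK.
Qed.

Lemma odd_coordinate (R : realType) (q : \bar R) n m (B : 'M[R]_(n, m)) (a : 'rV[int]_n) :
  (1%:E <= q)%E -> let x := map_mx intr a *m B in x != 0 ->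
  lpnorm q x < 2 * lambda1 q (lattice B) -> exists i, odd `|a 0%R i|%N.
Proof.
move=> q1 x x0 hx; apply/existsP; apply: contraLR hx.
rewrite negb_exists -leNgt => /forallP even_a.
pose b := \row_(i < n) (a 0%R i %/ 2)%Z.
have aE : a = 2 *: b.
  apply/rowP => i; rewrite !mxE mulrC divzK // dvdzE /= dvdn2; exact: even_a.
pose y := map_mx intr b *m B.
have xE : x = 2 *: y.
  by rewrite /x aE /y scalemxAl; congr (_ *m _); apply/rowP => i; rewrite !mxE rmorphM.
rewrite xE lpnormZ // normr_nat ler_pM2l // lambda1_le //; first by exists b.
by apply: contraNneq x0 => y0; rewrite xE y0 scaler0.
Qed.

Lemma odd_unit_Zmod k (z : int) : (0 < k)%N -> odd `|z|%N ->
  (z%:~R : 'Z_(2 ^ k)) \is a GRing.unit.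
Proof.
move=> k0; have k1 : (1 < 2 ^ k)%N by rewrite -{1}(expn0 2) ltn_exp2l.
have nat_case l : odd l -> (l%:R : 'Z_(2 ^ k)) \is a GRing.unit.
  by move=> ol; rewrite unitZpE // coprimeXl // coprime2n.
case: z => l ol /=; first exact: nat_case.
by rewrite NegzE mulrNz unitrN; apply: nat_case.
Qed.

(** The representative closest to 0 makes K x at most Q/2 times as long as x, as
    [congruent_parallel] requires. *)
Lemma centered_lift Q (kappa : 'Z_Q) : (1 < Q)%N ->
  exists K : int, K%:~R = kappa /\ (2 * `|K| <= Q)%N.
Proof.
move=> Q1; have kQ : (kappa < Q)%N by rewrite -[X in (_ < X)%N](Zp_cast Q1) ltn_ord.
have kE : (kappa : nat)%:R = kappa := natr_Zp kappa.
have [h|h] := leqP (2 * kappa) Q; first by exists (kappa : nat)%:Z; rewrite absz_nat.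
exists ((kappa : nat)%:Z - Q%:Z); split; last by lia.
rewrite rmorphB /= -[Q%:Z%:~R]/(Q%:R) pchar_Zp // subr0; exact: kE.
Qed.

(* A vector whose multiple by N is congruent to a multiple of the short vector x
   modulo Q L is parallel to x, since Q L has no vector that short. *)
Lemma congruent_parallel (R : realType) (p q : \bar R) n m (B : 'M[R]_(n, m)) (x v : 'rV[R]_m)
    (a b : 'rV[int]_n) (g : R) (N Q : nat) (K : int) :
  (1%:E <= p)%E -> (p <= q)%E -> (0 < n <= m)%N -> row_free B ->
  x = map_mx intr a *m B -> v = map_mx intr b *m B ->
  lpnorm q x <= 5 / 4 * lambda1 q (lattice B) ->
  lpnorm p v <= g * lpnorm p x -> 0 <= g -> (0 < N)%N -> 4 * N%:R * g * m%:R <= Q%:R ->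
  (0 < Q)%N -> (2 * `|K| <= Q)%N ->
  (forall i, (Q%:Z %| N%:Z * b 0%R i - K * a 0%R i)%Z) ->
  exists t : R, v = t *: x.
Proof.
move=> p1 pq /andP [n0 nm] Bfree xE vE hx hv g0 N0 hQ Q0 hK hdvd.
have q1 : (1%:E <= q)%E by apply: le_trans pq.
have m0 : (0 < m)%N by apply: leq_trans nm.
have l0 := lambda1_gt0 q1 n0 Bfree; set l := lambda1 q _ in hx l0.
(* By divisibility [y = (N v - K x) / Q] is a lattice vector; it will be too short to be nonzero. *)
pose y := map_mx intr (\row_(i < n) ((N%:Z * b 0%R i - K * a 0%R i) %/ Q%:Z)%Z) *m B.
have yE : Q%:R *: y = N%:R *: v - K%:~R *: x.
  rewrite /y xE vE !scalemxAl -mulmxBl; congr (_ *m _); apply/rowP => i; rewrite !mxE.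
  by rewrite -[Q%:R]/(Q%:Z%:~R) -[N%:R]/(N%:Z%:~R) -!intrM -intrB mulrC divzK.
have NR : (0 : R) < N%:R by rewrite ltr0n.
have QR : (0 : R) < Q%:R by rewrite ltr0n.
have y0 : y = 0.
  apply/eqP; apply: contraT => yn0.
  have hy : l <= lpnorm q y by apply: lambda1_le => //; eexists; reflexivity.
  have h1 : Q%:R * lpnorm q y <= N%:R * lpnorm q v + `|K%:~R| * lpnorm q x.
    rewrite -[Q%:R]normr_nat -lpnormZ // yE; apply: le_trans (lpnormD _ _ q1) _.
    by rewrite lpnormN // !lpnormZ // normr_nat.
  have h2 : lpnorm q v <= g * (m%:R * lpnorm q x).
    apply: le_trans (lpnorm_le _ p1 pq) _; apply: le_trans hv _.
    by rewrite ler_wpM2l // lpnorm_crude.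
  have h3 : 2 * `|K%:~R| <= Q%:R :> R.
    by rewrite -intr_norm -abszE -[_%:~R]/(_%:R) -natrM ler_nat.
  move: h1 h2 h3 hy; set nv := lpnorm q v; set nx := lpnorm q x in hx *; set ny := lpnorm q y.
  set kk := `|_| => h1 h2 h3 hy.
  (* The two terms of [h1] are at most 1/4 and 1/2 of Q nx, and nx <= 5/4 l, so ny <= 15/16 l < l.
     This fixes the constants 4 and 5/4. *)
  have nx0 : 0 <= nx := lpnorm_ge0 _ _.
  have h4 : 4 * (N%:R * nv) <= Q%:R * nx.
    apply: (@le_trans _ _ ((4 * N%:R * g * m%:R) * nx)); last exact: ler_wpM2r.
    have -> : 4 * N%:R * g * m%:R * nx = 4 * (N%:R * (g * (m%:R * nx))) by ring.
    by rewrite ler_pM2l // ler_pM2l.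
  have h5 : 2 * (kk * nx) <= Q%:R * nx by rewrite mulrA ler_wpM2r.
  have h6 : Q%:R * l <= Q%:R * ny by rewrite ler_pM2l.
  have h7 : Q%:R * nx <= Q%:R * (5 / 4 * l) by rewrite ler_pM2l.
  have h8 : 0 < Q%:R * l by rewrite mulr_gt0.
  by exfalso; move: h7; rewrite mulrCA; lra.
exists (N%:R^-1 * K%:~R); move/eqP: yE; rewrite y0 scaler0 eq_sym subr_eq0 => /eqP h.
by rewrite -scalerA -h scalerA mulVf ?scale1r // gt_eqF.
Qed.

Definition sub_query (R : realType) n m Q (B : 'M[R]_(n, m))
    (u : bool * {ffun 'I_n -> 'Z_Q}) : 'M[R]_(n, m) :=
  sub_basis Q u.1 (fun i => u.2 i) B.

(* As x / 2 is too short to be in the lattice, x has an odd coordinate i0; the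
   coin u.1 guesses a pivot j in {0, 1} other than i0, so that x is in the
   sublattice for a fraction 1/Q of the multipliers. *)
Lemma round_success (R : realType) (p q : \bar R) n m (B : 'M[R]_(n, m)) (x : 'rV[R]_m)
    (g : R) e k (V : seq 'rV[R]_m) :
  (1%:E <= p)%E -> (p <= q)%E -> (0 < n <= m)%N -> row_free B ->
  lattice B x -> x != 0 -> lpnorm q x <= 5 / 4 * lambda1 q (lattice B) ->
  0 <= g -> 4 * (2 ^ e)%:R * g * m%:R <= (2 ^ k)%:R -> (e < k)%N ->
  (size V <= 2 ^ e)%N ->
  {in V, forall v, [/\ lattice B v, lpnorm p v <= g * lpnorm p x &
     forall t : R, v <> t *: x]} ->
  (2 * (2 ^ k) ^ n <= 4 * 2 ^ k * #|[pred u : bool * {ffun 'I_n -> 'Z_(2 ^ k)} |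
     `[< lattice (sub_query B u) x /\ forall v, v \in V -> ~ lattice (sub_query B u) v >]]|)%N.
Proof.
move=> p1 pq nm Bfree Lx x0 hx g0 hQ ek sV hV.
have q1 : (1%:E <= q)%E by apply: le_trans pq.
have n0 : (0 < n)%N by case/andP: nm.
have k0 : (0 < k)%N by apply: leq_trans ek.
set Q := (2 ^ k)%N in hQ *.
have Q1 : (1 < Q)%N by rewrite -{1}(expn0 2) ltn_exp2l.
have l0 := lambda1_gt0 q1 n0 Bfree.
case: Lx x0 hx hV => a ->; set y := _ *m B => x0 hx hV.
have [i0 odd0] : exists i, odd `|a 0%R i|%N.
  by apply: odd_coordinate q1 x0 _; apply: le_lt_trans hx _; rewrite ltr_pM2r //; lra.
set P := [pred u | _].
(* The pivot is 1 if i0 = 0 and 0 otherwise, hence never i0. *)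
pose j := (i0 == 0 :> nat); pose F c : bool * {ffun 'I_n -> 'Z_Q} := (j, c).
have Finj : injective F by move=> c c' [].
have inP c : lattice (sub_query B (F c)) y /\
    (forall v, v \in V -> ~ lattice (sub_query B (F c)) v) -> F c \in P.
  by move=> h; exact: (asboolT h).
have cardP (A : {set {ffun 'I_n -> 'Z_Q}}) : {in A, forall c, F c \in P} -> (#|A| <= #|P|)%N.
  move=> hA; rewrite -(card_imset A Finj); apply: subset_leq_card.
  by apply/fintype.subsetP => _ /imsetP [c cA ->]; apply: hA.
(* A pivot beyond the last row means rank 1. All lattice vectors are then parallel to [y], so [V] is
   empty, and the query is [B] itself: all multipliers succeed. *)
have [nj|jn] := leqP n j.
  have sub1 c : sub_query B (F c) = B.
    by rewrite /sub_query /sub_basis sub_coef_out // map_mx1 mul1mx.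
  have n1 : n = 1%N.
    by apply/eqP; rewrite eqn_leq n0 andbT; apply: leq_trans nj (leq_b1 _).
  have V0 v : v \notin V.
    apply/negP => vV; have [[b bE] _ par] := hV _ vV.
    apply: (par ((b 0 i0)%:~R / (a 0 i0)%:~R)).
    have a0 : (a 0 i0)%:~R != 0 :> R by rewrite intr_eq0; apply: contraTneq odd0 => ->.
    rewrite bE /y scalemxAl; congr (_ *m _); apply/rowP => i; rewrite !mxE.
    have small (l : 'I_n) : l = 0%N :> nat.
      by apply/eqP; rewrite -leqn0 -ltnS -[X in (_ < X)%N]n1.
    have -> : i = i0 by apply: ord_inj; rewrite !small.
    by rewrite mulrVK // unitfE.
  have hT : {in [set: {ffun 'I_n -> 'Z_Q}], forall c, F c \in P}.
    move=> c _; apply: inP; rewrite sub1; split; first by exists a.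
    by move=> v vV; have := V0 v; rewrite vV.
  have := cardP _ hT; rewrite cardsT card_ffun card_Zmod // card_ord => h.
  by apply: leq_trans (leq_mul (leqnn _) h); rewrite leq_mul2r; apply/orP; right; lia.
pose jo := Ordinal jn.
have ne : i0 != jo.
  by rewrite -val_eqE /= /j; case: (nat_of_ord i0).
have ua : residues Q a i0 \is a GRing.unit by apply: odd_unit_Zmod.
set X := hyper (residues Q a) jo.
have hX := card_hyper Q1 ne ua; rewrite -/X in hX.
have coords v : v \in V -> exists b, v = map_mx intr b *m B by case/hV.
have exb v : exists b : 'rV[int]_n, v \in V -> v = map_mx intr b *m B.
  by have [/coords [b ->]|] := boolP (v \in V); [exists b | exists 0].
have [co coE] := choice exb.
pose Y v := hyper (residues Q (co v)) jo.
have hY v : v \in V -> (2 ^ e.+1 * #|X :&: Y v| <= #|X|)%N.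
  move=> vV; have [Lv hv par] := hV _ vV.
  have [//|hall] := card_two_hypers (residues Q a) (residues Q (co v)) k0 ne ek.
  (* When 2^e kills all minors, 2^e times the residues of [co v] equals [kappa] times those of [a].
     Lifting [kappa] to an integer makes [v] parallel to [y], against [par]. *)
  exfalso; pose kappa := (2 ^ e)%:R * residues Q (co v) i0 / residues Q a i0.
  have [K [KE hK]] := centered_lift kappa Q1.
  have := @congruent_parallel _ p q n m B y v a (co v) g (2 ^ e) Q K p1 pq nm Bfree erefl
    (coE _ vV) hx hv g0.
  rewrite expn_gt0 => /(_ isT hQ (ltnW Q1) hK) [i|t]; last exact: par.
  rewrite -intr_Zmod_eq0 // rmorphB !rmorphM /= KE subr_eq0.
  rewrite -[(Posz _)%:~R]/((2 ^ e)%:R) -[(co v 0 i)%:~R]/(residues Q (co v) i).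
  rewrite -[(a 0 i)%:~R]/(residues Q a i) /kappa.
  have := hall i; rewrite mulrBr => /eqP; rewrite subr_eq0 => /eqP h.
  apply/eqP; apply: (mulrI ua); rewrite mulrCA h.
  by rewrite !mulrA; congr (_ * _); rewrite -[X in X / _]mulrA [X in X / _]mulrC mulrK.
have inU (W : seq 'rV[R]_m) v c : v \in W -> c \in X :&: Y v ->
    c \in \bigcup_(v <- W) (X :&: Y v).
  elim: W => //= v' W IH; rewrite big_cons inE [in X in _ -> _ -> X]inE =>
    /orP [/eqP <- ->|vW cv] //.
  by rewrite IH ?orbT.
pose Z := X :\: \bigcup_(v <- V) (X :&: Y v).
have hZ : {in Z, forall c, F c \in P}.
  move=> c; rewrite inE => /andP [cn cX]; apply: inP; split.
    exact: (proj2 (mem_sub_basis jo c a Q1 Bfree) cX).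
  move=> v vV Lv; move/negP: cn; apply; apply: (inU V v c) => //.
  rewrite inE cX /=; apply: (proj1 (mem_sub_basis jo c (co v) Q1 Bfree)).
  by rewrite -coE.
(* Union bound: at most 2^e vectors, each excluding at most a fraction 2^-(e+1) of [X], so at least
   half of [X] survives. *)
have hU : (2 * #|\bigcup_(v <- V) (X :&: Y v)| <= #|X|)%N.
  have hV' (W : seq 'rV[R]_m) : {subset W <= V} ->
      (2 ^ e.+1 * #|\bigcup_(v <- W) (X :&: Y v)| <= size W * #|X|)%N.
    elim: W => [|v' W IH] sub; first by rewrite big_nil cards0 muln0.
    rewrite big_cons /= mulSn; apply: (@leq_trans (2 ^ e.+1 * (#|X :&: Y v'| + #|\bigcup_(v <- W)
      (X :&: Y v)|))).
      by rewrite leq_mul2l cardsU leq_subr orbT.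
    rewrite mulnDr; apply: leq_add; first by apply/hY/sub/mem_head.
    by apply: IH => w wW; apply: sub; rewrite inE wW orbT.
  have h := leq_trans (hV' V (fun _ => id)) (leq_mul sV (leqnn #|X|)).
  by move: h; rewrite expnS [(2 * _)%N]mulnC -mulnA leq_pmul2l ?expn_gt0.
have := cardP _ hZ; rewrite cardsD => hP.
have sub : (#|X :&: \bigcup_(v <- V) (X :&: Y v)| <= #|\bigcup_(v <- V) (X :&: Y v)|)%N.
  by apply: subset_leq_card; apply: subsetIr.
have h2 : (#|X| <= 2 * #|P|)%N.
  have aux (a1 b1 c1 d1 : nat) : (a1 - b1 <= d1)%N -> (2 * c1 <= a1)%N -> (b1 <= c1)%N ->
      (a1 <= 2 * d1)%N by clear; lia.
  exact: aux hP hU sub.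
(* The loss 4 Q consists of 2 for the pivot coin, 2 for the union bound, and Q for containing
   [y]. *)
apply: (@leq_trans (2 * (Q * #|X|))); first by rewrite leq_mul2l.
by rewrite -[4%N]/(2 * 2)%N -!mulnA leq_mul2l /= mulnCA leq_mul2l h2 orbT.
Qed.
(** * Probability of success *)

(** The expectation over fair coins. The recursive form allows conditioning on the coins of one
    round ([avg_cat]); [avg_sum] returns to the count of tuples in [SVP_reduction]. *)
Fixpoint avg (R : realType) (N : nat) (F : seq bool -> R) : R :=
  if N is N'.+1 then
    (avg N' (fun w => F (false :: w)) + avg N' (fun w => F (true :: w))) / 2
  else F [::].

Lemma avg_le (R : realType) N (F G : seq bool -> R) :
  (forall w, size w = N -> F w <= G w) -> avg N F <= avg N G.
Proof.
elim: N F G => [|N IH] F G h /=; first exact: h.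
by rewrite ler_pM2r // lerD // IH // => w hw; apply: h; rewrite /= hw.
Qed.

Lemma eq_avg (R : realType) N (F G : seq bool -> R) :
  (forall w, size w = N -> F w = G w) -> avg N F = avg N G.
Proof.
by move=> h; apply/eqP; rewrite eq_le !avg_le // => w hw; rewrite h.
Qed.

Lemma avg_cat (R : realType) N N' (F : seq bool -> R) :
  avg (N + N') F = avg N (fun u => avg N' (fun w => F (u ++ w))).
Proof. by elim: N F => [|N IH] F //=; rewrite !IH. Qed.

Lemma avg_cst (R : realType) N (c : R) : avg N (fun=> c) = c.
Proof. by elim: N => //= N ->; lra. Qed.

Lemma sum_tuple_cons (R : realType) N (F : seq bool -> R) :
  \sum_(w : N.+1.-tuple bool) F w =
  \sum_(w : N.-tuple bool) F (false :: w) + \sum_(w : N.-tuple bool) F (true :: w).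
Proof.
rewrite (reindex (fun bw : bool * N.-tuple bool => [tuple of bw.1 :: bw.2])) /=; last first.
  exists (fun w => (thead w, [tuple of behead w])) => [[b w] _|w _].
    by congr (_, _); apply: val_inj.
  by apply: val_inj; case/tupleP: w => b w.
rewrite -(pair_big xpredT xpredT (fun b (w : N.-tuple bool) => F (b :: w))) /=.
by rewrite big_bool addrC.
Qed.

Lemma avg_sum (R : realType) N (F : seq bool -> R) :
  2 ^+ N * avg N F = \sum_(w : N.-tuple bool) F w.
Proof.
elim: N F => [|N IH] F /=.
  rewrite expr0 mul1r (big_pred1 [tuple]) // => w.
  by rewrite (tuple0 w) /= eqxx.
rewrite sum_tuple_cons -(IH (fun w => F (false :: w))) -(IH (fun w => F (true :: w))) exprS.
by field.
Qed.

Lemma bitval_inj k (w w' : seq bool) : bitval w k = bitval w' k ->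
  forall b, (b < k)%N -> nth false w b = nth false w' b.
Proof.
elim: k => //= k IH h b; rewrite ltnS leq_eqVlt.
have [e1 e2] : bitval w k = bitval w' k /\ nth false w k = nth false w' k.
  by move: h; case: (nth false w k); case: (nth false w' k) => /=; lia.
by move=> /orP [/eqP ->|/(IH e1)].
Qed.

Definition decode_coins (n k : nat) (w : seq bool) : bool * {ffun 'I_n -> 'Z_(2 ^ k)} :=
  (head false w, [ffun i : 'I_n => (bitval (drop (1 + i * k) w) k)%:R]).

Lemma decode_val n k w (i : 'I_n) : (0 < k)%N ->
  (decode_coins n k w).2 i = bitval (drop (1 + i * k) w) k :> nat.
Proof.
move=> k0; have k1 : (1 < 2 ^ k)%N by rewrite -{1}(expn0 2) ltn_exp2l.
by rewrite ffunE val_Zp_nat // modn_small // bitval_lt.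
Qed.

Lemma decode_eq n k (w w' : seq bool) : (0 < k)%N ->
  decode_coins n k w = decode_coins n k w' ->
  forall x, (x < round_bits n k)%N -> nth false w x = nth false w' x.
Proof.
move=> k0 h [|x]; first by rewrite !nth0 => _; case: h.
rewrite /round_bits add1n ltnS => hx.
have hi : (x %/ k < n)%N by rewrite ltn_divLR.
have := congr1 (fun u : bool * {ffun 'I_n -> 'Z_(2 ^ k)} => nat_of_ord (u.2 (Ordinal hi))) h;
  rewrite !decode_val //=.
move=> /bitval_inj /(_ (x %% k)%N); rewrite ltn_mod => /(_ k0).
by rewrite !nth_drop /= add1n addSn -divn_eq.
Qed.

Lemma eq_bitval k (w w' : seq bool) :
  (forall b, (b < k)%N -> nth false w b = nth false w' b) -> bitval w k = bitval w' k.
Proof.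
elim: k => //= k IH h; rewrite h // IH // => b hb; apply: h; exact: ltnW.
Qed.

Lemma decode_cat n k (u w : seq bool) : (round_bits n k <= size u)%N ->
  decode_coins n k (u ++ w) = decode_coins n k u.
Proof.
move=> su; congr (_, _).
  by rewrite -!nth0 nth_cat ifT // (leq_trans _ su) // /round_bits add1n.
apply/ffunP => i; rewrite !ffunE; congr _%:R; apply: eq_bitval => b hb.
rewrite !nth_drop nth_cat ifT // (leq_trans _ su) // /round_bits.
have : (i.+1 * k <= n * k)%N by rewrite leq_mul2r ltn_ord orbT.
by rewrite mulSn; lia.
Qed.

(** As the modulus is a power of 2, decoding is a bijection from coin strings to pairs of pivot and
    multipliers, so fair coins give exactly the uniform distribution. *)
Lemma avg_decode (R : realType) n k (F : bool * {ffun 'I_n -> 'Z_(2 ^ k)} -> R) : (0 < k)%N ->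
  avg (round_bits n k) (fun w => F (decode_coins n k w)) = (\sum_u F u) / (2 * (2 ^ k) ^ n)%:R.
Proof.
move=> k0; have k1 : (1 < 2 ^ k)%N by rewrite -{1}(expn0 2) ltn_exp2l.
have cE : 2 ^+ round_bits n k = (2 * (2 ^ k) ^ n)%:R :> R.
  by rewrite -natrX /round_bits expnD expn1 mulnC [(n * k)%N]mulnC expnM mulnC.
have c0 : 2 ^+ round_bits n k != 0 :> R by rewrite expf_neq0.
rewrite -cE; apply: (mulfI c0); rewrite avg_sum mulrCA mulfV // mulr1.
rewrite [RHS](reindex (fun w : (round_bits n k).-tuple bool => decode_coins n k w)) //.
apply: onW_bij; apply: inj_card_bij.
  move=> w w' /(decode_eq k0) h; apply: val_inj; apply: (@eq_from_nth _ false) => [|i].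
    by rewrite !size_tuple.
  by rewrite size_tuple => /h.
rewrite card_prod card_bool card_ffun card_Zmod // card_ord card_tuple card_bool.
by rewrite /round_bits expnD expn1 [(n * k)%N]mulnC expnM.
Qed.

(** Answers may repeat or be useless, so the distinct good vectors form a separate list [W]. *)
Definition found (T : eqType) (good par : T -> Prop) (N : nat) (V : seq T) : Prop :=
  (exists v, [/\ v \in V, good v & par v]) \/
  (exists W, [/\ uniq W, size W = N, {subset W <= V} & forall v, v \in W -> good v]).

Lemma found_sub (T : eqType) (good par : T -> Prop) N (V V' : seq T) :
  {subset V <= V'} -> found good par N V -> found good par N V'.
Proof.
move=> sub [[v [vV gv pv]]|[W [uW sW WV gW]]]; [left | right].
  by exists v; split=> //; apply: sub.
by exists W; split=> // v /WV /sub.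
Qed.

Definition draws (T : Type) n k (f : bool * {ffun 'I_n -> 'Z_(2 ^ k)} -> T) (t : nat)
    (w : seq bool) : seq T :=
  [seq f (decode_coins n k (drop (round_start n k i) w)) | i <- iota 0 t].

Lemma draws_cons (T : Type) n k (f : bool * {ffun 'I_n -> 'Z_(2 ^ k)} -> T) t u w :
  size u = round_bits n k ->
  draws f t.+1 (u ++ w) = f (decode_coins n k u) :: draws f t w.
Proof.
move=> su; rewrite /draws /= /round_start mul0n drop0 decode_cat ?su //; congr (_ :: _).
rewrite -[1%N]/(1 + 0)%N iotaDl -map_comp; apply: eq_map => i /=.
by rewrite mulSn addnC -su -drop_drop drop_size_cat.
Qed.

Lemma draws_cat (T : Type) n k (f : bool * {ffun 'I_n -> 'Z_(2 ^ k)} -> T) t u w :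
  size u = (t * round_bits n k)%N -> draws f t (u ++ w) = draws f t u.
Proof.
move=> su; apply/eq_in_map => i; rewrite mem_iota add0n /round_start => /= it.
have h : (i.+1 * round_bits n k <= size u)%N by rewrite su leq_mul2r it orbT.
rewrite drop_cat ifT; last by apply: leq_trans h; rewrite ltn_mul2r ltnSn andbT.
by rewrite decode_cat // size_drop leq_subRL; [rewrite addnC -mulSn | rewrite mulSn in h; lia].
Qed.

Lemma ler_natb (R : realType) (b c : bool) : (b -> c) -> b%:R <= c%:R :> R.
Proof. by case: b; case: c => // /(_ isT). Qed.

(* Every missing good vector costs a factor 2, and each round gains a factor
   1 - s/2 on average, where s is the probability of progress. *)
Lemma boosting (R : realType) (T : eqType) (good par : T -> Prop) n k N
    (f : bool * {ffun 'I_n -> 'Z_(2 ^ k)} -> T) (s : R) : (0 < k)%N -> 0 <= s <= 1 ->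
  (forall V : seq T, (size V < N)%N -> (forall v, v \in V -> good v /\ ~ par v) ->
    s * (2 * (2 ^ k) ^ n)%:R <=
      #|[pred u | `[< good (f u) /\ f u \notin V >]]|%:R) ->
  forall t V, uniq V -> (size V <= N)%N -> (forall v, v \in V -> good v /\ ~ par v) ->
    avg (t * round_bits n k)
      (fun w => (~~ `[< found good par N (V ++ draws f t w) >])%:R) <=
    (1 - s / 2) ^+ t * 2 ^+ (N - size V).
Proof.
move=> k0 /andP [s0 s1] hprog; have s2 : 0 <= 1 - s / 2 by lra.
elim=> [|t IH] V uV sV hV.
  rewrite mul0n /= expr0 mul1r; apply: (@le_trans _ _ 1); first by case: (~~ _).
  by apply: exprn_ege1; rewrite ler1n.
move: sV; rewrite leq_eqVlt => /orP [/eqP sV|sV].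
  rewrite (@eq_avg _ _ _ (fun=> 0)) => [|w _].
    by rewrite avg_cst mulr_ge0 // exprn_ge0.
  rewrite (_ : `[< _ >] = true) //; apply/asboolP; right.
  exists V; split=> // [v vV|v /hV [] //]; by rewrite mem_cat vV.
pose b : R := (1 - s / 2) ^+ t * 2 ^+ (N - size V).
have b0 : 0 <= b by rewrite mulr_ge0 // exprn_ge0.
pose G u : bool := `[< good (f u) /\ f u \notin V >].
rewrite mulSn avg_cat.
(* Conditioning on one round: progress adds its answer to [V] and halves the bound [b] for the other
   [t] rounds; without progress [b] itself remains valid. *)
apply: (@le_trans _ _ (avg (round_bits n k) (fun w =>
  if G (decode_coins n k w) then b / 2 else b))).
  apply: avg_le => u su; set v := f (decode_coins n k u).
  rewrite (@eq_avg _ _ _ (fun w => (~~ `[< found good par N (V ++ v :: draws f t w) >])%:R));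
    last first.
    by move=> w _; rewrite draws_cons.
  case: ifP => [/asboolP [gv nv]|_]; last first.
    apply: le_trans (IH V uV (ltnW sV) hV); apply: avg_le => w _.
    apply: ler_natb; apply: contra => /asboolP h; apply/asboolP.
    apply: found_sub h => z; rewrite !mem_cat inE => /orP [->|->] //; by rewrite !orbT.
  (* A good parallel answer already realises [found], so failure is impossible from here. *)
  have [pv|npv] := pselect (par v).
    rewrite (@eq_avg _ _ _ (fun=> 0)) => [|w _]; first by rewrite avg_cst divr_ge0.
    rewrite (_ : `[< _ >] = true) //; apply/asboolP; left; exists v; split=> //.
    by rewrite mem_cat inE eqxx orbT.
  have uV' : uniq (v :: V) by rewrite /= nv.
  have hV' z : z \in v :: V -> good z /\ ~ par z.
    by rewrite inE => /orP [/eqP ->|/hV].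
  have := IH (v :: V) uV' sV hV'; rewrite /= => h.
  have -> : b / 2 = (1 - s / 2) ^+ t * 2 ^+ (N - (size V).+1).
    by rewrite /b -(subnSK sV) exprS; field.
  apply: le_trans h; apply: avg_le => w _; apply: ler_natb.
  apply: contra => /asboolP h; apply/asboolP; apply: found_sub h => z.
  by rewrite inE !mem_cat inE => /or3P [->|->|->]; rewrite ?orbT.
rewrite (avg_decode (fun u => if G u then b / 2 else b)) //.
set c := (2 * (2 ^ k) ^ n)%:R.
have c0 : 0 < c by rewrite ltr0n !muln_gt0 !expn_gt0.
have cE : \sum_(u : bool * {ffun 'I_n -> 'Z_(2 ^ k)}) 1 = c :> R.
  have k1 : (1 < 2 ^ k)%N by rewrite -{1}(expn0 2) ltn_exp2l.
  by rewrite sumr_const card_prod card_bool card_ffun card_Zmod // card_ord.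
have -> : \sum_u (if G u then b / 2 else b) = b * c - b / 2 * #|G|%:R.
  have -> : #|G|%:R = \sum_u (G u)%:R :> R.
    by rewrite -sum1_card natr_sum big_mkcond; apply: eq_bigr => u _;
      rewrite (_ : (u \in G) = G u) //; case: (G u).
  rewrite -cE !mulr_sumr -sumrB; apply: eq_bigr => u _.
  by case: (G u) => /=; field.
rewrite ler_pdivrMr //.
have hG : s * c <= #|G|%:R by apply: hprog.
have : b / 2 * (s * c) <= b / 2 * #|G|%:R by rewrite ler_wpM2l // divr_ge0.
rewrite exprS; rewrite -/b; have -> : (1 - s / 2) * (1 - s / 2) ^+ t * 2 ^+ (N - size V) = (1 - s
  / 2) * b.
  by rewrite mulrA.
by nra.
Qed.

(** * Memory contents as matrices and keys as norms *)

Lemma nth_allpairs_mul (S T A : Type) (f : S -> T -> A) (a0 : A) (s0 : S) (t0 : T)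
    (s : seq S) (t : seq T) i j : (i < size s)%N -> (j < size t)%N ->
  nth a0 [seq f x y | x <- s, y <- t] (i * size t + j) = f (nth s0 s i) (nth t0 t j).
Proof.
elim: s i => //= x s IH [|i] hi hj; rewrite nth_cat size_map.
  by rewrite mul0n add0n hj (nth_map t0).
by rewrite mulSn -addnA ltnNge leq_addr /= addKn IH.
Qed.

Lemma query_mxE (R : realType) n m k (B : 'M[R]_(n, m)) (w : seq bool) : (0 < k)%N ->
  query_mx n m (2 ^ k) k (nth 0 [seq B i j | i <- enum 'I_n, j <- enum 'I_m]) w =
  sub_query B (decode_coins n k w).
Proof.
move=> k0; set mem := nth 0 _.
have memE (i : 'I_n) (j : 'I_m) : mem (i * m + j)%N = B i j.
  have := @nth_allpairs_mul _ _ _ (fun i j => B i j) 0 i j (enum 'I_n) (enum 'I_m) i j.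
  by rewrite !size_enum_ord !ltn_ord !nth_ord_enum => h; exact: h.
apply/matrixP => i l; rewrite !mxE memE.
under eq_bigr do rewrite !mxE rmorphD /= mulrDl.
rewrite big_split /= (bigD1 i) //= eqxx mul1r big1 ?addr0 => [|i' ne]; last first.
  by rewrite eq_sym (negbTE ne) mul0r.
congr (_ + _).
have multE : row_mult (2 ^ k) k w i =
    sub_mult (2 ^ k) (decode_coins n k w).1 (fun i => (decode_coins n k w).2 i) i.
  by rewrite /row_mult /sub_mult /= -decode_val.
(* If the pivot row is missing, the program reads past the end of the basis, where [nth] returns the
   default 0, and [sub_coef] has no pivot column. *)
set j := head false w; have [nj|jn] := leqP n j.
  rewrite big1 => [|i' _]; last by rewrite ltn_eqF ?mul0r // (leq_trans (ltn_ord i')).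
  rewrite [mem _]nth_default ?mulr0 // size_allpairs !size_enum_ord.
  by apply: leq_trans (leq_addr _ _); rewrite leq_mul2r nj orbT.
rewrite (bigD1 (Ordinal jn)) //= eqxx big1 ?addr0 => [|i' ne]; last first.
  by rewrite ifN ?mul0r.
by rewrite (memE (Ordinal jn)) multE.
Qed.

Lemma key_upto_finite (R : realType) (s : R) (d : nat -> R) k : 0 < s ->
  key_upto s^-1 d k = \sum_(j < k) `|d j| `^ s.
Proof.
move=> s0; elim: k => [|k IH] /=; first by rewrite big_ord0.
rewrite big_ord_recr /= /key_step -IH leNgt invr_gt0 s0 /=.
have [->|dn0] := eqVneq (d k) 0.
  by rewrite mulr0 lexx normr0 powR0 ?gt_eqF // addr0.
have d0 : 0 < `|d k| by rewrite normr_gt0.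
have -> : d k * d k = `|d k| * `|d k| by rewrite -normrM ger0_norm // -expr2 sqr_ge0.
rewrite leNgt mulr_gt0 //=; congr (_ + _); rewrite lnM // /powR gt_eqF //.
by congr expR; field; rewrite gt_eqF.
Qed.

Lemma key_upto_max (R : realType) (d : nat -> R) k :
  exists M, [/\ key_upto 0 d k = M ^+ 2, 0 <= M,
    forall j, (j < k)%N -> `|d j| <= M &
    forall b, 0 <= b -> (forall j, (j < k)%N -> `|d j| <= b) -> M <= b].
Proof.
elim: k => [|k [M [hM M0 le lub]]] /=; first by exists 0; rewrite expr0n.
have sq : d k * d k = `|d k| ^+ 2 by rewrite real_normK ?num_real // expr2.
rewrite /key_step lexx hM sq ler_pXn2r ?nnegrE //.
case: (leP M `|d k|) => hle.
  exists `|d k|; split=> // [j|b b0 hb]; last exact: hb.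
  by rewrite ltnS leq_eqVlt => /orP [/eqP ->|/le h] //; apply: le_trans hle.
exists M; split=> // [j|b b0 hb].
  by rewrite ltnS leq_eqVlt => /orP [/eqP ->|/le] //; apply: ltW.
by apply: lub => // j hj; apply: hb; apply: ltnW.
Qed.

Lemma key_lpnorm (R : realType) (q : \bar R) m (x : 'rV[R]_m) (d : nat -> R) :
  (1%:E <= q)%E -> (forall j : 'I_m, d j = x 0 j) ->
  key_upto (inv_exponent q) d m =
    lpnorm q x `^ (if q is s%:E then s else 2).
Proof.
case: q => [s| |] // q1 dE.
  rewrite lee_fin in q1; have s0 : 0 < s by apply: lt_le_trans q1.
  rewrite powR_lpnorm // /= key_upto_finite //; apply: eq_bigr => j _; by rewrite dE.
have [M [-> M0 le lub]] := key_upto_max d m.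
rewrite powR_mulrn ?lpnorm_ge0 //; congr (_ ^+ 2); apply/eqP; rewrite eq_le; apply/andP; split.
  apply: lub => [|j hj]; first exact: lpnorm_ge0.
  by rewrite (dE (Ordinal hj)); apply: lpnorm_coord.
apply: bigmax_le => // j _; rewrite -dE; exact: le.
Qed.

(** The key is a fixed positive power of the norm, so the program compares norms without extracting
    a root. *)
Lemma key_upto_lpnorm (R : realType) (q : \bar R) m (x y : 'rV[R]_m) (d d' : nat -> R) :
  (1%:E <= q)%E -> (forall j : 'I_m, d j = x 0 j) -> (forall j : 'I_m, d' j = y 0 j) ->
  (0 < key_upto (inv_exponent q) d m) = (0 < lpnorm q x) /\
  (key_upto (inv_exponent q) d m <= key_upto (inv_exponent q) d' m) =
      (lpnorm q x <= lpnorm q y).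
Proof.
move=> q1 dE dE'; rewrite (key_lpnorm q1 dE) (key_lpnorm q1 dE').
set r := match q with s%:E => _ | _ => _ end.
have r0 : 0 < r.
  by rewrite /r; case: q q1 {dE dE' r} => [s| |] //; rewrite lee_fin; apply: lt_le_trans.
split; last by rewrite powR_leP ?lpnorm_ge0.
by rewrite !lt0r powR_eq0 (gt_eqF r0) andbT powR_ge0 lpnorm_ge0.
Qed.

(** * Constants, and the shortness of the winning pair *)

Lemma expR_half_le2 (R : realType) : expR (1 / 2) <= 2 :> R.
Proof.
have h : 1 / 2 <= expR (- (1 / 2)) :> R by have := expR_ge1Dx (- (1 / 2) : R); lra.
rewrite expRN in h; have e0 := expR_gt0 (1 / 2 : R).
by move: h; rewrite -[X in _ <= X]mul1r ler_pdivlMr //; lra.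
Qed.

Lemma expR1_le4 (R : realType) : expR 1 <= 4 :> R.
Proof.
have -> : 1 = 1 / 2 + 1 / 2 :> R by field.
rewrite expRD; have := expR_half_le2 R; have := expR_gt0 (1 / 2 : R).
by nra.
Qed.

(** Converts the natural exponentials of the size estimates into the powers of 2 of the time
    bound. *)
Lemma powR2_ge (R : realType) (y : R) : 0 <= y -> expR (y / 2) <= 2 `^ y.
Proof.
move=> y0; rewrite /powR pnatr_eq0 /= ler_expR ler_wpM2l //.
have := ler_ln (expR_gt0 (1 / 2 : R)) (ltr0n R 2); rewrite expRK expR_half_le2.
by rewrite div1r => ->.
Qed.

(** [ln 100 <= ln (1 / e)] lets [class_count] bound - ln (e / 100) by 2 ln (1 / e). *)
Lemma ln_inv_ge (R : realType) (e : R) : 0 < e < 1 / 100 ->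
  1 <= ln (1 / e) /\ ln 100 <= ln (1 / e).
Proof.
move=> /andP [e0 e1]; have i0 : 0 < 1 / e by rewrite divr_gt0.
have h : 100 <= 1 / e by rewrite ler_pdivlMr //; lra.
split; last by rewrite ler_ln ?posrE.
rewrite -[X in X <= _](expRK (1 : R)) ler_ln ?posrE ?expR_gt0 //.
by apply: le_trans h; have := expR1_le4 R; lra.
Qed.

(* The number of classes in close_pair for t = e / 100 and
   delta = e / (20 ln (1 / e)). *)
Lemma class_count (R : realType) (e : R) m : 0 < e < 1 / 100 ->
  ((1 + e / 100) / (1 - e / 100)) ^+ m / (e / 100) `^ (e / (20 * ln (1 / e)) * m%:R)
    <= expR (e * m%:R / 8).
Proof.
move=> he; have [L1 L100] := ln_inv_ge he; have /andP [e0 e1] := he.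
set L := ln (1 / e) in L1 L100 *; have L0 : 0 < L by lra.
set t := e / 100; have t0 : 0 < t by rewrite divr_gt0.
have t1 : t <= 1 / 10000 by rewrite /t; lra.
(* The quotient is 1 + 2 t / (1 - t); as t = e / 100 is at most 1/10000, 21/1000 leaves room above
   2/100. *)
have h1 : (1 + t) / (1 - t) <= expR (e * (21 / 1000)).
  apply: (@le_trans _ _ (expR (2 * t / (1 - t)))).
    apply: le_trans (expR_ge1Dx _); rewrite le_eqVlt; apply/orP; left; apply/eqP.
    by field; lra.
  rewrite ler_expR ler_pdivrMr; last by lra.
  by rewrite /t in t1 *; nra.
have h2 : ((1 + t) / (1 - t)) ^+ m <= expR (e * (21 / 1000) * m%:R).
  have q0 : 0 <= (1 + t) / (1 - t) by apply: divr_ge0; lra.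
  by rewrite [_ * m%:R]mulrC expRM_natl; apply: lerXn2r; rewrite ?nnegrE ?expR_ge0.
have lnt : ln t = - L - ln 100.
  by rewrite /t /L lnM ?posrE ?invr_gt0 // lnV ?posrE // div1r lnV ?posrE // opprK.
(* - ln t = L + ln 100 <= 2 L, and the exponent e / (20 L) turns 2 L into e / 10. The total 21/1000
   + 1/10 stays below 1/8. *)
have h3 : (t `^ (e / (20 * L) * m%:R))^-1 <= expR (e / 10 * m%:R).
  rewrite /powR gt_eqF //= -expRN ler_expR lnt.
  have c0 : 0 <= e / (20 * L) * m%:R by apply: mulr_ge0 => //; apply: divr_ge0; lra.
  apply: (@le_trans _ _ (e / (20 * L) * m%:R * (L + L))).
    by rewrite -mulrN ler_wpM2l //; lra.
  by rewrite le_eqVlt; apply/orP; left; apply/eqP; field; rewrite gt_eqF.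
apply: (@le_trans _ _ (expR (e * (21 / 1000) * m%:R) * expR (e / 10 * m%:R))).
  apply: ler_pM => //; last by rewrite invr_ge0 powR_ge0.
  by apply: exprn_ge0; apply: divr_ge0; lra.
rewrite -expRD ler_expR; have m0 : 0 <= m%:R :> R by [].
have : 0 <= e * m%:R by rewrite mulr_ge0 // ltW.
by lra.
Qed.

Definition approx_factor (R : realType) (p : \bar R) (e g : R) : R :=
  100 * ln (1 / e) `^ inv_exponent p * g / e `^ inv_exponent p.

Lemma inv_exponent_ge0 (R : realType) (p : \bar R) : (1%:E <= p)%E -> 0 <= inv_exponent p.
Proof.
case: p => [r| |] //=; rewrite lee_fin => r1.
by rewrite invr_ge0; apply: le_trans r1.
Qed.

Lemma approx_factor_ge (R : realType) (p : \bar R) (e g : R) :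
  (1%:E <= p)%E -> 0 < e < 1 / 100 -> 0 <= g -> 100 * g <= approx_factor p e g.
Proof.
move=> p1 he g0; have [L1 _] := ln_inv_ge he; have /andP [e0 e1] := he.
have i0 := inv_exponent_ge0 p1.
have h1 : 1 <= ln (1 / e) `^ inv_exponent p.
  by rewrite -[X in X <= _](powRr0 (ln (1 / e))); apply: ler_powR.
have h2 : e `^ inv_exponent p <= 1.
  rewrite -[X in _ <= X](powRr0 e); apply: ger_powR => //.
  by rewrite e0; lra.
have ep0 : 0 < e `^ inv_exponent p by apply: powR_gt0.
rewrite /approx_factor ler_pdivlMr //.
set a := ln _ `^ _ in h1 *; set b := e `^ _ in h2 ep0 *.
apply: (@le_trans _ _ (100 * g)); first by rewrite ler_piMr // mulr_ge0.
by rewrite mulrAC ler_peMr // mulr_ge0.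
Qed.

Definition good_vec (R : realType) (p : \bar R) n m (B : 'M[R]_(n,
  m)) (g : R) (x v : 'rV[R]_m) : Prop :=
  [/\ lattice B v, v != 0 & lpnorm p v <= g * lpnorm p x].

Definition parallel (R : realType) m (x v : 'rV[R]_m) : Prop := exists t : R, v = t *: x.

(** Passing between the l_p and l_q norms of [x] costs m^c with c = 1/p - 1/q, and the truncation
    scale of [close_pair] gains back the same power of m; hence the factor is free of m. *)
Lemma winner (R : realType) (p q : \bar R) n m (B : 'M[R]_(n, m)) (x : 'rV[R]_m) (g e : R) a V :
  (1%:E <= p)%E -> (p <= q)%E -> (0 < n <= m)%N -> row_free B -> x != 0 ->
  lpnorm q x <= 5 / 4 * lambda1 q (lattice B) -> 1 <= g -> 0 < e < 1 / 100 ->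
  expR (e * m%:R / 8) <= (2 ^ a)%:R ->
  found (good_vec p B g x) (parallel x) (2 ^ a) V ->
  exists v w, [/\ v \in 0 :: V, w \in 0 :: V, v != w &
    lpnorm q (v - w) <= approx_factor p e g * lambda1 q (lattice B)].
Proof.
move=> p1 pq /andP [n0 nm] Bfree x0 hx g1 he ha.
have q1 : (1%:E <= q)%E by apply: le_trans pq.
have m0 : (0 < m)%N by apply: leq_trans nm.
have g0 : 0 <= g by apply: le_trans g1.
have l0 := lambda1_gt0 q1 n0 Bfree; set l := lambda1 q _ in hx l0 *.
have single v : v \in V -> v != 0 -> lpnorm q v <= g * lpnorm q x ->
    exists v w, [/\ v \in 0 :: V, w \in 0 :: V, v != w &
      lpnorm q (v - w) <= approx_factor p e g * l].
  move=> vV v0 hv; exists v, 0; rewrite !inE eqxx vV orbT subr0; split=> //.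
  apply: le_trans hv _; apply: (@le_trans _ _ (100 * g * l)).
    apply: (@le_trans _ _ (g * (5 / 4 * l))); first by rewrite ler_wpM2l.
    have : 0 <= g * l by rewrite mulr_ge0 // ltW.
    by rewrite -mulrA; lra.
  by rewrite ler_pM2r // approx_factor_ge.
case=> [[v [vV [Lv v0 hv] [t tE]]]|[W [uW sW WV gW]]].
  (* v = t x scales all norms alike, so the l_p bound says |t| <= g and gives the l_q bound. *)
  apply: (single v) => //; rewrite tE lpnormZ // ler_wpM2r ?lpnorm_ge0 //.
  move: hv; rewrite tE lpnormZ // ler_pM2r // lpnorm_gt0 //.
(* p = oo forces q = oo, and then any single good vector is short enough. *)
case: p p1 pq gW single => [r| |] // p1 pq gW single; last first.
  have qy : q = +oo%E by apply/eqP; rewrite -leye_eq.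
  have : (0 < size W)%N by rewrite sW expn_gt0.
  case: W uW sW WV gW => // v W uW sW WV gW _.
  have [Lv v0 hv] := gW v (mem_head _ _).
  by apply: (single v) => //; [exact/WV/mem_head | rewrite qy].
have := p1; rewrite lee_fin => r1; have r0 : 0 < r by apply: lt_le_trans r1.
have /andP [e0 e1] := he; have [L1 _] := ln_inv_ge he.
set L := ln (1 / e) in L1; have L0 : 0 < L by lra.
have P0 : 0 < lpnorm r%:E x by rewrite lpnorm_gt0.
pose A := g * lpnorm r%:E x; have A0 : 0 < A by rewrite mulr_gt0 // (lt_le_trans ltr01).
pose d := e / (20 * L); have d0 : 0 < d by rewrite divr_gt0 // mulr_gt0.
have d1 : d <= 1 by rewrite /d ler_pdivrMr ?mulr_gt0 //; lra.
have t01 : 0 < e / 100 < 1 by apply/andP; split; lra.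
(* Adding 0 gives 2^a + 1 vectors, which makes the pigeonhole inequality strict. *)
have uW0 : uniq (0 :: W).
  by rewrite /= uW andbT; apply/negP => /gW []; rewrite eqxx.
have hW0 : {in 0 :: W, forall v, lpnorm r%:E v <= A}.
  move=> v; rewrite inE => /orP [/eqP ->|/gW [] //]; by rewrite lpnorm0 // ltW.
have hcard : ((1 + e / 100) / (1 - e / 100)) ^+ m / (e / 100) `^ (d * m%:R) < (size (0 :: W))%:R.
  apply: le_lt_trans (class_count m he) _; apply: le_lt_trans ha _.
  by rewrite /= sW ltr_nat.
have [v [w [vW wW ne hvw]]] := close_pair r1 pq m0 A0 d0 t01 uW0 hW0 hcard.
have sub0 z : z \in 0 :: W -> z \in 0 :: V.
  by rewrite !inE => /orP [->|/WV ->]; rewrite ?orbT.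
exists v, w; split=> //; try exact: sub0.
apply: le_trans hvw _.
have mR : 0 < m%:R :> R by rewrite ltr0n.
set c := r^-1 - inv_exponent q.
have hP : lpnorm r%:E x <= m%:R `^ c * lpnorm q x by apply: lpnorm_holder.
have -> : (d * m%:R) `^ (- c) = d `^ (- c) * (m%:R `^ c)^-1.
  by rewrite powRM ?(ltW d0) // [m%:R `^ (- c)]powRN.
have dc : d `^ (- c) <= d `^ (- r^-1).
  apply: ger_powR; first by rewrite d0.
  by rewrite lerN2 /c gerBl inv_exponent_ge0.
have mc0 : 0 < m%:R `^ c by apply: powR_gt0.
(* 4 from [close_pair] times 5/4 from the choice of [x] gives 5, and [d] contributes 20^(1/r) <= 20:
   together the constant 100. *)
apply: (@le_trans _ _ (5 * g * d `^ (- r^-1) * l)).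
  apply: (@le_trans _ _ (4 * (g * lpnorm q x) * d `^ (- r^-1))).
    apply: (@le_trans _ _ (4 * (g * (m%:R `^ c * lpnorm q x)) * (d `^ (- r^-1) * (m%:R `^
      c)^-1))).
      apply: ler_pM.
      - by rewrite mulr_ge0 // ltW.
      - by rewrite mulr_ge0 ?powR_ge0 // invr_ge0 ltW.
      - by rewrite ler_pM2l // ler_wpM2l.
      - by rewrite ler_wpM2r // invr_ge0 ltW.
    by rewrite le_eqVlt; apply/orP; left; apply/eqP; field; rewrite gt_eqF.
  have -> : 5 * g * d `^ (- r^-1) * l = 4 * (g * (5 / 4 * l)) * d `^ (- r^-1) by field.
  by rewrite ler_wpM2r ?powR_ge0 // ler_pM2l // ler_wpM2l.
rewrite ler_pM2r // /approx_factor -/L /=.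
have -> : d `^ (- r^-1) = 20 `^ r^-1 * (L `^ r^-1 / e `^ r^-1).
  rewrite powRN /d (powRM _ (ltW e0)) ?invr_ge0 ?mulr_ge0 ?(ltW L0) //.
  rewrite powRV ?mulr_ge0 ?(ltW L0) // (powRM _ _ (ltW L0)) //.
  field; rewrite !gt_eqF ?powR_gt0 //.
have h20 : 20 `^ r^-1 <= 20 :> R.
  by rewrite -[X in _ <= X]powRr1 // ler_powR ?invf_le1 //; lra.
have q0 : 0 <= L `^ r^-1 / e `^ r^-1 by rewrite divr_ge0 ?powR_ge0.
apply: (@le_trans _ _ (5 * g * (20 * (L `^ r^-1 / e `^ r^-1)))).
  by rewrite ler_wpM2l ?mulr_ge0 // ler_wpM2r.
rewrite le_eqVlt; apply/orP; left; apply/eqP; field.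
by rewrite gt_eqF ?powR_gt0.
Qed.

(** * Size and running time estimates *)

Lemma first_pow_le (R : realType) (X : R) a : 1 <= X -> first_pow X a -> (2 ^ a)%:R <= 2 * X.
Proof.
move=> X1 h; case: a h => [|a] h; first by rewrite expn0; lra.
have := h a (leqnSn a); rewrite ltn_eqF // => /negbT; rewrite -ltNge => lt.
by rewrite expnS natrM ler_pM2l // ltW.
Qed.

Lemma natmul_half_pow (R : realType) m : m%:R * 2^-1 ^+ m <= 1 :> R.
Proof.
rewrite exprVn ler_pdivrMr ?exprn_gt0 // mul1r -natrX ler_nat.
by apply: ltnW; apply: ltn_expl.
Qed.

Lemma eps_exponent (R : realType) (e e' : R) m : `|e' - e| <= 2^-1 ^+ m ->
  e * m%:R / 8 <= e' * m%:R / 8 + 1 <= e * m%:R / 8 + 2.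
Proof.
rewrite ler_norml => /andP [h1 h2]; have h := natmul_half_pow R m.
have m0 : 0 <= m%:R :> R by [].
have h3 : m%:R * (- 2^-1 ^+ m) <= m%:R * (e' - e) by rewrite ler_wpM2l.
have h4 : m%:R * (e' - e) <= m%:R * 2^-1 ^+ m by rewrite ler_wpM2l.
rewrite mulrN in h3; rewrite mulrBr in h3 h4.
by apply/andP; split; rewrite [e' * _]mulrC [e * _]mulrC; lra.
Qed.

Lemma bitlen_le k e : (k <= 2 ^ e)%N -> (bitlen k <= e.+1)%N.
Proof.
move=> h; rewrite ltnS; apply: leq_trans (leq_trunc_log 2 h) _.
by rewrite trunc_expnK.
Qed.

Lemma value_bound_le m a kk : (0 < m)%N ->
  (value_bound m (rounds_number (2 ^ kk) (2 ^ a)) <= 2 ^ (11 + kk + a + 2 * m))%N.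
Proof.
move=> m0; have a0 : (0 < 2 ^ a)%N by rewrite expn_gt0.
have k0 : (0 < 2 ^ kk)%N by rewrite expn_gt0.
have hT : ((rounds_number (2 ^ kk) (2 ^ a)).+2 <= 2 ^ 5 * (2 ^ kk * 2 ^ a))%N.
  by rewrite /rounds_number -[(2 ^ 5)%N]/32%N; nia.
have mm : (m <= 2 ^ m)%N by apply/ltnW/ltn_expl.
have -> : (11 + kk + a + 2 * m = 6 + 5 + kk + a + m + m)%N by lia.
rewrite !expnD /value_bound; apply: leq_mul => //; apply: leq_mul => //.
apply: (@leq_trans (2 ^ 6 * (2 ^ 5 * (2 ^ kk * 2 ^ a)))); last by rewrite !mulnA.
by apply: leq_mul.
Qed.

(** Rounding up to powers of 2 costs a factor 2, and exp(2) accounts for the imprecision of [e'].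
    The logarithm [kk] of the modulus is bounded only linearly in g m, which the fourth power of g
    can afford. *)
Lemma ln_cost_bounds (R : realType) (e e' g : R) m a kk : (0 < m)%N -> 1 <= g -> 0 < e < 1 / 100
  ->
  `|e' - e| <= 2^-1 ^+ m ->
  first_pow (expR (e' * m%:R / 8 + 1)) a ->
  first_pow (4 * (2 ^ a)%:R * g * m%:R) kk ->
  let E := expR (e * m%:R / 8) in
  [/\ (2 ^ a)%:R <= 2 ^+ 5 * E, (2 ^ kk)%:R <= 2 ^+ 8 * (E * g * m%:R), (a <= m + 5)%N &
     (kk%:R <= 12 * (g * m%:R))].
Proof.
move=> m0 g1 he he' ha hk E; have /andP [e0 e1] := he.
have m1 : 1 <= m%:R :> R by rewrite ler1n.
have E1 : 1 <= E.
  by rewrite -expR0 ler_expR; apply: mulr_ge0 => //; apply: mulr_ge0 => //; apply: ltW.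
have /andP [l1 l2] := eps_exponent he'.
have X1 : 1 <= expR (e' * m%:R / 8 + 1).
  by apply: le_trans E1 _; rewrite ler_expR.
have ba : (2 ^ a)%:R <= 2 ^+ 5 * E.
  apply: le_trans (first_pow_le X1 ha) _.
  apply: (@le_trans _ _ (2 * (E * expR 2))).
    by rewrite ler_pM2l // -expRD ler_expR.
  have -> : 2 = 1 + 1 :> R by ring.
  rewrite expRD; have := expR1_le4 R; have := expR_gt0 (1 : R); set y := expR 1 => y0 y4.
  have : y * y <= 16 by nra.
  by move: E1; nra.
have gm1 : 1 <= g * m%:R by rewrite mulr_ege1.
have a1 : 1 <= (2 ^ a)%:R :> R by rewrite ler1n expn_gt0.
have Y1 : 1 <= 4 * (2 ^ a)%:R * g * m%:R by rewrite -mulrA; nra.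
have bk : (2 ^ kk)%:R <= 2 ^+ 8 * (E * g * m%:R).
  apply: le_trans (first_pow_le Y1 hk) _.
  have -> : 2 * (4 * (2 ^ a)%:R * g * m%:R) = 8 * (g * m%:R) * (2 ^ a)%:R by ring.
  have -> : 2 ^+ 8 * (E * g * m%:R) = 8 * (g * m%:R) * (2 ^+ 5 * E) by ring.
  by rewrite ler_wpM2l // mulr_ge0 //; lra.
have E2m : E <= (2 ^ m)%:R.
  apply: (@le_trans _ _ (expR (m%:R * (1 / 2)))).
    rewrite ler_expR; have : e * m%:R <= 1 * m%:R by rewrite ler_wpM2r //; lra.
    lra.
  by rewrite expRM_natl natrX lerXn2r ?nnegrE ?expR_ge0 // expR_half_le2.
split=> //.
  rewrite -(@leq_exp2l 2) // -(ler_nat R) addnC expnD natrM (natrX _ 2 5).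
  by apply: le_trans ba _; rewrite ler_wpM2l.
(* A power of 2 above [g] whose exponent is at most g + 1. *)
pose G := (Num.truncn g).+1; have gG : g <= (2 ^ G)%:R.
  apply: (@le_trans _ _ G%:R); first by apply/ltW/truncnS_gt.
  by rewrite ler_nat; apply/ltnW/ltn_expl.
have hk' : (kk <= 8 + m + G + m)%N.
  rewrite -(@leq_exp2l 2) // -(ler_nat R) [X in _ <= X]natrX.
  rewrite (exprD _ (8 + m + G)) (exprD _ (8 + m)) (exprD _ 8).
  rewrite natrX in gG; rewrite natrX in E2m.
  have m2 : m%:R <= 2 ^+ m :> R by rewrite -natrX ler_nat; apply/ltnW/ltn_expl.
  have h3 : E * (g * m%:R) <= 2 ^+ m * (2 ^+ G * 2 ^+ m).
    apply: ler_pM; [by lra | by lra | exact: E2m | ].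
    by apply: ler_pM; [lra | by [] | exact: gG | exact: m2].
  have h4 := ler_wpM2l (exprn_ge0 8 (ler0n R 2)) h3.
  apply: le_trans bk _; move: h4; move: (2 ^+ 8) (2 ^+ m) (2 ^+ G) => c1 c2 c3 h4.
  apply: le_trans (le_trans _ h4) _; by rewrite !mulrA.
have Gg : G%:R <= g + 1.
  have /andP [h _] := truncn_itv (le_trans ler01 g1).
  by rewrite /G -natr1 lerD2r.
have : kk%:R <= (8 + m + G + m)%:R :> R by rewrite ler_nat.
rewrite !natrD => h.
have g2 : g <= g * m%:R by rewrite ler_peMr //; lra.
have mg : m%:R <= g * m%:R by rewrite ler_peMl.
by lra.
Qed.

(** T is O(E^2 g m), so T^2 gives E^4 g^2 m^2; [m + a + kk + 6] and the step cost add a factor g m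
    each, and one more m makes m^5. Here E^4 = exp(e m / 2), and 59 = 7 + 18 + 18 + 5 + 11. *)
Lemma main_cost_le (R : realType) (e e' g : R) m a kk : (0 < m)%N -> 1 <= g -> 0 < e < 1 / 100 ->
  `|e' - e| <= 2^-1 ^+ m ->
  first_pow (expR (e' * m%:R / 8 + 1)) a ->
  first_pow (4 * (2 ^ a)%:R * g * m%:R) kk ->
  (main_cost m a kk)%:R <= g ^+ 4 * 2 `^ (e * m%:R) * (2 ^+ 59 * m%:R ^+ 5).
Proof.
move=> m0 g1 he he' ha hk; have /andP [e0 e1] := he.
have [ba bk ha' hk'] := ln_cost_bounds m0 g1 he he' ha hk.
set E := expR (e * m%:R / 8) in ba bk.
have m1 : 1 <= m%:R :> R by rewrite ler1n.
have E1 : 1 <= E.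
  by rewrite -expR0 ler_expR; apply: mulr_ge0 => //; apply: mulr_ge0 => //; apply: ltW.
have gm1 : 1 <= g * m%:R by rewrite mulr_ege1.
have E4 : E ^+ 4 <= 2 `^ (e * m%:R).
  have em0 : 0 <= e * m%:R by apply: mulr_ge0 => //; apply: ltW.
  apply: le_trans (powR2_ge em0); rewrite -expRM_natl ler_expR; lra.
set T := rounds_number (2 ^ kk) (2 ^ a).
have bT : T.+2%:R <= 2 ^+ 18 * (E ^+ 2 * (g * m%:R)) :> R.
  have -> : T.+2%:R = 8 * (2 ^ kk)%:R * ((2 ^ a)%:R + 2) + 2 :> R.
    by rewrite -addn2 natrD /T /rounds_number !natrM natrD.
  set x := (2 ^ kk)%:R in bk *; set y := (2 ^ a)%:R in ba *; set z := g * m%:R in gm1 *.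
  have x0 : 0 <= x by [].
  have bk' : x <= 256 * (E * z) by have -> : 256 * (E * z) = 2 ^+ 8 * (E * g * m%:R) by rewrite
    /z; ring.
  have ba' : y + 2 <= 34 * E by lra.
  have y2 : 0 <= y + 2 by rewrite addr_ge0 // /y.
  have h : x * (y + 2) <= 256 * (E * z) * (34 * E) by apply: ler_pM.
  have h2 : 1 <= E * E * z by rewrite mulr_ege1 // mulr_ege1.
  have -> : 2 ^+ 18 * (E ^+ 2 * z) = 1024 * (256 * (E * E * z)).
    by have -> : 18%N = (10 + 8)%N by []; rewrite exprD; ring.
  have h3 : 256 * (E * z) * (34 * E) = 256 * (34 * (E * E * z)) by ring.
  by rewrite -mulrA; lra.
have bz : (m + a + kk + 6)%:R <= 2 ^+ 5 * (g * m%:R) :> R.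
  have : (m + a + kk + 6)%:R <= (m + (m + 5) + kk + 6)%:R :> R.
    by rewrite ler_nat; clear -ha'; lia.
  rewrite !natrD => h; have mg : m%:R <= g * m%:R by rewrite ler_peMl.
  apply: le_trans h _; have -> : 2 ^+ 5 = 32 :> R by ring.
  by lra.
have bs : (step_cost (value_bound m T))%:R <= 2 ^+ 11 * (g * m%:R) :> R.
  have h := bitlen_le (value_bound_le a kk m0); rewrite -/T in h.
  have h' : (bitlen (value_bound m T))%:R <= 32 * (g * m%:R) :> R.
    apply: (@le_trans _ _ (11 + kk + (m + 5) + 2 * m).+1%:R).
      by rewrite ler_nat; apply: leq_trans h _; clear -ha'; lia.
    have -> : (11 + kk + (m + 5) + 2 * m).+1%:R = 17 + kk%:R + 3 * m%:R :> R by ring.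
    have mg : m%:R <= g * m%:R by rewrite ler_peMl.
    lra.
  rewrite /step_cost natrM; have -> : 2 ^+ 11 = 2048 :> R by ring.
  lra.
rewrite /main_cost -/T 5!natrM.
set x := T.+2%:R in bT *; set y := (m + a + kk + 6)%:R in bz *; set z := (step_cost _)%:R in bs *.
have x0 : 0 <= x by []. have y0 : 0 <= y by []. have z0 : 0 <= z by [].
have h1 : x * x <= (2 ^+ 18 * (E ^+ 2 * (g * m%:R))) * (2 ^+ 18 * (E ^+ 2 * (g * m%:R))).
  exact: ler_pM.
have h2 : y * z <= (2 ^+ 5 * (g * m%:R)) * (2 ^+ 11 * (g * m%:R)) by apply: ler_pM.
have -> : 100 * x * x * m%:R * y * z = 100 * m%:R * ((x * x) * (y * z)) by ring.
apply: (@le_trans _ _ (2 ^+ 7 * m%:R * ((2 ^+ 18 * (E ^+ 2 * (g * m%:R))) * (2 ^+ 18 * (E ^+ 2 *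
  (g * m%:R)))
    * ((2 ^+ 5 * (g * m%:R)) * (2 ^+ 11 * (g * m%:R)))))).
  apply: ler_pM; [exact: mulr_ge0 | by rewrite !mulr_ge0 | | ].
    have -> : 2 ^+ 7 = 128 :> R by ring.
    by apply: ler_wpM2r => //; lra.
  by apply: ler_pM => //; exact: mulr_ge0.
apply: (@le_trans _ _ (g ^+ 4 * E ^+ 4 * (2 ^+ 59 * m%:R ^+ 5))).
  rewrite le_eqVlt; apply/orP; left; apply/eqP.
  have -> : 2 ^+ 59 = 2 ^+ 7 * (2 ^+ 18 * (2 ^+ 18 * (2 ^+ 5 * 2 ^+ 11))) :> R.
    by rewrite -!exprD.
  move: (2 ^+ 7) (2 ^+ 18) (2 ^+ 5) (2 ^+ 11) => c1 c2 c3 c4; ring.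
apply: ler_wpM2r; first by rewrite mulr_ge0 // exprn_ge0.
by apply: ler_wpM2l => //; rewrite exprn_ge0 //; lra.
Qed.

Lemma failure_bound (R : realType) Q N : (0 < Q)%N ->
  (1 - (4 * Q%:R)^-1 / 2) ^+ rounds_number Q N * 2 ^+ N <= 1 / 3 :> R.
Proof.
move=> Q0; have QR : 0 < Q%:R :> R by rewrite ltr0n.
have Q1 : 1 <= Q%:R :> R by rewrite ler1n.
set s := (4 * Q%:R)^-1 / 2.
have sE : s = (8 * Q%:R)^-1 by rewrite /s; field; rewrite gt_eqF.
have s1 : 0 <= 1 - s.
  by rewrite subr_ge0 sE invf_le1 ?mulr_gt0 //; lra.
have h1 : (1 - s) ^+ rounds_number Q N <= expR (- (N%:R + 2)).
  have -> : - (N%:R + 2) = (rounds_number Q N)%:R * (- s).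
    by rewrite /rounds_number !natrM natrD sE; field; rewrite gt_eqF.
  by rewrite expRM_natl; apply: lerXn2r; rewrite ?nnegrE ?expR_ge0 //; apply: expR_ge1Dx.
have h2 : 2 ^+ N <= expR N%:R :> R.
  rewrite -[N%:R]mulr1 expRM_natl; apply: lerXn2r; rewrite ?nnegrE ?expR_ge0 //.
  by have := expR_ge1Dx (1 : R).
apply: (@le_trans _ _ (expR (- (N%:R + 2)) * expR N%:R)).
  by apply: ler_pM => //; exact: exprn_ge0.
rewrite -expRD opprD addrAC addNr add0r expRN div1r lef_pV2 ?posrE ?expR_gt0 //.
by have := expR_ge1Dx (2 : R); lra.
Qed.

(** From sublattices to answers: if the sublattice contains [x], its minimum is at most ||x||_p and
    the answer is good; if it misses [V], the answer is new. *)
Lemma round_progress (R : realType) (p q : \bar R) (gB : nat -> nat -> R) (O : oracle R)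
    n m (B : 'M[R]_(n, m)) (x : 'rV[R]_m) a k (V : seq 'rV[R]_m) :
  (1%:E <= p)%E -> (p <= q)%E -> (0 < n <= m)%N -> row_free B -> solves_SVP p gB O ->
  lattice B x -> x != 0 -> lpnorm q x <= 5 / 4 * lambda1 q (lattice B) ->
  0 <= gB n m -> 4 * (2 ^ a)%:R * gB n m * m%:R <= (2 ^ k)%:R -> (a < k)%N ->
  let good := good_vec p B (gB n m) x in
  let f u := O n m (sub_query B u) in
  (size V < 2 ^ a)%N -> (forall v, v \in V -> good v /\ ~ parallel x v) ->
  (4 * (2 ^ k)%:R)^-1 * (2 * (2 ^ k) ^ n)%:R <=
    #|[pred u : bool * {ffun 'I_n -> 'Z_(2 ^ k)} | `[< good (f u) /\ f u \notin V >]]|%:R :> R.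
Proof.
move=> p1 pq nm Bfree hO Lx x0 hx g0 hQ ak good f sV hV.
have n0 : (0 < n)%N by case/andP: nm.
have k0 : (0 < k)%N by apply: leq_ltn_trans ak.
have Q0 : (0 < 2 ^ k)%N by rewrite expn_gt0.
have k1 : (1 < 2 ^ k)%N by rewrite -{1}(expn0 2) ltn_exp2l.
have hV' : {in V, forall v, [/\ lattice B v, lpnorm p v <= gB n m * lpnorm p x &
     forall t : R, v <> t *: x]}.
  by move=> v /hV [[Lv v0 hv] npar]; split=> // t e; apply: npar; exists t.
have h := round_success p1 pq nm Bfree Lx x0 hx g0 hQ ak (ltnW sV) hV'.
have QR : 0 < 4 * (2 ^ k)%:R :> R by rewrite mulr_gt0 // ltr0n.
rewrite mulrC ler_pdivrMr // mulrC -natrM -natrM ler_nat.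
apply: leq_trans h _; rewrite leq_mul2l; apply/orP; right.
apply: subset_leq_card; apply/fintype.subsetP => u /asboolP [Lxu hVu]; apply/asboolT.
have [L0 L1 L2] := hO n m (sub_query B u) n0 (sub_basis_free _ _ (ltnW k1) Bfree).
split; last by apply/negP => /hVu; apply.
split; [exact: sub_basis_sub L0 | by rewrite -(lpnorm_gt0 _ p1) | ].
by apply: le_trans L2 _; rewrite ler_wpM2l // lambda1_le.
Qed.

Lemma best_output (R : realType) (q : \bar R) m n (B : 'M[R]_(n, m)) T
    (pool : nat -> nat -> R) (pv : nat -> 'rV[R]_m) (best : R) (s : state R) (bd : R) i j :
  (1%:E <= q)%E -> (forall t x (xm : (x < m)%N), (t <= T)%N -> pool t x = pv t 0 (Ordinal xm)) ->
  (forall t, (t <= T)%N -> lattice B (pv t)) ->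
  best_so_far (inv_exponent q) m pool (fun i j => (i <= T)%N /\ (j <= T)%N) best (rmem s 2) ->
  (i <= T)%N -> (j <= T)%N -> pv i != pv j -> lpnorm q (pv i - pv j) <= bd ->
  [/\ lattice B (output m s), 0 < lpnorm q (output m s) & lpnorm q (output m s) <= bd].
Proof.
move=> q1 hpool hL hbest iT jT ne hbd.
have dE a b : (a <= T)%N -> (b <= T)%N -> forall x : 'I_m,
    pool a x - pool b x = (pv a - pv b) 0 x.
  move=> aT bT x; rewrite (hpool _ _ (ltn_ord x) aT) (hpool _ _ (ltn_ord x) bT) !mxE.
  by congr (pv a 0 _ - pv b 0 _); apply: val_inj.
have oE (x : 'I_m) : rmem s 2 x = (output m s) 0 x by rewrite mxE.
pose dij x := pool i x - pool j x.
have dijE : forall x : 'I_m, dij x = (pv i - pv j) 0 x by exact: dE.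
have [ij0 _] := key_upto_lpnorm q1 dijE dijE.
rewrite lpnorm_gt0 // subr_eq0 ne in ij0.
case: hbest => [[_ h]|[b0 hb [a [b [[aT bT] hab]]] h]].
  by have := h i j (conj iT jT); rewrite leNgt [X in ~~ X]ij0.
have [out0 outle] := key_upto_lpnorm q1 oE dijE.
split.
- have -> : output m s = pv a - pv b.
    by apply/rowP => x; rewrite -oE hab // dE.
  by apply: latticeB; apply: hL.
- by rewrite -out0 -hb.
- apply: le_trans hbd; rewrite -outle -hb.
  by case: (h i j (conj iT jT)) => //; rewrite leNgt [X in ~~ X]ij0.
Qed.

Lemma Forall_map (A C : Type) (P : C -> Prop) (f : A -> C) (l : seq A) :
  (forall x, P (f x)) -> List.Forall P [seq f x | x <- l].
Proof. by move=> h; elim: l => [|x l IH] /=; constructor. Qed.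

(** Ensures that N coins supply all T rounds, so that no round reads the default bit [false]. *)
Lemma coins_le_cost n m a kk : (0 < n <= m)%N ->
  (rounds_number (2 ^ kk) (2 ^ a) * round_bits n kk <= main_cost m a kk)%N.
Proof.
move=> /andP [n0 nm]; rewrite /main_cost; set T := rounds_number _ _; set U := step_cost _.
have U0 : (0 < U)%N := step_cost_gt0 _.
apply: (@leq_trans (100 * T.+2 * T.+2 * (m * (m + a + kk + 6)))); last first.
  by rewrite mulnA leq_pmulr.
have hT : (T <= 100 * T.+2 * T.+2)%N.
  by clear U U0; move: T => T; nia.
apply: leq_mul => //.
apply: (@leq_trans (m * kk.+1)); last by rewrite leq_mul2l; apply/orP; right; lia.
rewrite /round_bits mulnS; apply: leq_add; first exact: leq_trans nm.
by rewrite leq_mul2r nm orbT.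
Qed.

Lemma sum_le_card (R : realType) (I : finType) (b P : pred I) :
  (forall i, b i -> P i) -> \sum_i (b i)%:R <= #|P|%:R :> R.
Proof.
move=> h; have -> : \sum_i (b i)%:R = #|b|%:R :> R.
  rewrite -sum1_card natr_sum [RHS]big_mkcond; apply: eq_bigr => i _.
  by rewrite (_ : (i \in b) = b i) //; case: (b i).
by rewrite ler_nat; apply: subset_leq_card; apply/fintype.subsetP.
Qed.

Lemma nat_above (R : realType) (x : R) : exists N : nat, x <= N%:R.
Proof.
exists (Num.bound `|x|); apply: le_trans (ler_norm x) _.
exact: ltW (archi_boundP (normr_ge0 x)).
Qed.

Theorem theorem3p2 (R : realType) (p q : \bar R)
    (eps gamma : nat -> nat -> R)
    (hp : (1%:E <= p)%E) (hpq : (p <= q)%E)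
    (heps : forall n m : nat, (0 < n <= m)%N -> 0 < eps n m < 1 / 100)
    (heps_comp : efficiently_computable eps)
    (hgamma : forall n m : nat, (0 < n <= m)%N -> 1 <= gamma n m) :
  exists (c : cmd) (C k : nat),
    SVP_reduction p q
      (fun n m => 100 * (ln (1 / eps n m)) `^ inv_exponent p * gamma n m
                  / (eps n m) `^ inv_exponent p)
      gamma
      (fun n m => gamma n m ^+ 4 * 2 `^ (eps n m * m%:R)
                  * (C%:R * m%:R ^+ k))
      c.
Proof.
have hq : (1%:E <= q)%E by apply: le_trans hpq.
case: heps_comp => c0 [C0 [k0 [pc hc0]]].
have [C1 hC1] := nat_above (2 ^+ 59 : R).
(* [C1] and m^5 pay for the main program; the program for eps, run with precision m, takes time C0
   (2 m)^k0. *)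
exists (main_cmd c0), (C1 + C0 * 2 ^ k0)%N, (5 + k0)%N.
move=> O hO n m B n0 Bfree start.
have nm : (0 < n <= m)%N by rewrite n0 -(eqP Bfree) rank_leq_col.
have m0 : (0 < m)%N by case/andP: nm => ? ?; apply: leq_trans n0 _.
have [s0 [ex0 clk0 he']] := hc0 n m m nm.
have he := heps _ _ nm; have hg := hgamma _ _ nm.
set e := eps n m in he he' *; set g := gamma n m in hg start *; set e' := rmem s0 _ _ in he'.
have [a ha] := first_powP (expR (e' * m%:R / 8 + 1)).
have [kk hk] := first_powP (4 * (2 ^ a)%:R * g * m%:R).
pose T := rounds_number (2 ^ kk) (2 ^ a).
pose L := round_bits n kk.
pose N := (main_cost m a kk + clock s0)%N.
have m1 : 1 <= m%:R :> R by rewrite ler1n.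
have g0 : 0 <= g by apply: le_trans hg.
have hQ : 4 * (2 ^ a)%:R * g * m%:R <= (2 ^ kk)%:R by rewrite hk ?eqxx.
have akk : (a < kk)%N.
  rewrite -(@ltn_exp2l 2) // -(ltr_nat R); apply: lt_le_trans hQ.
  have gm1 : 1 <= g * m%:R by rewrite mulr_ege1.
  have a1 : 1 <= (2 ^ a)%:R :> R by rewrite ler1n expn_gt0.
  rewrite -mulrA; nra.
have kk0 : (0 < kk)%N by apply: leq_ltn_trans akk.
have ha' : expR (e * m%:R / 8) <= (2 ^ a)%:R.
  have h : expR (e' * m%:R / 8 + 1) <= (2 ^ a)%:R by rewrite ha ?eqxx.
  by apply: le_trans h; rewrite ler_expR; have /andP [] := eps_exponent he'.
have c1 : 1 < 5 / 4 :> R by lra.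
have [x [Lx x0 hx]] := near_shortest hq n0 Bfree c1.
pose f (u : bool * {ffun 'I_n -> 'Z_(2 ^ kk)}) := O n m (sub_query B u).
pose good := good_vec p B g x.
have hrun (w : seq bool) := @run_main R O c0 n m a kk
  [:: inv_exponent p; inv_exponent q; g] B w s0 nm pc ex0 ha hk.
have TL : (T * L <= N)%N by apply: leq_trans (coins_le_cost a kk nm) (leq_addr _ _).
exists N; split.
- rewrite /N natrD.
  have gE1 : 1 <= g ^+ 4 * 2 `^ (e * m%:R).
    apply: mulr_ege1; first exact: exprn_ege1.
    have em0 : 0 <= e * m%:R by case/andP: he => e0 _; apply: mulr_ge0 => //; apply: ltW.
    apply: le_trans (powR2_ge em0); rewrite -[X in X <= _]expR0 ler_expR.
    by apply: divr_ge0.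
  have h1 := main_cost_le m0 hg he he' ha hk.
  have m5 : m%:R ^+ 5 <= m%:R ^+ (5 + k0) :> R by apply: ler_weXn2l => //; apply: leq_addr.
  have mk : m%:R ^+ k0 <= m%:R ^+ (5 + k0) :> R by apply: ler_weXn2l => //; apply: leq_addl.
  have h2 : (clock s0)%:R <= (C0 * 2 ^ k0)%:R * m%:R ^+ k0 :> R.
    have -> : (C0 * 2 ^ k0)%:R * m%:R ^+ k0 = (C0 * (m + m) ^ k0)%:R :> R.
      by rewrite -natrX -natrM addnn -mul2n expnMn mulnA.
    by rewrite ler_nat.
  set X := g ^+ 4 * _ in gE1 h1 *.
  rewrite natrD mulrDl mulrDr; apply: lerD.
    apply: le_trans h1 _; apply: ler_wpM2l; first by lra.
    by apply: ler_pM => //; apply: exprn_ge0.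
  apply: (@le_trans _ _ ((C0 * 2 ^ k0)%:R * m%:R ^+ (5 + k0))).
    by apply: le_trans h2 _; apply: ler_wpM2l.
  by rewrite ler_peMl // mulr_ge0 // exprn_ge0.
- move=> w; have [s [ex [hasked _] clk]] := hrun w; exists s; split=> //.
  rewrite hasked; apply: Forall_map => t; exists (sub_query B (decode_coins n kk (drop
    (round_start n kk t) w))).
  rewrite query_mxE //; split=> //.
    by apply: sub_basis_free => //; rewrite expn_gt0.
  by move=> y; apply: sub_basis_sub.
pose fail (w : seq bool) := ~~ `[< found good (parallel x) (2 ^ a) (draws f T w) >].
have Q0 : (0 < 2 ^ kk)%N by rewrite expn_gt0.
have hfail : avg N (fun w => (fail w)%:R) <= 1 / 3 :> R.
  (* Only the first T L coins decide failure; averaging over the others changes nothing. *)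
  rewrite -(subnKC TL) avg_cat.
  apply: le_trans (failure_bound R (2 ^ a) Q0).
  rewrite (@eq_avg _ _ _ (fun u => (fail u)%:R)) => [|u su]; last first.
    rewrite (@eq_avg _ _ _ (fun=> (fail u)%:R)) => [|w _]; first by rewrite avg_cst.
    by rewrite /fail draws_cat.
  pose r : R := (4 * (2 ^ kk)%:R)^-1.
  have s01 : 0 <= r <= 1.
    have h1 : 1 <= (2 ^ kk)%:R :> R by rewrite ler1n.
    have h4 : 0 < 4 * (2 ^ kk)%:R :> R by lra.
    apply/andP; split; first by rewrite invr_ge0 ltW.
    by rewrite /r invf_le1 //; lra.
  have := @boosting R _ good (parallel x) n kk (2 ^ a) f _ kk0 s01
    (fun V sV hV => round_progress hp hpq nm Bfree hO Lx x0 hx g0 hQ akk sV hV) T [::].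
  by rewrite subn0; apply.
have hsum : 2 / 3 * 2 ^+ N <= \sum_(w : N.-tuple bool) (~~ fail w)%:R :> R.
  have := avg_sum N (fun w => (fail w)%:R : R).
  have hall : \sum_(w : N.-tuple bool) (1 : R) = 2 ^+ N.
    by rewrite sumr_const card_tuple card_bool natrX.
  have -> : \sum_(w : N.-tuple bool) (~~ fail w)%:R =
      2 ^+ N - \sum_(w : N.-tuple bool) (fail w)%:R :> R.
    by rewrite -hall -sumrB; apply: eq_bigr => w _; case: (fail w); rewrite ?subrr ?subr0.
  move=> <-; have p0 : 0 <= 2 ^+ N :> R by apply: exprn_ge0.
  have := ler_wpM2l p0 hfail; lra.
apply: le_trans hsum _.
(* From here on the coins are fixed: outside the failure event the output is a solution with
   certainty. *)
apply: sum_le_card => w hf; apply/asboolT.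
have {hf} hf : found good (parallel x) (2 ^ a) (draws f T w) by move/negPn/asboolP: hf.
have [s [ex [_ [pool [hpool hbest]]] _]] := hrun w; exists s => //.
have [v [v' [vP v'P ne hvv]]] := winner hp hpq nm Bfree x0 hx hg he ha' hf.
set pv := pool_vec O n m (2 ^ kk) kk _ w in hpool.
have pvE t : (t < T)%N -> pv t.+1 = f (decode_coins n kk (drop (round_start n kk t) w)).
  by move=> tT; rewrite /pv /= query_mxE.
have pvL t : (t <= T)%N -> lattice B (pv t).
  case: t => [|t] tT; first exact: lattice0.
  rewrite pvE //.
  have k1 : (0 < 2 ^ kk)%N by rewrite expn_gt0.
  have [L0 _ _] := hO n m _ n0 (sub_basis_free
    (decode_coins n kk (drop (round_start n kk t) w)).1
    (fun i => (decode_coins n kk (drop (round_start n kk t) w)).2 i) k1 Bfree).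
  exact: sub_basis_sub L0.
have pool_index z : z \in 0 :: draws f T w -> exists2 t, (t <= T)%N & pv t = z.
  rewrite inE => /orP [/eqP ->|/mapP [t]]; first by exists 0%N.
  by rewrite mem_iota add0n => /= tT ->; exists t.+1 => //; rewrite pvE.
have [i iT iE] := pool_index _ vP; have [j jT jE] := pool_index _ v'P.
rewrite -iE -jE in ne hvv.
exact: (best_output hq hpool pvL hbest iT jT ne hvv).
Qed.
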